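(* Let $d\ge2$ and $p\in[1,\infty)$, and let $f^{\mathrm{cone}}:\mathbb{R}^d\to\mathbb{R}$, $f^{\mathrm{cone}}(x):=(1-|x|)_+$. Let $f_1,f_2\in L^1_{\mathrm{loc}}(\mathbb{R}^d)$ have bounded Hessian--Schatten variation in $\mathbb{R}^d$ and satisfy $$|\mathrm{D}^2_pf_1|(\mathbb{R}^d)=|\mathrm{D}^2_pf_2|(\mathbb{R}^d)=|\mathrm{D}^2_pf^{\mathrm{cone}}|(\mathbb{R}^d),$$ and suppose that for some $\lambda\in(0,1)$ $$f^{\mathrm{cone}}=\lambda f_1+(1-\lambda)f_2.$$ Then $f_1$ and $f_2$ are equal to $f^{\mathrm{cone}}$ up to affine terms: there exist affine functions $L_1,L_2:\mathbb{R}^d\to\mathbb{R}$ such that $f_i=f^{\mathrm{cone}}+L_i$ (as elements of $L^1_{\mathrm{loc}}(\mathbb{R}^d)$) for $i=1,2$.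
   Context: Here $|x|$ is the Euclidean norm, $t_+=\max\{t,0\}$, and $\mathscr{L}^d$ is Lebesgue measure on $\mathbb{R}^d$. Schatten norms: for $M\in\mathbb{R}^{d\times d}$ and $p\in[1,\infty]$, $|M|_p$ is the $\ell^p$ norm of the vector of singular values of $M$ (counted with multiplicity). Hessian--Schatten variation: for $p\in[1,\infty]$ with conjugate exponent $p^*$, $f\in L^1_{\mathrm{loc}}(\mathbb{R}^d)$ and $A\subseteq\mathbb{R}^d$ open, $$|\mathrm{D}^2_pf|(A):=\sup\Big\{\int_A\sum_{i,j=1}^d f\,\partial_i\partial_jF_{i,j}\,d\mathscr{L}^d:\ F\in C_c^\infty(A)^{d\times d},\ \sup_{x}|F(x)|_{p^*}\le1\Big\}.$$ The function $f$ has bounded Hessian--Schatten variation in $\mathbb{R}^d$ if $|\mathrm{D}^2_pf|(\mathbb{R}^d)<\infty$; by equivalence of matrix norms this does not depend on $p$. *)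

(* Defs.v *)
From HB Require Import structures.
From mathcomp Require Import all_boot all_order all_algebra.
From mathcomp Require Import all_classical all_reals all_analysis.
From mathcomp Require complex.

Set Implicit Arguments.
Unset Strict Implicit.
Unset Printing Implicit Defensive.

Import Order.TTheory GRing.Theory Num.Theory.
Import numFieldNormedType.Exports.

Local Open Scope classical_set_scope.
Local Open Scope ring_scope.

Definition measure_matrix_display : measure_display -> measure_display.
Proof. exact. Qed.

Section measurable_matrix.
Context {d} {T : measurableType d}.
Variables m n : nat.

(* The product sigma-algebra, as for n.-tuple T in the library; for T = R this
   is the Borel sigma-algebra of 'M[R]_(m, n). *)
Definition matrix_measurable : set (set 'M[T]_(m, n)) :=
  <<s \bigcup_(ij in [set: 'I_m * 'I_n])
        preimage_set_system setT (fun M : 'M[T]_(m, n) => M ij.1 ij.2)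
          measurable >>.

Let matrix_set0 : matrix_measurable set0.
Proof. exact: sigma_algebra0. Qed.

Let matrix_setC A : matrix_measurable A -> matrix_measurable (~` A).
Proof. exact: sigma_algebraC. Qed.

Let matrix_bigcup (F : _^nat) : (forall i, matrix_measurable (F i)) ->
  matrix_measurable (\bigcup_i F i).
Proof. exact: sigma_algebra_bigcup. Qed.

HB.instance Definition _ := @isMeasurable.Build (measure_matrix_display d)
  'M[T]_(m, n) matrix_measurable matrix_set0 matrix_setC matrix_bigcup.

Lemma measurable_coord (i : 'I_m) (j : 'I_n) :
  measurable_fun [set: 'M[T]_(m, n)] (fun M : 'M[T]_(m, n) => M i j).
Proof.
move=> _ Y mY; rewrite setTI; apply: sub_sigma_algebra.
by exists (i, j) => //; exists Y => //; rewrite setTI.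
Qed.

Lemma measurable_fun_coordP d' (U : measurableType d') (f : U -> 'M[T]_(m, n)) :
  (forall i j, measurable_fun [set: U] (fun x => f x i j)) ->
  measurable_fun [set: U] f.
Proof.
move=> mf _ Y; rewrite setTI /measurable /= => mY.
pose S := [set A | d'.-measurable (f @^-1` A)].
have sub : matrix_measurable `<=` S; last exact: sub mY.
apply: smallest_sub.
  split=> [|A|F mF]; rewrite /S /=.
  - by rewrite preimage_set0.
  - by move=> mA; rewrite setTD preimage_setC; exact: measurableC.
  - by rewrite preimage_bigcup; exact: bigcupT_measurable.
move=> A [[i j] _ [B mB <-]]; rewrite /S /= setTI.
by rewrite -[X in measurable X]setTI; exact: (mf i j).
Qed.

End measurable_matrix.

Section lebesgue_measure_rV.
Context {R : realType}.
Local Open Scope ereal_scope.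

Definition rV_cons n (p : R * 'rV[R]_n) : 'rV[R]_n.+1 :=
  \row_i (if unlift ord0 i is Some j then p.2 ord0 j else p.1).

Definition rV_uncons n (x : 'rV[R]_n.+1) : R * 'rV[R]_n :=
  (x ord0 ord0, \row_j x ord0 (lift ord0 j)).

Fixpoint lebesgue_measure_rV n : set 'rV[R]_n -> \bar R :=
  match n with
  | 0%N => \d_(0%R : 'rV[R]_0)
  | n'.+1 => pushforward (@lebesgue_measure R \x lebesgue_measure_rV (n := n'))
                         (@rV_cons n')
  end.

Lemma rV_consK n : cancel (@rV_cons n) (@rV_uncons n).
Proof.
case=> a v; rewrite /rV_uncons /rV_cons !mxE unlift_none; congr pair.
by apply/rowP => j; rewrite !mxE liftK.
Qed.

Lemma measurable_rV_cons n :
  measurable_fun [set: (measurableTypeR R * 'rV[R]_n)%type] (@rV_cons n).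
Proof.
apply: measurable_fun_coordP => i j.
have [k ->|->] := unliftP ord0 j.
- rewrite (_ : (fun _ => _) =
    (fun v : 'rV[R]_n => v ord0 k) \o snd); last first.
    by apply/funext => p; rewrite /= mxE liftK.
  by apply: measurableT_comp => //; exact: measurable_coord.
- rewrite (_ : (fun _ => _) = fst)//.
  by apply/funext => p; rewrite /= mxE unlift_none.
Qed.

Lemma measurable_rV_uncons n :
  measurable_fun setT (@rV_uncons n : _ -> (measurableTypeR R * 'rV[R]_n)%type).
Proof.
apply: measurable_fun_pair; first exact: measurable_coord.
apply: measurable_fun_coordP => i j.
under eq_fun do rewrite mxE.
exact: measurable_coord.
Qed.

Section step.
Variables (n : nat) (mu : {sigma_finite_measure set 'rV[R]_n -> \bar R}).

Let nu : set 'rV[R]_n.+1 -> \bar R :=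
  pushforward (@lebesgue_measure R \x mu) (@rV_cons n).

HB.instance Definition _ := Measure.copy nu
  (measure_function_pushforward__canonical__measure_function_Measure
    (@lebesgue_measure R \x mu) (@measurable_rV_cons n)).

Let nu_sigma_finite : sigma_finite setT nu.
Proof.
have /sigma_finiteP[F [TF ndF Foo]] := sigma_finiteT (@lebesgue_measure R).
have /sigma_finiteP[G [TG ndG Goo]] := sigma_finiteT mu.
exists (fun k => @rV_uncons n @^-1` (F k `*` G k)).
  rewrite -preimage_bigcup (_ : \bigcup_k _ = setT) ?preimage_setT//.
  apply/seteqP; split=> // -[x y] _.
  have [k _ Fkx] : (\bigcup_k F k) x by rewrite -TF.
  have [l _ Gly] : (\bigcup_k G k) y by rewrite -TG.
  exists (maxn k l) => //; split => /=.
  - by move: x Fkx; exact/subsetPset/ndF/leq_maxl.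
  - by move: y Gly; exact/subsetPset/ndG/leq_maxr.
move=> k; have [mF Fk] := Foo k; have [mG Gk] := Goo k; split.
  rewrite -[X in measurable X]setTI.
  by apply: measurable_rV_uncons => //; exact: measurableX.
rewrite /nu /pushforward -comp_preimage.
rewrite (_ : _ \o _ = id); last by apply/funext => x /=; rewrite rV_consK.
by rewrite preimage_id product_measure1E// lte_mul_pinfty// ge0_fin_numE.
Qed.

HB.instance Definition _ := Measure_isSigmaFinite.Build _ _ _ nu
  nu_sigma_finite.

Lemma lebesgue_measure_rV_step :
  exists mu' : {sigma_finite_measure set 'rV[R]_n.+1 -> \bar R},
    mu' = nu :> (set 'rV[R]_n.+1 -> \bar R).
Proof. by exists nu. Qed.

End step.

Lemma lebesgue_measure_rV_subproof n :
  exists mu : {sigma_finite_measure set 'rV[R]_n -> \bar R},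
    mu = @lebesgue_measure_rV n :> (set 'rV[R]_n -> \bar R).
Proof.
elim: n => [|n [mu IH]] /=; first by exists \d_(0%R : 'rV[R]_0).
by rewrite -IH; exact: lebesgue_measure_rV_step.
Qed.

Let lebesgue_measure_rV0 n : @lebesgue_measure_rV n set0 = 0.
Proof. by have [mu <-] := lebesgue_measure_rV_subproof n; exact: measure0. Qed.

Let lebesgue_measure_rV_ge0 n A : 0 <= @lebesgue_measure_rV n A.
Proof. by have [mu <-] := lebesgue_measure_rV_subproof n; exact: measure_ge0. Qed.

Let lebesgue_measure_rV_semi_sigma_additive n :
  semi_sigma_additive (@lebesgue_measure_rV n).
Proof.
have [mu <-] := lebesgue_measure_rV_subproof n.
exact: measure_semi_sigma_additive.
Qed.

HB.instance Definition _ n := isMeasure.Build _ _ _ (@lebesgue_measure_rV n)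
  (lebesgue_measure_rV0 n) (@lebesgue_measure_rV_ge0 n)
  (@lebesgue_measure_rV_semi_sigma_additive n).

Let lebesgue_measure_rV_sigma_finite n :
  sigma_finite setT (@lebesgue_measure_rV n).
Proof. by have [mu <-] := lebesgue_measure_rV_subproof n; exact: sigma_finiteT. Qed.

HB.instance Definition _ n := Measure_isSigmaFinite.Build _ _ _
  (@lebesgue_measure_rV n) (lebesgue_measure_rV_sigma_finite n).

Lemma lebesgue_measure_rV_box n (B : 'I_n -> set R) :
  (forall i, measurable (B i)) ->
  lebesgue_measure_rV [set x | forall i, B i (x ord0 i)] =
    \prod_(i < n) lebesgue_measure (B i).
Proof.
elim: n => [|n IH] in B *.
  move=> _; rewrite big_ord0 /= diracE mem_set//.
  by move=> -[].
move=> mB; have mB' i : measurable (B (lift ord0 i)) by exact: mB.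
rewrite big_ord_recl -(IH _ mB') /= /pushforward.
have mC : measurable [set x : 'rV[R]_n | forall i, B (lift ord0 i) (x ord0 i)].
  rewrite (_ : [set _ | _] = \bigcap_(i in [set: 'I_n])
    ((fun x : 'rV[R]_n => x ord0 i) @^-1` B (lift ord0 i))); last first.
    by apply/seteqP; split=> [x Bx i _|x Bx i]; [exact: Bx|exact: (Bx i)].
  apply: fin_bigcap_measurable => // i _.
  by rewrite -[X in measurable X]setTI; exact: measurable_coord.
have [mu muE] := lebesgue_measure_rV_subproof n.
rewrite -muE -product_measure1E//; last exact: (mB ord0).
congr (_ _); apply/seteqP; split => -[a v] /=.
- move=> h; split=> /= [|i]; first by have := h ord0; rewrite mxE unlift_none.
  by have := h (lift ord0 i); rewrite mxE liftK.
- move=> [/= ha hv] i; rewrite mxE /=.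
  by case: unliftP => [j ->|->].
Qed.

End lebesgue_measure_rV.
Arguments lebesgue_measure_rV {R} n.

Section singular_values.
Context {R : realType}.
Variable d : nat.
Implicit Types (M : 'M[R]_d) (s : 'rV[R]_d).

(* The entries of s are the square roots of the eigenvalues of M^T M, counted
   with multiplicity; this determines s up to the order of its entries. *)
Definition is_singular_values M s : Prop :=
  (forall i, 0 <= s ord0 i) /\
  char_poly (M^T *m M) = \prod_(i < d) ('X - (s ord0 i ^+ 2)%:P).

Definition singular_values M : 'rV[R]_d := xget 0 (is_singular_values M).

Import complex.
Local Open Scope sesquilinear_scope.

Lemma singular_values_exist M : exists s, is_singular_values M s.
Proof.
pose iC : {rmorphism R -> complex R} := real_complex R.
pose MC := map_mx iC M.
pose A := MC^T *m MC.
have conjMC : map_mx Num.conj MC = MC.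
  apply/matrixP => i j; rewrite !mxE; exact: (conjc_real (M i j)).
have Asym : A \is normalmx.
  apply/normalmxP.
  suff -> : A ^t* = A by [].
  by rewrite /A trmx_mul trmxK map_mxM -map_trmx conjMC.
have /orthomx_spectralP AE := Asym.
set S := spectralmx A in AE; set D := spectral_diag A in AE.
have Su : S \is unitarymx by exact: spectral_unitarymx.
have DE : diag_mx D = (S *m MC^T) *m (S *m MC^T)^t*.
  rewrite trmx_mul map_mxM trmxK conjMC mulmxA -(mulmxA S) -/A AE.
  rewrite invmx_unitary// !mulmxA.
  by rewrite (unitarymxP Su) mul1mx -mulmxA (unitarymxP Su) mulmx1.
have D0 i : 0 <= D ord0 i.
  have /matrixP/(_ i i) := DE; rewrite !mxE eqxx mulr1n => ->.
  by apply: sumr_ge0 => j _; rewrite !mxE mul_conjC_ge0.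
pose s : 'rV[R]_d := \row_i Num.sqrt (complex.Re (D ord0 i)).
exists s; split=> [i|]; first by rewrite mxE sqrtr_ge0.
apply: (@map_poly_inj _ _ iC).
rewrite map_char_poly map_mxM -map_trmx -/MC -/A AE.
transitivity (char_poly (diag_mx D)).
  have SV : S \in unitmx := unitarymx_unit Su.
  rewrite /char_poly /char_poly_mx.
  have -> : 'X%:M - map_mx polyC (invmx S *m diag_mx D *m S) =
    map_mx polyC (invmx S) *m ('X%:M - map_mx polyC (diag_mx D)) *m map_mx polyC S.
    rewrite mulmxBr mulmxBl !map_mxM; congr (_ - _).
    by rewrite scalar_mxC -mulmxA -map_mxM mulVmx// map_mx1 mulmx1.
  rewrite !det_mulmx mulrAC -det_mulmx -map_mxM mulVmx// map_mx1 det1 mul1r//.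
rewrite char_poly_trig ?diag_mx_is_trig// rmorph_prod; apply: eq_bigr => i _.
rewrite rmorphB /= map_polyX map_polyC; congr ('X - _%:P).
rewrite !mxE eqxx mulr1n sqr_sqrtr.
  have := D0 i; case: (D ord0 i) => a b.
  by rewrite lecE => /andP[/eqP /= -> _].
by have := D0 i; rewrite lecE => /andP[].
Qed.

Lemma singular_valuesP M : is_singular_values M (singular_values M).
Proof. exact: (xgetPex _ (singular_values_exist M)). Qed.

End singular_values.

Section schatten_norm.
Context {R : realType}.

Definition lp_norm (p : \bar R) n (s : 'rV[R]_n) : R :=
  match p with
  | q%:E => (\sum_i `|s ord0 i| `^ q) `^ q^-1
  | +oo%E => \big[Num.max/0]_i `|s ord0 i|
  | -oo%E => 0
  end.

Definition schatten_norm (p : \bar R) d (M : 'M[R]_d) : R :=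
  lp_norm p (singular_values M).

End schatten_norm.

Section hessian_schatten_variation.
Context {R : realType} {d : nat}.
Implicit Types (f g : 'rV[R]_d -> R) (A : set 'rV[R]_d).

Definition partial (i : 'I_d) g : 'rV[R]_d -> R :=
  fun x => 'D_(delta_mx ord0 i) g x.

(* All iterated partial derivatives exist everywhere and are continuous. *)
Definition smooth g : Prop := forall s : seq 'I_d,
  let Dg := foldr partial g s in
  continuous Dg /\ forall i x, derivable Dg x (delta_mx ord0 i).

(* C_c^oo(A)^{d x d}, each field being extended by 0 outside A. *)
Definition test_field A (F : 'rV[R]_d -> 'M[R]_d) : Prop :=
  [/\ forall i j, smooth (fun x => F x i j),
      compact (closure [set x | F x != 0]) &
      closure [set x | F x != 0] `<=` A].

Definition hessian_schatten_variation (p : \bar R) f A : \bar R :=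
  ereal_sup
    [set (\int[lebesgue_measure_rV d]_(x in A)
           (\sum_i \sum_j
              f x * partial i (partial j (fun y => F y i j)) x)%:E)%E
    | F in [set F | test_field A F /\
                    forall x, schatten_norm (hoelder_conjugate p) (F x) <= 1]].

Definition bounded_hessian_schatten_variation (p : \bar R) f : Prop :=
  (hessian_schatten_variation p f [set: 'rV[R]_d] < +oo)%E.

(* Elements of L^1_loc(R^d) are given by Borel representatives. *)
Definition locally_integrable_rV f : Prop :=
  measurable_fun [set: 'rV[R]_d] f /\
  forall K, compact K ->
    (\int[lebesgue_measure_rV d]_(x in K) `|f x|%:E < +oo)%E.

Definition affine (L : 'rV[R]_d -> R) : Prop :=
  exists (l : {linear 'rV[R]_d -> R^o}) (c : R), forall x, L x = l x + c.

(* The norm `|x| of the library is the maximum norm. *)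
Definition euclidean_norm (x : 'rV[R]_d) : R :=
  Num.sqrt (\sum_i x ord0 i ^+ 2).

Definition fcone (x : 'rV[R]_d) : R := Num.max (1 - euclidean_norm x) 0.

End hessian_schatten_variation.

(* Main.v *)
(* Let T_f(E) denote the integral of f against the sum of the second derivatives
   d_i d_j E_ij, so that the variation of f is the supremum V of T_f over the
   admissible fields E, those of dual Schatten norm at most 1. As the cone is
   a convex combination of f1 and f2, a field almost maximizing T_cone almost
   maximizes T_f1; hence T_f1(H) is at most of order e whenever E + H is
   admissible and E maximizes T_cone up to e.
   - Outside the ball, E may be cut off freely, so f1 is affine near each
     exterior point. After subtracting an affine function, it vanishes on a
     half-space, and then on the whole exterior: a translated (or dilated) test
     function pairs with f1 as an affine function of the parameter.
   - Inside the ball, E may be replaced near any interior shell by the extremal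
     field F = - c (1 - x x^T / |x|^2). Rotating F keeps its Schatten norm and a
     radial perturbation t x x^T changes it by o(t), so T_f1 vanishes on all
     fields phi e_k x^T. This says that u(s x) - s u(x) is constant in the ball,
     equal to kap (1 - s).
   - A second difference of step h bounds the mass of u in the shell
     1 - h < |x| < 1 by O(h^2), whereas u - kap (1 - |x|), being homogeneous of
     degree one, has mass of order h there unless it is 0. Equality of the
     variations then gives kap = 1. *)
From HB Require Import structures.
From mathcomp Require Import all_boot all_order all_algebra.
From mathcomp Require Import all_classical all_reals all_analysis.
From mathcomp Require Import measurable_realfun ring lra.
Require Import Defs.

Set Implicit Arguments.
Unset Strict Implicit.
Unset Printing Implicit Defensive.

Import Order.TTheory GRing.Theory Num.Theory.
Import numFieldNormedType.Exports.

Local Open Scope classical_set_scope.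
Local Open Scope ring_scope.

(** * A flat function and smooth steps *)

Section flat.
Context {R : realType}.
Implicit Types (t x : R) (n : nat) (p : {poly R}).

(** The supremum V is only approached by smooth fields: the extremal field is singular at the origin
    and is prescribed only inside the ball, while the cone also has curvature concentrated on the
    sphere. Hence almost maximizing fields are modified only on shells away from both, and what is
    left near the origin or the sphere is estimated by the bound |T(G)| <= C sup |G|, in which
    derivatives of cutoffs do not enter. Norms of sums of fields are evaluated only where one
    summand vanishes or where the sum has explicit singular values. With d = n + 1 and q dual to p,
    the constant c is n^(-1/q): it gives the n nonzero singular values of the extremal field l^q
    norm 1. As p is finite, q > 1, and a radial eigenvalue t changes the norm to (1 + |t|^q)^(1/q) =
    1 + o(t), or to max(1, |t|) if q is infinite; for q = 1 the change would be of first order.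
    Rotating the field in direction A yields A (1 - x x^T / |x|^2); the constant skew part A pairs
    to zero by symmetry of second derivatives, which leaves A x x^T. These fields and the multiples
    of x x^T span all e_k x^T. *)

Lemma poly_le_expR p a : 0 < a ->
  exists2 C, 0 <= C & forall x, 0 <= x -> `|p.[x]| <= C * expR (a * x).
Proof.
elim/poly_ind: p a => [|p c IH] a a0.
  by exists 0 => // x _; rewrite horner0 normr0 mul0r.
(* Half of the rate is left to the induction hypothesis; the other half absorbs the new factor x
   through [a / 2 * x <= expR (a / 2 * x)]. *)
have a20 : 0 < a / 2 by rewrite divr_gt0.
have [C C0 HC] := IH _ a20.
exists (C * (2 / a) + `|c|) => [|x x0].
  by rewrite addr_ge0// mulr_ge0// divr_ge0// ltW.
rewrite hornerMXaddC (le_trans (ler_normD _ _))// mulrDl lerD//; last first.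
  rewrite ler_peMr// -[leLHS]expR0 ler_expR mulr_ge0// ltW//.
rewrite normrM (ger0_norm x0).
have -> : a * x = a / 2 * x + a / 2 * x by field.
rewrite expRD mulrACA ler_pM// ?HC//.
have h : a / 2 * x <= expR (a / 2 * x).
  by rewrite (le_trans _ (expR_ge1Dx _))// lerDr.
rewrite [leLHS](_ : _ = 2 / a * (a / 2 * x)); last by field; rewrite gt_eqF.
by rewrite ler_wpM2l// divr_ge0// ltW.
Qed.

(** The derivative of P(1/t) exp(-1/t) is t^-2 (P - P')(1/t) exp(-1/t), whence the recursion. *)
Fixpoint flat_poly n : {poly R} :=
  if n is m.+1 then 'X^2 * (flat_poly m - (flat_poly m)^`()) else 1.

(* [flat 0] is the function exp(-1/t) extended by 0 to t <= 0, and [flat n] its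
   n-th derivative. *)
Definition flat n t : R :=
  if 0 < t then (flat_poly n).[t^-1] * expR (- t^-1) else 0.

Lemma flat_is_derive n t : is_derive t 1 (flat n) (flat n.+1 t).
Proof.
have [t0|t0|<-] := ltgtP 0 t.
- have -> : flat n.+1 t =
    (flat_poly n)^`().[t^-1] * (- t ^- 2) * expR (- t^-1)
     + (flat_poly n).[t^-1] * (expR (- t^-1) * t ^- 2).
    rewrite /flat t0 /= hornerM hornerXn hornerD hornerN -exprVn; ring.
  apply: (@near_eq_is_derive R R R
     (fun s => (flat_poly n).[s^-1] * expR (- s^-1))).
    by near=> s; rewrite /flat ifT//; near: s; exact: lt_nbhsr.
  have tn0 : t != 0 by rewrite gt_eqF.
  have dV : is_derive t 1 (fun s : R => s^-1) (- t ^- 2).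
    apply: DeriveDef; first exact: derivableV.
    by rewrite deriveV// derive_id /GRing.scale/= mulr1.
  have dp : is_derive t 1 (fun s => (flat_poly n).[s^-1])
      ((flat_poly n)^`().[t^-1] * (- t ^- 2)).
    exact: (is_derive1_comp (f := horner (flat_poly n))).
  have de : is_derive t 1 (fun s : R => expR (- s^-1)) (expR (- t^-1) * t ^- 2).
    rewrite -[t ^- 2]opprK.
    apply: (is_derive1_comp (f := expR) (g := fun s : R => - s^-1)).
  apply: is_derive_eq; rewrite /GRing.scale/= addrC; congr (_ + _).
  by rewrite mulrC.
- rewrite (_ : flat n.+1 t = 0) ?/flat ?ltNge ?(ltW t0)//.
  apply: (@near_eq_is_derive R R R (cst 0)).
    near=> s; rewrite /cst ifF//; apply/negbTE.
    by rewrite -leNgt; near: s; exact: lt_le_nbhsl.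
- rewrite (_ : flat n.+1 0 = 0) ?/flat ?ltxx//.
  (* For h > 0 the difference quotient at 0 is h * (h^-2 P(1/h)) * exp(-1/h), at most C h by the
     exponential bound on X^2 P. *)
  have [C C0 HC] := @poly_le_expR ('X^2 * flat_poly n) 1 ltr01.
  suff H : h^-1 *: (flat n (h *: 1 + 0) - flat n 0) @[h --> 0^'] --> (0 : R).
    apply: DeriveDef; first by apply/cvg_ex; exists 0.
    exact: cvg_lim H.
  apply/cvgrPdist_le => e e0; near=> h.
  rewrite sub0r normrN addr0 /GRing.scale/= mulr1 {2}/flat ltxx subr0 /flat.
  case: ifPn => h0; last by rewrite mulr0 normr0 ltW.
  have := HC h^-1; rewrite invr_ge0 (ltW h0) => /(_ isT).
  rewrite hornerM hornerXn mul1r => HC'.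
  have -> : h^-1 * ((flat_poly n).[h^-1] * expR (- h^-1)) =
     h * (h^-1 ^+ 2 * (flat_poly n).[h^-1]) / expR h^-1.
    rewrite expRN; field.
    by rewrite !gt_eqF ?expR_gt0.
  rewrite normrM normfV (gtr0_norm (expR_gt0 _)) normrM (gtr0_norm h0).
  rewrite ler_pdivrMr ?expR_gt0//.
  rewrite (le_trans (ler_wpM2l (ltW h0) HC'))//.
  rewrite mulrA ler_wpM2r ?expR_ge0//.
  rewrite (le_trans (ler_wpM2l (ltW h0) (_ : C <= C + 1))) ?lerDl//.
  rewrite -ler_pdivlMr ?ltr_wpDl// (le_trans (ler_norm _))//.
  by near: h; apply: dnbhs0_le; rewrite divr_gt0// ltr_wpDl.
Unshelve. all: by end_near. Qed.

Definition e0 t : R := flat 0 t.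

Lemma e0E t : e0 t = if 0 < t then expR (- t^-1) else 0.
Proof. by rewrite /e0 /flat hornerC mul1r. Qed.

Lemma e0_ge0 t : 0 <= e0 t.
Proof. by rewrite e0E; case: ifP => // _; exact: expR_ge0. Qed.

Lemma e0_gt0 t : (0 < e0 t) = (0 < t).
Proof. by rewrite e0E; case: ifP => // _; rewrite ?ltxx ?expR_gt0. Qed.

Lemma e0_eq0 t : t <= 0 -> e0 t = 0.
Proof. by rewrite e0E ltNge => ->. Qed.

Definition step t : R := e0 t / (e0 t + e0 (1 - t)).

Lemma step_den t : 0 < e0 t + e0 (1 - t).
Proof.
have [t0|t0] := ltP 0 t; first by rewrite ltr_wpDr ?e0_ge0// e0_gt0.
by rewrite ltr_wpDl ?e0_ge0// e0_gt0 subr_gt0 (le_lt_trans t0).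
Qed.

Lemma step_itv t : 0 <= step t <= 1.
Proof.
rewrite /step divr_ge0 ?e0_ge0//= ?(ltW (step_den t))//.
by rewrite ler_pdivrMr ?step_den// mul1r lerDl e0_ge0.
Qed.

Lemma step_eq0 t : t <= 0 -> step t = 0.
Proof. by move=> t0; rewrite /step e0_eq0// mul0r. Qed.

Lemma step_eq1 t : 1 <= t -> step t = 1.
Proof.
move=> t1; rewrite /step (@e0_eq0 (1 - t)) ?subr_le0// addr0 divff//.
by rewrite gt_eqF// e0_gt0 (lt_le_trans _ t1).
Qed.

End flat.

(** * A class of smooth functions closed under partial derivatives *)

Section smooth_class.
Context {R : realType} {d : nat}.
Local Notation rV := 'rV[R]_d.
Implicit Types (f g : rV -> R) (x y v : rV) (i j : 'I_d).

(** A syntactic class that contains every cutoff and field entry constructed below. Smoothness and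
    the symmetry of second derivatives follow by induction on the constructors. All [flat n] are
    included because differentiation raises n; inverses and square roots ask for a global sign
    condition, so singular functions have to be regularized before they enter. *)
Inductive cls : (rV -> R) -> Prop :=
| cls_cst c : cls (fun=> c)
| cls_coord i : cls (fun x => x ord0 i)
| clsD f g : cls f -> cls g -> cls (fun x => f x + g x)
| clsM f g : cls f -> cls g -> cls (fun x => f x * g x)
| clsV f : cls f -> (forall x, f x != 0) -> cls (fun x => (f x)^-1)
| cls_flat f n : cls f -> cls (fun x => flat n (f x))
| cls_sqrt f : cls f -> (forall x, 0 < f x) -> cls (fun x => Num.sqrt (f x)).

Lemma is_diff_partial f x (df : rV -> R) i :
  is_diff x f df -> partial i f x = df (delta_mx ord0 i).
Proof. by move=> h; rewrite /partial deriveE ?diff_val//; exact: ex_diff. Qed.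

Definition gradf (f : rV -> R) x v := \sum_i v ord0 i * partial i f x.

Lemma diff_gradf f x : differentiable f x -> 'd f x = gradf f x :> (rV -> R).
Proof.
move=> df; apply/funext => v; rewrite {1}(row_sum_delta v) linear_sum /gradf.
by apply: eq_bigr => i _; rewrite linearZ /partial deriveE.
Qed.

Lemma is_diff_coord i x : is_diff x (fun y : rV => y ord0 i) (fun v => v ord0 i).
Proof.
have df : differentiable (fun y : rV => y ord0 i) x by exact: differentiable_coord.
apply: DiffDef => //.
pose l (y : rV) := y ord0 i.
have ll : linear l by move=> a u w; rewrite /l !mxE.
pose L := GRing.isLinear.Build _ _ _ _ l ll.
pose LL : {linear rV -> R^o} := HB.pack l L.
rewrite -[LHS]/('d LL x : _ -> _) diff_lin//.
exact: coord_continuous.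
Qed.

Lemma cls_diff f : cls f -> forall x, differentiable f x.
Proof.
elim=> [c x|i x|g h _ dg _ dh x|g h _ dg _ dh x|g _ dg g0 x|g n _ dg x|g _ dg g0 x].
- exact: differentiable_cst.
- exact: differentiable_coord.
- exact: differentiableD.
- exact: differentiableM.
- exact: differentiableV.
- apply: differentiable_comp => //.
  by apply/derivable1_diffP; have [] := flat_is_derive n (g x).
- apply: differentiable_comp => //.
  by apply/derivable1_diffP; have [] := is_derive1_sqrt (g0 x).
Qed.

Lemma two_sqrt_neq0 (t : R) : 0 < t -> 2 * Num.sqrt t != 0.
Proof. by move=> t0; rewrite mulf_neq0// gt_eqF ?sqrtr_gt0. Qed.

Lemma partial_cst c i : partial i (fun=> c : R) = fun=> 0.
Proof. by apply/funext => x; rewrite /partial derive_cst. Qed.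

Lemma partial_coord i j : partial i (fun x : rV => x ord0 j) = fun=> (i == j)%:R.
Proof.
apply/funext => x; rewrite (is_diff_partial i (is_diff_coord j x)) mxE eqxx/=.
by rewrite eq_sym.
Qed.

Section partial_rules.
Variables (f g : rV -> R) (i : 'I_d) (x : rV).
Hypotheses (df : derivable f x (delta_mx ord0 i)) (dg : derivable g x (delta_mx ord0 i)).

Lemma partialD : partial i (fun x => f x + g x) x = partial i f x + partial i g x.
Proof. by rewrite /partial -deriveD. Qed.

Lemma partialM :
  partial i (fun x => f x * g x) x = f x * partial i g x + g x * partial i f x.
Proof. exact: deriveM. Qed.

Lemma partialV : f x != 0 ->
  partial i (fun x => (f x)^-1) x = - (f x)^-1 * (f x)^-1 * partial i f x.
Proof.
by move=> f0; rewrite mulNr -invfM -expr2; exact: deriveV.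
Qed.

(** Only a directional derivative of f is assumed, so the one-variable chain rule is applied along
    the line t -> t v + x. *)
Lemma partial_comp (h : R -> R) a : is_derive (f x) 1 h a ->
  derivable (fun x => h (f x)) x (delta_mx ord0 i) /\
  partial i (fun x => h (f x)) x = a * partial i f x.
Proof.
move=> dh; pose v : rV := delta_mx ord0 i.
have /derivable1P df1 : derivable f x (delta_mx ord0 i) by exact: df.
have e0 : (0 *: v + x) = x by rewrite scale0r add0r.
have d1 : is_derive (0:R) 1 (fun t : R => f (t *: v + x)) (partial i f x).
  apply: DeriveDef => //.
  rewrite /partial /derive; set g1 := fun h => h^-1 *: _; set g2 := fun h => h^-1 *: _.
  suff -> : g1 = g2 by [].
  by apply/funext => t; rewrite /g1 /g2 /= !addr0 e0 [t *: 1]mulr1.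
have dh' : is_derive (f (0 *: v + x)) 1 h a by rewrite e0.
have [d2 e2] := is_derive1_comp (f := h) (g := fun t => f (t *: v + x)) dh' d1.
split; first by apply/derivable1P.
rewrite -e2 /partial /derive; set g1 := fun h => h^-1 *: _; set g2 := fun h => h^-1 *: _.
suff -> : g1 = g2 by [].
by apply/funext => t; rewrite /g1 /g2 /= !addr0 e0 [t *: 1]mulr1.
Qed.
End partial_rules.

Lemma cls_derivable f x v : cls f -> derivable f x v.
Proof. by move=> cf; apply/diff_derivable/cls_diff. Qed.

Lemma partial_flat f n i : cls f ->
  partial i (fun x => flat n (f x)) = fun x => flat n.+1 (f x) * partial i f x.
Proof.
move=> cf; apply/funext => x.
by have [] := partial_comp (@cls_derivable f x (delta_mx ord0 i) cf)
  (flat_is_derive n (f x)).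
Qed.

Lemma partial_sqrt f i : cls f -> (forall x, 0 < f x) ->
  partial i (fun x => Num.sqrt (f x)) =
    fun x => (2 * Num.sqrt (f x))^-1 * partial i f x.
Proof.
move=> cf f0; apply/funext => x.
by have [] := partial_comp (@cls_derivable f x (delta_mx ord0 i) cf)
  (is_derive1_sqrt (f0 x)).
Qed.

Lemma partialDE f g i : cls f -> cls g ->
  partial i (fun x => f x + g x) = fun x => partial i f x + partial i g x.
Proof. by move=> cf cg; apply/funext => x; rewrite partialD//; exact: cls_derivable. Qed.

Lemma partialME f g i : cls f -> cls g ->
  partial i (fun x => f x * g x) = fun x => f x * partial i g x + g x * partial i f x.
Proof. by move=> cf cg; apply/funext => x; rewrite partialM//; exact: cls_derivable. Qed.

Lemma partialVE f i : cls f -> (forall x, f x != 0) ->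
  partial i (fun x => (f x)^-1) = fun x => -1 * (f x)^-1 * (f x)^-1 * partial i f x.
Proof.
move=> cf f0; apply/funext => x; rewrite partialV// ?mulN1r//.
exact: cls_derivable.
Qed.

Lemma cls_partial f i : cls f -> cls (partial i f).
Proof.
elim=> [c|j|g h cg ig ch ih|g h cg ig ch ih|g cg ig g0|g n cg ig|g cg ig g0].
- by rewrite partial_cst; exact: cls_cst.
- by rewrite partial_coord; exact: cls_cst.
- by rewrite partialDE//; exact: clsD.
- by rewrite partialME//; apply: clsD; exact: clsM.
- rewrite partialVE//.
  by do !apply: clsM => //; [exact: cls_cst|exact: clsV..].
- by rewrite partial_flat//; apply: clsM => //; exact: cls_flat.
- rewrite partial_sqrt//; apply: clsM => //; apply: clsV => [|x].
    by apply: clsM; [exact: cls_cst|exact: cls_sqrt].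
  exact: two_sqrt_neq0.
Qed.

(** For each constructor the differentiation rules expand both sides to the same polynomial in the
    derivatives of the constituents, up to the induction hypothesis. *)
Lemma partialC f i j : cls f -> partial i (partial j f) = partial j (partial i f).
Proof.
elim=> [c|k|g h cg ig ch ih|g h cg ig ch ih|g cg ig g0|g n cg ig|g cg ig g0].
- by rewrite !partial_cst.
- by rewrite !partial_coord !partial_cst.
- have [cgi cgj] := (cls_partial i cg, cls_partial j cg).
  have [chi chj] := (cls_partial i ch, cls_partial j ch).
  rewrite (@partialDE _ _ j cg ch) (@partialDE _ _ i cg ch).
  by rewrite (@partialDE _ _ i cgj chj) (@partialDE _ _ j cgi chi) ig ih.
- have [cgi cgj] := (cls_partial i cg, cls_partial j cg).
  have [chi chj] := (cls_partial i ch, cls_partial j ch).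
  rewrite (@partialME _ _ j cg ch) (@partialME _ _ i cg ch).
  rewrite (@partialDE _ _ i (clsM cg chj) (clsM ch cgj)).
  rewrite (@partialDE _ _ j (clsM cg chi) (clsM ch cgi)).
  rewrite (@partialME _ _ i cg chj) (@partialME _ _ i ch cgj).
  rewrite (@partialME _ _ j cg chi) (@partialME _ _ j ch cgi) ig ih.
  apply/funext => x; rewrite addrACA [RHS]addrACA; congr (_ + _).
  by rewrite addrC mulrC [X in _ + X]mulrC.
- have [cgi cgj] := (cls_partial i cg, cls_partial j cg).
  have cV := clsV cg g0.
  have c1 := cls_cst (-1).
  have c2 := clsM c1 cV.
  have c3 := clsM c2 cV.
  rewrite (@partialVE _ j cg g0) (@partialVE _ i cg g0).
  rewrite (@partialME _ _ i c3 cgj) (@partialME _ _ j c3 cgi) ig.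
  rewrite (@partialME _ _ i c2 cV) (@partialME _ _ j c2 cV).
  rewrite (@partialME _ _ i c1 cV) (@partialME _ _ j c1 cV).
  rewrite (@partialVE _ j cg g0) (@partialVE _ i cg g0) !partial_cst.
  apply/funext => x; move: (g x)^-1 (partial i (partial j g) x)
    (partial i g x) (partial j g x) => *; ring.
- have [cgi cgj] := (cls_partial i cg, cls_partial j cg).
  have cf k := cls_flat k cg.
  rewrite (@partial_flat _ _ j cg) (@partial_flat _ _ i cg).
  rewrite (@partialME _ _ i (cf _) cgj) (@partialME _ _ j (cf _) cgi) ig.
  rewrite (@partial_flat _ _ j cg) (@partial_flat _ _ i cg).
  apply/funext => x; move: (flat n.+1 (g x)) (flat n.+2 (g x)) (partial i (partial j g) x)
    (partial i g x) (partial j g x) => *; ring.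
- have [cgi cgj] := (cls_partial i cg, cls_partial j cg).
  have c3 : cls (fun x => (2 * Num.sqrt (g x))^-1).
    apply: clsV => [|x]; first by apply: clsM; [exact: cls_cst|exact: cls_sqrt].
    exact: two_sqrt_neq0.
  have e3 k : partial k (fun x => (2 * Num.sqrt (g x))^-1) =
      fun x => - (2 * Num.sqrt (g x))^-1 * (2 * Num.sqrt (g x))^-1 *
         (2 * ((2 * Num.sqrt (g x))^-1 * partial k g x)).
    have c2 : cls (fun x => 2 * Num.sqrt (g x)).
      by apply: clsM; [exact: cls_cst|exact: cls_sqrt].
    rewrite (@partialVE _ k c2) => [|x]; last by apply: two_sqrt_neq0.
    rewrite (@partialME _ _ k (cls_cst 2) (cls_sqrt cg g0)) partial_cst.
    rewrite (@partial_sqrt _ k cg g0); apply/funext => x.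
    by rewrite mulN1r mulr0 addr0.
  rewrite (@partial_sqrt _ j cg g0) (@partial_sqrt _ i cg g0).
  rewrite (@partialME _ _ i c3 cgj) (@partialME _ _ j c3 cgi) ig !e3.
  apply/funext => x; move: (2 * Num.sqrt (g x))^-1 (partial i (partial j g) x)
    (partial i g x) (partial j g x) => *; ring.
Qed.

Lemma cls_foldr f (s : seq 'I_d) : cls f -> cls (foldr partial f s).
Proof. by move=> cf; elim: s => //= i s; exact: cls_partial. Qed.

Lemma cls_cont f : cls f -> continuous f.
Proof. by move=> cf x; apply/differentiable_continuous/cls_diff. Qed.

Lemma cls_smooth f : cls f -> smooth f.
Proof.
move=> cf s /=; have cs := cls_foldr s cf.
by split=> [|i x]; [exact: cls_cont|exact: cls_derivable].
Qed.

Lemma cls_affine f (a : R) (b : rV) : cls f -> cls (fun x => f (a *: x + b)).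
Proof.
elim=> [c|k|g h cg ig ch ih|g h cg ig ch ih|g cg ig g0|g n cg ig|g cg ig g0].
- exact: cls_cst.
- rewrite (_ : (fun _ => _) = (fun x : rV => a * x ord0 k + b ord0 k)).
    by apply: clsD; [apply: clsM; [exact: cls_cst|exact: cls_coord]|exact: cls_cst].
  by apply/funext => x; rewrite !mxE.
- exact: clsD.
- exact: clsM.
- exact: clsV.
- exact: cls_flat.
- exact: cls_sqrt.
Qed.

Lemma is_derive_line f (p u : rV) (t : R) : derivable f (p + t *: u) u ->
  is_derive t 1 (fun s : R => f (p + s *: u)) ('D_u f (p + t *: u)).
Proof.
move=> df.
pose F (s : R) := f (p + s *: u).
have E : (fun h : R => h^-1 *: ((F \o shift t) (h *: 1) - F t)) =
    (fun h : R => h^-1 *: ((f \o shift (p + t *: u)) (h *: u) - f (p + t *: u))).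
  apply/funext => h; rewrite /F /= [h *: 1]mulr1; congr (_ *: (f _ - _)).
  by rewrite scalerDl addrCA addrA.
by apply: DeriveDef; rewrite /derivable /derive E.
Qed.

(** One family of paths serves both for translations (a = 1, b = 0) and for dilations (a = 0, b = 1,
    v = 0). *)
Lemma cls_path_is_derive f (a b : R) (v x : rV) (t : R) : cls f ->
  is_derive t 1 (fun s : R => f ((a + s * b) *: x + s *: v))
    (gradf f ((a + t * b) *: x + t *: v) (b *: x + v)).
Proof.
move=> cf.
have E s : (a + s * b) *: x + s *: v = a *: x + s *: (b *: x + v).
  by rewrite scalerDl scalerDr scalerA addrA.
under eq_fun do rewrite E.
rewrite E -diff_gradf; last exact: cls_diff.
rewrite -deriveE; last exact: cls_diff.
by apply: is_derive_line; exact: cls_derivable.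
Qed.

Lemma clsN f : cls f -> cls (fun x => - f x).
Proof.
move=> cf; rewrite (_ : (fun _ => _) = (fun x => -1 * f x)).
  by apply: clsM => //; exact: cls_cst.
by apply/funext => x; rewrite mulN1r.
Qed.

Lemma clsB f g : cls f -> cls g -> cls (fun x => f x - g x).
Proof. by move=> cf cg; apply: clsD => //; exact: clsN. Qed.

Lemma cls_sum (I : Type) (r : seq I) (P : pred I) (F : I -> rV -> R) :
  (forall k, cls (F k)) -> cls (fun x => \sum_(k <- r | P k) F k x).
Proof.
move=> cF; elim: r => [|k r IH].
  by under eq_fun do rewrite big_nil; exact: cls_cst.
under eq_fun do rewrite big_cons.
by case: (P k) => //; exact: clsD.
Qed.

Lemma cls_e0 f : cls f -> cls (fun x => e0 (f x)).
Proof. by move=> cf; exact: cls_flat. Qed.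

Lemma cls_step f : cls f -> cls (fun x => step (f x)).
Proof.
move=> cf; apply: clsM; first exact: cls_e0.
apply: clsV => [|x]; last by rewrite gt_eqF ?step_den.
apply: clsD; apply: cls_e0 => //.
by apply: clsB => //; exact: cls_cst.
Qed.

End smooth_class.

(** * Affine changes of variables *)

Section rV_measure.
Context {R : realType}.
Local Open Scope ereal_scope.
Local Notation lam := (@lebesgue_measure R).

Definition aff1 (a b : R) (t : measurableTypeR R) : measurableTypeR R := (a * t + b)%R.

Lemma measurable_aff1 a b : measurable_fun setT (aff1 a b).
Proof.
apply: (measurable_funD (f := fun t : R => (a * t)%R) (g := cst b)) => //.
exact: mulrl_measurable.
Qed.

(** Both sides are measures in A; by uniqueness of Lebesgue measure it suffices to compare them on
    half-open intervals. *)
Lemma lebesgue_measure_aff1 (a b : R) (A : set (measurableTypeR R)) : (0 < a)%R -> measurable A ->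
  lam A = a%:E * lam (aff1 a b @^-1` A).
Proof.
move=> a0 mA.
have an : (0 <= a)%R := ltW a0.
pose m1 : {measure set (measurableTypeR R) -> \bar R} :=
  measure_function_pushforward__canonical__measure_function_Measure
    lam (measurable_aff1 a b).
pose m2 : {measure set (measurableTypeR R) -> \bar R} := mscale (NngNum an) m1.
rewrite -[RHS]/(m2 A); apply: lebesgue_measure_unique => // _ [[l r]] _ <-.
rewrite -[RHS]/(a%:E * lam (aff1 a b @^-1` `]l, r])).
have -> : aff1 a b @^-1` `]l, r] = `]((l - b) / a)%R, ((r - b) / a)%R]%classic.
  apply/seteqP; split => t /=; rewrite !in_itv/= /aff1.
    by rewrite ltr_pdivrMr// ler_pdivlMr// ltrBlDr lerBrDr mulrC.
  by rewrite ltr_pdivrMr// ler_pdivlMr// ltrBlDr lerBrDr mulrC.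
rewrite !lebesgue_measure_itv/= !lte_fin ltr_pM2r ?invr_gt0// ltrD2r.
case: ifP => // _; last by rewrite mule0.
by rewrite -!EFinD -EFinM; congr EFin; field; rewrite gt_eqF.
Qed.

Section affn.
Variables (a : R) (n : nat) (b : 'rV[R]_n).
Definition affn (x : 'rV[R]_n) : 'rV[R]_n := (a *: x + b)%R.

Lemma measurable_affn : measurable_fun setT affn.
Proof.
apply: measurable_fun_coordP => i j; rewrite /affn.
under eq_fun do rewrite !mxE.
apply: (measurable_funD (f := fun x : 'rV[R]_n => (a * x i j)%R) (g := cst (b i j))) => //.
apply: (measurable_funM (f := cst a) (g := fun x : 'rV[R]_n => x i j)) => //.
exact: measurable_coord.
Qed.
End affn.

(** Induction on the dimension: [rV_cons] intertwines the affine map with the product of its first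
    coordinate and the rest, and uniqueness of the product measure reduces the claim to
    rectangles. *)
Lemma lebesgue_measure_affn (a : R) n (b : 'rV[R]_n) (A : set 'rV[R]_n) :
  (0 < a)%R -> measurable A ->
  lebesgue_measure_rV n A = (a ^+ n)%:E * lebesgue_measure_rV n (affn a b @^-1` A).
Proof.
move=> a0; elim: n => [|n IH] in b A *.
  move=> mA; rewrite expr0 mul1e /=; congr (\d_ _ _).
  by apply/seteqP; split => x /=; rewrite (thinmx0 (affn _ _ _)) (thinmx0 x).
move=> mA; pose b' : 'rV[R]_n := (\row_j b ord0 (lift ord0 j))%R.
pose T := (measurableTypeR R * 'rV[R]_n)%type.
pose psi (p : T) : T := (aff1 a (b ord0 ord0) p.1, affn a b' p.2).
have mpsi : measurable_fun [set: T] psi.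
  by apply: measurable_fun_pair => /=; apply: measurableT_comp => //;
    [exact: measurable_aff1|exact: measurable_affn].
have an : (0 <= a ^+ n.+1)%R by rewrite exprn_ge0// ltW.
have [mu muE] := @lebesgue_measure_rV_subproof R n.
pose m1 : {measure set T -> \bar R} :=
  measure_function_pushforward__canonical__measure_function_Measure
    (lam \x mu) mpsi.
pose m2 : {measure set T -> \bar R} := mscale (NngNum an) m1.
have mB : measurable (@rV_cons R n @^-1` A).
  rewrite -[X in measurable X]setTI; exact: measurable_rV_cons.
rewrite /= -muE /pushforward.
have -> : rV_cons (n:=n) @^-1` (affn a b @^-1` A) = psi @^-1` (rV_cons (n:=n) @^-1` A).
  suff e p : affn a b (rV_cons p) = rV_cons (psi p).
    by apply/seteqP; split => p /=; rewrite e.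
  apply/rowP => i; rewrite !mxE; case: unliftP => [j ->|->]//.
  by rewrite !mxE.
rewrite -[RHS]/(m2 _); apply: product_measure_unique => // B C mB' mC.
rewrite -[LHS]/((a ^+ n.+1)%:E * (lam \x mu) (psi @^-1` (B `*` C))).
have -> : psi @^-1` (B `*` C) = (aff1 a (b ord0 ord0) @^-1` B) `*` (affn a b' @^-1` C).
  by [].
have mB1 : measurable (aff1 a (b ord0 ord0) @^-1` B).
  by rewrite -[X in measurable X]setTI; exact: measurable_aff1.
have mC1 : measurable (affn a b' @^-1` C).
  by rewrite -[X in measurable X]setTI; exact: measurable_affn.
rewrite product_measure1E// -[RHS]/(lam B * mu C).
rewrite (lebesgue_measure_aff1 (b ord0 ord0) a0 mB').
have := IH b' C mC; rewrite -muE => ->.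
by rewrite muleACA -EFinM exprS.
Qed.

Section integral.
Variable n : nat.
Local Notation rV := 'rV[R]_n.
Local Notation mu := (@lebesgue_measure_rV R n).
Variables (a : R) (b : rV).
Hypothesis a0 : (0 < a)%R.

Lemma ge0_integral_affn (f : rV -> \bar R) : measurable_fun setT f ->
  (forall x, 0 <= f x) ->
  \int[mu]_x f x = (a ^+ n)%:E * \int[mu]_x f (affn a b x).
Proof.
move=> mf f0.
have an : (0 <= a ^+ n)%R by rewrite exprn_ge0// ltW.
pose m1 : {measure set rV -> \bar R} :=
  measure_function_pushforward__canonical__measure_function_Measure
    mu (measurable_affn a b).
pose m2 : {measure set rV -> \bar R} := mscale (NngNum an) m1.
rewrite (@eq_measure_integral _ _ _ setT m2); last first.
  by move=> A mA _; exact: lebesgue_measure_affn.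
rewrite ge0_integral_mscale//; congr (_ * _).
by rewrite ge0_integral_pushforward//; exact: measurable_affn.
Qed.

Lemma integrable_affn (f : rV -> \bar R) :
  mu.-integrable setT f -> mu.-integrable setT (fun x => f (affn a b x)).
Proof.
move=> /integrableP[mf foo]; have mc := measurable_affn a b.
apply/integrableP; split; first exact: measurableT_comp.
move: foo; rewrite ge0_integral_affn//; last exact: measurableT_comp.
have an : (0 < a ^+ n)%R by rewrite exprn_gt0.
by apply: contraTT; rewrite -!leNgt !leye_eq => /eqP ->; rewrite gt0_muley// lte_fin.
Qed.

Lemma integral_affn (f : rV -> \bar R) : mu.-integrable setT f ->
  \int[mu]_x f x = (a ^+ n)%:E * \int[mu]_x f (affn a b x).
Proof.
move=> fi; have /measurable_int mf := fi.
have := integrable_add_def measurableT (integrable_affn fi).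
set P := \int[mu]_x _^\+ x; set N := \int[mu]_x _^\- x => PN.
rewrite integralE [in RHS]integralE -/P -/N.
rewrite /P /N in PN *.
have e1 : (fun x => f (affn a b x))^\+ = (fun x => f^\+ (affn a b x)).
  by apply/funext => x; rewrite !funeposE.
have e2 : (fun x => f (affn a b x))^\- = (fun x => f^\- (affn a b x)).
  by apply/funext => x; rewrite !funenegE.
rewrite e1 e2 (ge0_integral_affn (measurable_funepos mf))//.
rewrite (ge0_integral_affn (measurable_funeneg mf))//.
move: PN; rewrite e1 e2 => PN.
apply/esym/muleBr; first by []; exact: PN.
Qed.

Lemma ae_affn (P : rV -> Prop) :
  {ae mu, forall x, P x} -> {ae mu, forall x, P (affn a b x)}.
Proof.
move=> [N [mN N0 PN]]; exists (affn a b @^-1` N); split.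
- by rewrite -[X in measurable X]setTI; exact: measurable_affn.
- have := lebesgue_measure_affn b a0 mN; rewrite N0 => /esym/eqP.
  by rewrite mule_eq0 eqe expf_eq0 (gt_eqF a0) andbF/= => /eqP.
- by move=> x /= xP; exact: PN.
Qed.
End integral.

End rV_measure.

(** * Borel measurability of open sets and continuous functions *)

Section continuous_measurable.
Context {R : realType} {d : nat}.
Local Notation rV := 'rV[R]_d.

Lemma rV_norm_leP (x : rV) (M : R) :
  `|x| <= M <-> 0 <= M /\ forall i, `|x ord0 i| <= M.
Proof.
split=> [xM|[M0 xM]].
  split=> [|i]; first exact: le_trans xM.
  apply: le_trans xM; rewrite /Num.norm/= mx_normrE.
  by rewrite (le_bigmax _ _ (ord0, i)).
rewrite /Num.norm/= mx_normrE; apply/bigmax_leP; split=> // -[i j] _.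
by rewrite (ord1 i).
Qed.

Lemma rV_norm_ltP (x : rV) (M : R) :
  `|x| < M <-> 0 < M /\ forall i, `|x ord0 i| < M.
Proof.
split=> [xM|[M0 xM]].
  split=> [|i]; first exact: le_lt_trans xM.
  apply: le_lt_trans xM; rewrite /Num.norm/= mx_normrE.
  by rewrite (le_bigmax _ _ (ord0, i)).
rewrite /Num.norm/= mx_normrE; apply/bigmax_ltP; split=> // -[i j] _.
by rewrite (ord1 i).
Qed.

Lemma measurable_rV_ball (c : rV) (r : R) : measurable [set x : rV | `|x - c| < r].
Proof.
rewrite (_ : mkset _ = if 0 < r then \bigcap_(i in [set: 'I_d])
    ((fun x : rV => x ord0 i) @^-1` `]c ord0 i - r, c ord0 i + r[%classic) else set0).
  case: ifP => // r0; apply: fin_bigcap_measurable => // i _.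
  by rewrite -[X in measurable X]setTI; exact: measurable_coord.
case: ifP => r0; apply/seteqP; split=> x //=.
- move=> /rV_norm_ltP[_ h] i _ /=; have := h i.
  by rewrite !mxE ltr_distl in_itv.
- move=> h; apply/rV_norm_ltP; split=> // i; have /= := h i I.
  by rewrite !mxE ltr_distl in_itv.
- by move=> /rV_norm_ltP[]; rewrite r0.
Qed.

(** The sigma-algebra is generated by the coordinates, and a ball of the maximum norm is a box. An
    open set is the union of the rational balls it contains; [pickle] enumerates centres and radii,
    and a ball not inside U is replaced by the empty set. *)
Lemma open_measurable_rV (U : set rV) : open U -> measurable U.
Proof.
move=> oU.
pose B (q : 'rV[rat]_d * nat) :=
  [set x : rV | `|x - map_mx ratr q.1| < q.2.+1%:R^-1].
pose F (k : nat) : set rV :=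
  if unpickle k is Some q then if `[< B q `<=` U >] then B q else set0 else set0.
rewrite (_ : U = \bigcup_k F k).
  apply: bigcupT_measurable => k; rewrite /F; case: unpickle => // q.
  by case: asboolP => // _; exact: measurable_rV_ball.
apply/seteqP; split=> [x Ux|x [k _]]; last first.
  by rewrite /F; case: unpickle => // q; case: asboolP => // h /h.
have /nbhs_ballP[e /= e0 eU] : nbhs x U by exact: open_nbhs_nbhs.
have [m /= me] : exists m : nat, m.+1%:R^-1 < e / 2.
  have [m _ h] := near_infty_natSinv_lt (PosNum (divr_gt0 e0 (ltr0n _ 2))).
  by exists m; exact: (h m (leqnn m)).
have /choice[q qx] i : exists q : rat, `|x ord0 i - ratr q| < m.+1%:R^-1.
  have lt1 : x ord0 i - m.+1%:R^-1 < x ord0 i + m.+1%:R^-1.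
    by rewrite ltrBlDr -addrA ltrDl addr_gt0// invr_gt0.
  have [q] := rat_in_itvoo lt1.
  by rewrite in_itv/= => h; exists q; rewrite distrC ltr_distl.
pose qq : 'rV[rat]_d := \row_i q i.
exists (pickle (qq, m)) => //; rewrite /F pickleK; case: asboolP => [_|[]] /=.
  by apply/rV_norm_ltP; split=> // i; rewrite !mxE.
move=> y /= yq; apply: eU; rewrite -ball_normE /=.
rewrite -(subrK (map_mx ratr qq) x) -addrA (le_lt_trans (ler_normD _ _))//.
rewrite (splitr e) ltrD//.
  by apply: lt_trans me; apply/rV_norm_ltP; split=> // i; rewrite !mxE.
by rewrite distrC (lt_trans yq).
Qed.

Lemma continuous_measurable_rV (f : rV -> R) : continuous f ->
  measurable_fun setT f.
Proof.
move=> cf; apply: (measurability (@RGenOpens.G R)).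
  exact: RGenOpens.measurableE.
move=> _ [_ [a [b ->]] <-]; rewrite setTI; apply: open_measurable_rV.
by apply: open_comp => // x _; exact: cf.
Qed.

End continuous_measurable.

(** * Integrals, local integrability and differentiation under the integral sign *)

Section integration.
Context {R : realType} {d : nat}.
Local Notation rV := 'rV[R]_d.
Local Notation mu := (@lebesgue_measure_rV R d).
Implicit Types (f g w : rV -> R) (M C : R).

Definition itg f : Prop := mu.-integrable setT (EFin \o f).
Definition II f : R := \int[mu]_x f x.

Lemma itgD f g : itg f -> itg g -> itg (fun x => f x + g x).
Proof. by move=> hf hg; have := integrableD measurableT hf hg. Qed.

Lemma itgB f g : itg f -> itg g -> itg (fun x => f x - g x).
Proof. by move=> hf hg; have := integrableB measurableT hf hg. Qed.

Lemma itgZ c f : itg f -> itg (fun x => c * f x).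
Proof. by move=> hf; have := integrableZl measurableT c hf. Qed.

Lemma itg_norm f : itg f -> itg (fun x => `|f x|).
Proof. by move=> hf; exact: integrable_norm. Qed.

Lemma itg_sum (I : Type) (s : seq I) (F : I -> rV -> R) :
  (forall i, itg (F i)) -> itg (fun x => \sum_(i <- s) F i x).
Proof.
move=> iF; have := integrable_sum (P := xpredT) measurableT s (fun i _ => iF i).
rewrite /itg; apply: eq_integrable => // x _ /=.
by rewrite sumEFin.
Qed.

Lemma itg_eq f g : f =1 g -> itg f -> itg g.
Proof. by move=> fg; rewrite (_ : g = f)//; apply/esym/funext. Qed.

Lemma itg_meas f : itg f -> measurable_fun setT f.
Proof. by move=> /measurable_int/measurable_EFinP. Qed.

Lemma itg_le f g : measurable_fun setT f -> (forall x, `|f x| <= g x) -> itg g -> itg f.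
Proof.
move=> mf fg ig; apply: le_integrable ig => //; first exact/measurable_EFinP.
by move=> x _ /=; rewrite lee_fin (le_trans (fg x))// ler_norm.
Qed.

Lemma IID f g : itg f -> itg g -> II (fun x => f x + g x) = II f + II g.
Proof. by move=> hf hg; exact: RintegralD. Qed.

Lemma IIB f g : itg f -> itg g -> II (fun x => f x - g x) = II f - II g.
Proof. by move=> hf hg; exact: RintegralB. Qed.

Lemma IIZ c f : itg f -> II (fun x => c * f x) = c * II f.
Proof. by move=> hf; exact: RintegralZl. Qed.

Lemma II0 : II (fun=> 0) = 0.
Proof. by rewrite /II /Rintegral integral0. Qed.

Lemma II_sum (I : Type) (s : seq I) (F : I -> rV -> R) : (forall i, itg (F i)) ->
  II (fun x => \sum_(i <- s) F i x) = \sum_(i <- s) II (F i).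
Proof.
move=> iF; elim: s => [|i s IH].
  by rewrite big_nil -[RHS]II0; congr II; apply/funext => x; rewrite big_nil.
rewrite big_cons -IH -IID//; last exact: itg_sum.
by congr II; apply/funext => x; rewrite big_cons.
Qed.

Lemma II_le f g : itg f -> itg g -> (forall x, f x <= g x) -> II f <= II g.
Proof. by move=> hf hg fg; apply: le_Rintegral. Qed.

Lemma II_norm f : itg f -> `|II f| <= II (fun x => `|f x|).
Proof. by move=> hf; exact: le_normr_Rintegral. Qed.

Lemma II_ge0 f : (forall x, 0 <= f x) -> 0 <= II f.
Proof. by move=> f0; apply: Rintegral_ge0. Qed.

Lemma EFin_II f : itg f -> (II f)%:E = (\int[mu]_x (f x)%:E)%E.
Proof. by move=> hf; rewrite /II /Rintegral fineK//; exact: integrable_fin_num. Qed.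

Lemma II_ae f g : measurable_fun setT f -> measurable_fun setT g ->
  {ae mu, forall x, f x = g x} -> II f = II g.
Proof.
move=> mf mg fg; rewrite /II /Rintegral; congr fine; apply: ae_eq_integral => //.
- exact/measurable_EFinP.
- exact/measurable_EFinP.
- by apply: filterS fg => x /= -> _.
Qed.

Lemma itg_affn f (a : R) (b : rV) : 0 < a -> itg f -> itg (fun x => f (affn a b x)).
Proof. by move=> a0 hf; exact: (integrable_affn b a0 hf). Qed.

Lemma II_affn f (a : R) (b : rV) : 0 < a -> itg f ->
  II f = a ^+ d * II (fun x => f (affn a b x)).
Proof.
move=> a0 hf; apply: EFin_inj; rewrite EFinM !EFin_II//; last exact: itg_affn.
exact: integral_affn.
Qed.

Lemma measurable_cball M : measurable [set x : rV | `|x| <= M].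
Proof.
have := continuous_measurable_rV (@norm_continuous _ rV).
move/(_ measurableT `]-oo, M]%classic (measurable_itv _)); rewrite setTI.
by congr measurable; apply/seteqP; split=> x /=; rewrite in_itv.
Qed.

Lemma compact_cball M : compact [set x : rV | `|x| <= M].
Proof.
have [M0|M0] := leP 0 M; last first.
  rewrite (_ : mkset _ = set0); first exact: compact0.
  by apply/seteqP; split=> x //= /(le_trans (normr_ge0 _)); rewrite leNgt M0.
have := @rV_compact R d (fun=> `[-M, M]%classic) (fun=> @segment_compact _ _ _).
congr compact; apply/seteqP; split=> x /=.
  by move=> h; apply/rV_norm_leP; split=> // i; have := h i; rewrite in_itv/= ler_norml.
by move=> /rV_norm_leP[_ h] i; rewrite in_itv/= -ler_norml.
Qed.

Lemma continuous_bounded_cball f M : continuous f ->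
  exists2 C, 0 <= C & forall x, `|x| <= M -> `|f x| <= C.
Proof.
move=> cf.
have cnf : {within [set x : rV | `|x| <= M], continuous (fun x => `|f x|)}.
  apply: continuous_subspaceT => x.
  by apply: continuous_comp; [exact: cf|exact: norm_continuous].
have [M0|M0] := leP 0 M; last first.
  by exists 0 => // x /(le_trans (normr_ge0 _)); rewrite leNgt M0.
have ne : [set x : rV | `|x| <= M] !=set0 by exists 0; rewrite /= normr0.
have [c _ hc] := EVT_max_rV ne (@compact_cball M) cnf.
by exists `|f c| => // x xM; apply: hc; rewrite inE.
Qed.

Lemma mu_cball_lty M : (mu [set x : rV | (`|x| <= M)%R] < +oo)%E.
Proof.
pose B (i : 'I_d) : set R := `[-`|M|, `|M|]%classic.
have mB : measurable [set x : rV | forall i, B i (x ord0 i)].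
  rewrite (_ : mkset _ = \bigcap_(i in [set: 'I_d])
      ((fun x : rV => x ord0 i) @^-1` B i)).
    apply: fin_bigcap_measurable => // i _.
    rewrite -[X in measurable X]setTI; apply: measurable_coord => //.
    exact: measurable_itv.
  by apply/seteqP; split=> [x h i _|x h i]; [exact: h|exact: (h i)].
apply: (@le_lt_trans _ _ (mu [set x | forall i, B i (x ord0 i)])).
  apply: le_measure; rewrite ?inE//; first exact: measurable_cball.
  move=> x /= /rV_norm_leP[M0 h] i; rewrite /B /= in_itv/= -ler_norml.
  by rewrite (ger0_norm M0).
rewrite lebesgue_measure_rV_box; last by move=> i; exact: measurable_itv.
rewrite (eq_bigr (fun=> (`|M| - - `|M|)%:E)) ?prodEFin ?ltry// => i _.
rewrite /B lebesgue_measure_itv/= lte_fin; case: ifPn => //.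
by rewrite -leNgt => h; congr EFin; have := normr_ge0 M; lra.
Qed.

(** Closed balls of the maximum norm stand in for all compact sets. *)
Definition locint w : Prop := measurable_fun setT w /\
  forall M, mu.-integrable [set x | `|x| <= M] (EFin \o w).

(** Compact support with an explicit radius, so that it can be kept uniform along families of
    translates and dilates. *)
Definition bsup M f := forall x, M < `|x| -> f x = 0.

Lemma itg_locint w g M C : locint w -> measurable_fun setT g ->
  (forall x, `|g x| <= C) -> bsup M g -> itg (fun x => w x * g x).
Proof.
move=> [mw lw] mg gC gM.
have := integrableMl (measurable_cball M) (lw M) (measurable_funTS mg).
have bg : [bounded g x | x in [set x : rV | `|x| <= M]].
  exists C; split=> [|y /ltW Cy x _]; first exact: num_real.
  exact: le_trans Cy.
move=> /(_ bg) /(integrable_mkcond _ (measurable_cball M)).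
apply: eq_integrable => // x _; rewrite patchE; case: ifPn => //=.
by rewrite notin_setE /= => /negP; rewrite -ltNge => /gM ->; rewrite mulr0.
Qed.

Lemma locint_cont f : continuous f -> locint f.
Proof.
move=> cf; have mf := continuous_measurable_rV cf; split=> // M.
apply: measurable_bounded_integrable.
- exact: measurable_cball.
- exact: mu_cball_lty.
- exact: measurable_funTS.
- have [C _ hC] := continuous_bounded_cball M cf.
  exists C; split=> [|y /ltW Cy x xM]; first exact: num_real.
  by apply: le_trans Cy; exact: hC.
Qed.

Lemma locintP f : locally_integrable_rV f -> locint f.
Proof.
move=> [mf lf]; split=> // M; apply/integrableP; split.
  exact/measurable_EFinP/measurable_funTS.
exact: (lf _ (@compact_cball M)).
Qed.

Lemma locintD f g : locint f -> locint g -> locint (fun x => f x + g x).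
Proof.
move=> [mf lf] [mg lg]; split=> [|M]; first exact: measurable_funD.
exact: (integrableD (measurable_cball M) (lf M) (lg M)).
Qed.

Lemma locintZ c f : locint f -> locint (fun x => c * f x).
Proof.
move=> [mf lf]; split=> [|M]; first exact: (measurable_funM (f := cst c)).
exact: (integrableZl (measurable_cball M) c (lf M)).
Qed.

Lemma locint_affn f (a : R) (b : rV) : 0 < a -> locint f -> locint (fun x => f (affn a b x)).
Proof.
move=> a0 [mf lf]; split=> [|M].
  by apply: measurableT_comp => //; exact: measurable_affn.
apply/(integrable_mkcond _ (measurable_cball M)).
pose A := [set x : rV | `|x| <= a * M + `|b|].
have h : itg (fun x => f x * \1_A x).
  apply: (@itg_locint f (\1_A) (a * M + `|b|) 1) => //.
  - by apply: measurable_indic; exact: measurable_cball.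
  - by move=> x; rewrite indicE; case: (_ \in _); rewrite ?normr1 ?normr0.
  - move=> x xM; rewrite indicE memNset//= => xM'.
    by move: (lt_le_trans xM xM'); rewrite ltxx.
have {}h := itg_affn b a0 h.
apply: le_integrable (itg_norm h) => //.
  apply: (iffLR (measurable_restrictT _ (measurable_cball M))).
  apply/measurable_EFinP/measurable_funTS.
  by apply: measurableT_comp => //; exact: measurable_affn.
move=> x _; rewrite patchE; case: ifPn => [|_]; last by rewrite abse0 abse_ge0.
rewrite inE /= => xM; rewrite indicE mem_set ?mulr1 ?lee_fin ?normr_id//=.
rewrite /A /affn /= (le_trans (ler_normD _ _))// lerD2r normrZ (gtr0_norm a0).
by rewrite ler_pM2l.
Qed.

(** Dominated convergence with majorant C' |w| on the ball of radius M, which is why the bound and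
    the support of H' are uniform for t near t0. *)
Lemma int_deriv w (H H' : R -> rV -> R) (t0 r C C' M : R) : 0 < r -> locint w ->
  (forall t, `|t - t0| < r -> measurable_fun setT (H t)) ->
  (forall t x, `|t - t0| < r -> `|H t x| <= C) ->
  (forall t, `|t - t0| < r -> bsup M (H t)) ->
  (forall t x, `|t - t0| < r -> is_derive t 1 (H ^~ x) (H' t x)) ->
  (forall t x, `|t - t0| < r -> `|H' t x| <= C') ->
  (forall t, `|t - t0| < r -> bsup M (H' t)) ->
  is_derive t0 1 (fun t => II (fun x => w x * H t x)) (II (fun x => w x * H' t0 x)).
Proof.
move=> r0 lw mH HC HM dH HC' HM'.
pose B := [set x : rV | `|x| <= M].
have inI t : `]t0 - r, t0 + r[%classic t -> `|t - t0| < r.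
  by rewrite /= in_itv/= -ltr_distl.
have It0 : `]t0 - r, t0 + r[%classic t0 by rewrite /= in_itv/= ltrBlDr ltrDl r0.
pose f t x := w x * H t x.
have intf t : `]t0 - r, t0 + r[%classic t -> mu.-integrable setT (EFin \o f t).
  by move=> /inI h; apply: itg_locint (HM t h) => //; [exact: mH|move=> x; exact: HC].
have df t x : `]t0 - r, t0 + r[%classic t -> is_derive t 1 (f ^~ x) (w x * H' t x).
  move=> /inI h; have := dH t x h => dh.
  rewrite (_ : f ^~ x = w x \*: (H ^~ x)); last by apply/funext.
  exact: is_deriveZ.
pose G x := `|w x * (C' * \1_B x)|.
have C0 : 0 <= C'.
  by apply: le_trans (HC' t0 0 _); rewrite ?subrr ?normr0.
have iG : itg G.
  apply/itg_norm/(@itg_locint _ _ M C') => //.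
  - apply: (measurable_funM (f := cst C')) => //.
    by apply: measurable_indic; exact: measurable_cball.
  - move=> x; rewrite indicE normrM (ger0_norm C0); case: (_ \in _);
      by rewrite ?normr1 ?normr0 ?mulr1 ?mulr0.
  - move=> x xM; rewrite indicE memNset ?mulr0//= => xM'.
    by move: (lt_le_trans xM xM'); rewrite ltxx.
have GG t x : `]t0 - r, t0 + r[%classic t -> setT x -> `|partial1of2 f t x| <= G x.
  move=> It _; rewrite partial1of2E; have [_ ->] := df t x It.
  rewrite /G !normrM ler_wpM2l// indicE; have h := inI _ It.
  case: (boolP (x \in B)) => [_|]; first by rewrite normr1 mulr1 (ger0_norm C0) HC'.
  by rewrite notin_setE /B /= => /negP; rewrite -ltNge => /HM' ->//; rewrite !normr0 mulr0.
have K := @cvg_differentiation_under_integral R _ _ mu f setT measurableT t0 (t0 - r)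
  (t0 + r) It0 intf (fun t x It _ => @ex_derive _ _ _ _ _ _ _ (df t x It)) G
  (fun=> normr_ge0 _) iG GG.
have E : \int[mu]_y partial1of2 f t0 y = II (fun x => w x * H' t0 x).
  apply: eq_Rintegral => x _; rewrite partial1of2E.
  by have [_ ->] := df t0 x It0.
rewrite E in K.
apply: DeriveDef.
  apply/cvg_ex; exists (II (fun x => w x * H' t0 x)).
  by under eq_fun do rewrite [_ *: 1]mulr1; exact: K.
apply: cvg_lim => //.
by under eq_fun do rewrite [_ *: 1]mulr1; exact: K.
Qed.

End integration.

(** * Density of smooth functions and the fundamental lemma *)

Section density.
Context {R : realType} {d : nat}.
Local Notation rV := 'rV[R]_d.
Local Notation mu := (@lebesgue_measure_rV R d).
Implicit Types (f g w rho psi : rV -> R) (M C : R).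

Lemma II_dct (h : nat -> rV -> R) (h0 G : rV -> R) :
  (forall n, measurable_fun setT (h n)) -> measurable_fun setT h0 -> itg G ->
  (forall n x, `|h n x| <= G x) -> (forall x, h n x @[n --> \oo] --> h0 x) ->
  itg h0 /\ (II (h n) @[n --> \oo] --> II h0).
Proof.
move=> mh mh0 iG hG hh.
have [] := @dominated_convergence _ _ _ mu setT measurableT
  (fun n => EFin \o h n) (EFin \o h0) (EFin \o G).
- by move=> n; exact/measurable_EFinP.
- exact/measurable_EFinP.
- apply: aeW => x _; apply/fine_cvgP; split; first exact: nearW.
  exact: hh.
- exact: iG.
- by apply: aeW => x n _ /=; rewrite lee_fin.
move=> ih0 _ K; split => //.
rewrite -(EFin_II ih0) in K.
by move/fine_cvgP : K => [].
Qed.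

(** The squared Euclidean norm: unlike the norm itself it is a polynomial, so every region below is
    described through it. *)
Definition sq (x : rV) : R := \sum_i x ord0 i ^+ 2.

Lemma sq_ge0 x : 0 <= sq x.
Proof. by apply: sumr_ge0 => i _; exact: sqr_ge0. Qed.

Lemma cls_sq : cls sq.
Proof.
apply: cls_sum => i; under eq_fun do rewrite expr2.
by apply: clsM; exact: cls_coord.
Qed.

Lemma norm_le_sq (x : rV) : `|x| ^+ 2 <= sq x.
Proof.
suff h : `|x| <= Num.sqrt (sq x).
  by rewrite -[leRHS](sqr_sqrtr (sq_ge0 x)) lerXn2r// nnegrE ?normr_ge0 ?sqrtr_ge0.
apply/rV_norm_leP; split=> [|i]; first exact: sqrtr_ge0.
rewrite -sqrtr_sqr ler_wsqrtr// /sq (bigD1 i)//= lerDl.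
by apply: sumr_ge0 => j _; exact: sqr_ge0.
Qed.

Lemma cls_meas f : cls f -> measurable_fun setT f.
Proof. by move=> cf; exact: continuous_measurable_rV (cls_cont cf). Qed.

Section approximation.
Variable g : rV -> R.
Hypotheses (ig : itg g) (g0 : forall x, 0 <= g x).

(** Density in the weighted space L^1(g dx). The range [0, 1] of the approximants makes the property
    stable under complements and intersections, by 1 - psi and by products. *)
Definition approximable (A : set rV) := forall e, 0 < e -> exists psi,
  [/\ cls psi, forall x, 0 <= psi x <= 1 & II (fun x => g x * `|\1_A x - psi x|) <= e].

Lemma indic_itv (A : set rV) x : 0 <= (\1_A x : R) <= 1.
Proof. by rewrite indicE; case: (_ \in _); rewrite ler01 lexx. Qed.

Lemma itg_approx (A : set rV) psi : measurable A -> measurable_fun setT psi ->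
  (forall x, 0 <= psi x <= 1) -> itg (fun x => g x * `|\1_A x - psi x|).
Proof.
move=> mA mp p01; apply: itg_le ig.
  apply: measurable_funM; first exact: itg_meas.
  by apply: measurableT_comp => //; exact: measurable_funB.
move=> x; rewrite normrM normr_id ger0_norm// ler_piMr// ler_norml.
by have /andP[? ?] := indic_itv A x; have /andP[? ?] := p01 x; apply/andP; split; lra.
Qed.

Lemma approximableC A : measurable A -> approximable A -> approximable (~` A).
Proof.
move=> mA aA e e0; have [psi [cp p01 pe]] := aA e e0.
exists (fun x => 1 - psi x); split.
- by apply: clsB => //; exact: cls_cst.
- by move=> x; have /andP[? ?] := p01 x; apply/andP; split; lra.
- apply: le_trans pe; rewrite le_eqVlt; apply/orP; left; apply/eqP.
  congr II; apply/funext => x; congr (_ * _).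
  rewrite (_ : \1_(~` A) x = 1 - \1_A x); last first.
    by rewrite !indicE in_setC; case: (_ \in _) => /=; rewrite ?subrr ?subr0.
  by rewrite -normrN; congr (`|_|); ring.
Qed.

Lemma approximableI A B : measurable A -> measurable B ->
  approximable A -> approximable B -> approximable (A `&` B).
Proof.
move=> mA mB aA aB e e0; have e20 : 0 < e / 2 by rewrite divr_gt0.
have [p [cp p01 pe]] := aA _ e20; have [q [cq q01 qe]] := aB _ e20.
have pq01 x : 0 <= p x * q x <= 1.
  have /andP[p0 p1] := p01 x; have /andP[q0 q1] := q01 x.
  by rewrite mulr_ge0//= mulr_ile1.
exists (fun x => p x * q x); split; [exact: clsM|exact: pq01|].
rewrite [leRHS]splitr (le_trans _ (lerD pe qe))// -IID; last 2 first.
- by apply: itg_approx => //; exact: cls_meas.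
- by apply: itg_approx => //; exact: cls_meas.
apply: II_le.
- exact: itg_approx (measurableI _ _ mA mB) (cls_meas (clsM cp cq)) pq01.
- by apply: itgD; apply: itg_approx => //; exact: cls_meas.
move=> x; rewrite -mulrDr ler_wpM2l// indicI /=.
have /andP[p0 p1] := p01 x; have /andP[q0 q1] := q01 x.
have /andP[a0 a1] := indic_itv A x; have /andP[b0 b1] := indic_itv B x.
have -> : \1_A x * \1_B x - p x * q x =
   \1_B x * (\1_A x - p x) + p x * (\1_B x - q x) by ring.
rewrite (le_trans (ler_normD _ _))// !normrM lerD// ger0_norm// ler_piMl//.
Qed.

Lemma approximable0 : approximable set0.
Proof.
move=> e e0; exists (fun=> 0); split; first exact: cls_cst.
  by move=> x; rewrite lexx ler01.
rewrite (_ : (fun _ => _) = (fun=> 0)) ?II0 ?ltW//.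
by apply/funext => x; rewrite indic0 subrr normr0 mulr0.
Qed.

Lemma approximable_bigcup (F : (set rV)^nat) :
  (forall n, measurable (F n)) -> (forall n, approximable (F n)) ->
  approximable (\bigcup_n F n).
Proof.
move=> mF aF.
pose C n := \big[setU/set0]_(k < n) F k.
have mC n : measurable (C n) by exact: bigsetU_measurable.
have aC n : approximable (C n).
  rewrite /C; elim: n => [|n IH]; first by rewrite big_ord0; exact: approximable0.
  rewrite big_ord_recr/= -[X in approximable X]setCK setCU.
  have mCn : measurable (\big[setU/set0]_(k < n) F k) by exact: mC.
  apply: approximableC.
    by apply: measurableI; exact: measurableC.
  by apply: approximableI; [exact: measurableC..|exact: approximableC|exact: approximableC].
pose U := \bigcup_n F n.
have mU : measurable U by exact: bigcupT_measurable.
have cv : II (fun x => g x * `|\1_U x - \1_(C n) x|) @[n --> \oo] --> (0 : R).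
  rewrite -[X in _ --> X](@II0 R d).
  have [] := @II_dct (fun n x => g x * `|\1_U x - \1_(C n) x|) (fun=> 0) g => //.
  - by move=> n; exact: itg_meas (itg_approx mU (measurable_indic (mC n)) (indic_itv (C n))).
  - move=> n x; rewrite normrM normr_id ger0_norm// ler_piMr// ler_norml.
    have /andP[? ?] := indic_itv U x; have /andP[? ?] := indic_itv (C n) x.
    by apply/andP; split; lra.
  - move=> x; apply: cvg_near_cst; have [Ux|Ux] := pselect (U x).
    + have [k _ Fk] := Ux; exists k.+1 => // n /= kn.
      rewrite !indicE !mem_set ?subrr ?normr0 ?mulr0//.
      by rewrite /C -bigcup_mkord; exists k.
    + apply: nearW => n; rewrite !indicE !memNset ?subrr ?normr0 ?mulr0//.
      by rewrite /C -bigcup_mkord => -[k /= _ Fk]; apply: Ux; exists k.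
move=> e e0; have e20 : 0 < e / 2 by rewrite divr_gt0.
move/cvgrPdist_le/(_ _ e20) : cv => [n _ /(_ n (leqnn n))].
rewrite sub0r normrN ger0_norm; last by apply: II_ge0 => x; rewrite mulr_ge0.
move=> le1; have [p [cp p01 pe]] := aC n _ e20.
exists p; split => //; rewrite [leRHS]splitr (le_trans _ (lerD le1 pe))//.
rewrite -IID; last 2 first.
- exact: (itg_approx mU (measurable_indic (mC n)) (indic_itv (C n))).
- by apply: itg_approx => //; exact: cls_meas.
apply: II_le.
- by apply: itg_approx => //; exact: cls_meas.
- apply: itgD.
    exact: (itg_approx mU (measurable_indic (mC n)) (indic_itv (C n))).
  by apply: itg_approx => //; exact: cls_meas.
move=> x; rewrite -mulrDr ler_wpM2l//.
have -> : \1_U x - p x = \1_U x - \1_(C n) x + (\1_(C n) x - p x) by ring.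
exact: ler_normD.
Qed.

Lemma e0_cvg (t : R) : e0 (n%:R * t) @[n --> \oo] --> ((0 < t)%R%:R : R).
Proof.
have [t0|t0] := ltP 0 t; last first.
  apply: cvg_near_cst; apply: nearW => n; rewrite e0_eq0//.
  by rewrite mulr_ge0_le0.
rewrite -cvg_shiftS /=.
have -> : (fun n => e0 (n.+1%:R * t)) = (fun n => expR (- (n.+1%:R^-1 * t^-1))).
  by apply/funext => n; rewrite e0E mulr_gt0// invfM.
have h : expR (- (n.+1%:R^-1 * t^-1)) @[n --> \oo] --> expR (- (0 * t^-1)).
  apply: continuous_cvg; first exact: continuous_expR.
  by apply: cvgN; apply: cvgMl; exact: cvg_harmonic.
by move: h; rewrite mul0r oppr0 expR0.
Qed.

(** The functions exp(-1 / (k (x_i - a))), extended by 0, increase to the indicator of the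
    half-space as k tends to infinity. *)
Lemma approximable_ray (i : 'I_d) (a : R) :
  approximable [set x : rV | a < x ord0 i].
Proof.
pose A := [set x : rV | a < x ord0 i].
have mA : measurable A.
  have := @measurable_coord _ R 1 d ord0 i measurableT `]a, +oo[%classic (measurable_itv _).
  by rewrite setTI; congr measurable; apply/seteqP; split=> x /=; rewrite in_itv/= andbT.
pose p (n : nat) (x : rV) := e0 (n%:R * (x ord0 i - a)).
have cp n : cls (p n).
  apply: cls_e0; apply: clsM; first exact: cls_cst.
  by apply: clsB; [exact: cls_coord|exact: cls_cst].
have p01 n x : 0 <= p n x <= 1.
  rewrite /p e0_ge0 e0E; case: ifPn => h; last by rewrite ler01.
  by rewrite -[leRHS]expR0 ler_expR oppr_le0 invr_ge0 ltW.
have cv : II (fun x => g x * `|\1_A x - p n x|) @[n --> \oo] --> (0 : R).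
  rewrite -[X in _ --> X](@II0 R d).
  have [] := @II_dct (fun n x => g x * `|\1_A x - p n x|) (fun=> 0) g => //.
  - by move=> n; exact: itg_meas (itg_approx mA (cls_meas (cp n)) (p01 n)).
  - move=> n x; rewrite normrM normr_id ger0_norm// ler_piMr// ler_norml.
    have /andP[? ?] := indic_itv A x; have /andP[? ?] := p01 n x.
    by apply/andP; split; lra.
  - move=> x.
    have h : g x * `|\1_A x - p n x| @[n --> \oo] --> g x * `|\1_A x - \1_A x|.
      apply: cvgMr; apply: cvg_norm; apply: cvgB; first exact: cvg_cst.
      rewrite indicE (_ : x \in A = (0 < x ord0 i - a)); first exact: e0_cvg.
      by rewrite subr_gt0; apply/idP/idP; rewrite inE.
    by move: h; rewrite subrr normr0 mulr0.
move=> e e0; move/cvgrPdist_le/(_ _ e0) : cv => [n _ /(_ n (leqnn n))].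
rewrite sub0r normrN ger0_norm; last by apply: II_ge0 => x; rewrite mulr_ge0.
by move=> h; exists (p n); split.
Qed.

(** The measurable approximable sets form a sigma-algebra, and it contains the half-spaces, which
    generate the Borel sets. *)
Lemma measurable_approximable (A : set rV) : measurable A -> approximable A.
Proof.
pose S := [set A : set rV | measurable A /\ approximable A].
suff sub : @measurable _ rV `<=` S by move=> /sub[].
have SS : sigma_algebra setT S.
  split.
  - by split; [exact: measurable0|exact: approximable0].
  - move=> B [mB aB]; rewrite setTD; split; first exact: measurableC.
    exact: approximableC.
  - move=> F SF; split; first by apply: bigcupT_measurable => n; have [] := SF n.
    by apply: approximable_bigcup => n; have [] := SF n.
apply: smallest_sub => // _ [[i j] _ [B mB <-]]; rewrite setTI /= (ord1 i).
pose S' := [set B : set R | S ((fun x : rV => x ord0 j) @^-1` B)].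
suff : (@measurable _ (measurableTypeR R)) `<=` S' by apply.
have -> : @measurable _ (measurableTypeR R) = <<s @RGenOInfty.G R >>.
  exact: RGenOInfty.measurableE.
apply: smallest_sub.
  case: SS => S0 SC SU; split.
  - by rewrite /S' /= preimage_set0.
  - by move=> C S'C; rewrite /S' /= setTD preimage_setC -setTD; exact: SC.
  - by move=> F S'F; rewrite /S' /= preimage_bigcup; exact: SU.
move=> _ [a ->]; rewrite /S' /=.
rewrite (_ : _ @^-1` _ = [set x : rV | a < x ord0 j]).
  split; last exact: approximable_ray.
  have := @measurable_coord _ R 1 d ord0 j measurableT `]a, +oo[%classic (measurable_itv _).
  by rewrite setTI; congr measurable; apply/seteqP; split=> x /=; rewrite in_itv/= andbT.
by apply/seteqP; split=> x /=; rewrite in_itv/= andbT.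
Qed.
End approximation.
End density.

(** * L^1 duality and the fundamental lemma *)

Section duality.
Context {R : realType} {d : nat}.
Local Notation rV := 'rV[R]_d.
Local Notation mu := (@lebesgue_measure_rV R d).
Implicit Types (f g w rho psi : rV -> R) (M C : R).

Lemma cls_pos_measurable rho : cls rho -> measurable [set x | 0 < rho x].
Proof.
move=> cr; have := cls_meas cr measurableT (measurable_itv `]0, +oo[).
by rewrite setTI; congr measurable; apply/seteqP; split=> x /=; rewrite in_itv/= andbT.
Qed.

(** The lower bound [dl] on rho replaces the compact inclusion of the support in the open set where
    rho is positive. *)
Definition test_in rho psi := [/\ cls psi, exists M, bsup M psi &
  exists2 dl, 0 < dl & forall x, psi x != 0 -> dl <= rho x].

Lemma cutoffE rho (n : nat) (chi := fun x : rV => step (n%:R * rho x - 1) * step (n%:R - sq x)) :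
  cls rho -> [/\ test_in rho chi, forall x, 0 <= chi x <= 1 &
    forall x, rho x <= 0 -> chi x = 0].
Proof.
move=> cr; split.
- split.
  + apply: clsM; apply: cls_step.
      apply: clsB; last exact: cls_cst.
      by apply: clsM => //; exact: cls_cst.
    by apply: clsB; [exact: cls_cst|exact: cls_sq].
  (* Beyond this radius |x| >= 1, hence |x|^2 >= |x| > n and the second factor vanishes. *)
  + exists (n%:R + 1) => x nx; rewrite /chi [step (_ - sq x)]step_eq0 ?mulr0//.
    rewrite subr_le0 (le_trans _ (norm_le_sq x))//.
    have h1 : 1 <= `|x| by rewrite (le_trans _ (ltW nx))// lerDr.
    rewrite expr2 (le_trans _ (ler_peMr _ h1))// (le_trans _ (ltW nx))// lerDl//.
  (* n + 1 instead of n, so that n = 0 is covered as well. *)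
  + exists (n%:R + 1)^-1; first by rewrite invr_gt0 ltr_wpDl.
    move=> x; apply: contra_neqT; rewrite -ltNge => rx.
    rewrite /chi step_eq0 ?mul0r// subr_le0.
    have [r0|r0] := ltP 0 (rho x); last by rewrite (le_trans (mulr_ge0_le0 _ r0)).
    have n1 : 0 < n%:R + 1 :> R by rewrite ltr_wpDl.
    have h : (n%:R + 1) * rho x <= 1.
      by rewrite -[leRHS](mulfV (lt0r_neq0 n1)) ler_pM2l// ltW.
    by apply: le_trans h; rewrite ler_wpM2r ?lerDl// ltW.
- move=> x; have /andP[? ?] := step_itv (n%:R * rho x - 1).
  have /andP[? ?] := step_itv (n%:R - sq x).
  by rewrite mulr_ge0//= mulr_ile1.
- move=> x r0; rewrite /chi step_eq0 ?mul0r// subr_le0.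
  by rewrite (le_trans (mulr_ge0_le0 _ r0)).
Qed.

(** The sign of w is the ideal test function. It is replaced by 2 p - 1, where p in the class
    approximates the indicator of the set w > 0 in the weight |w| chi_n; Fatou's lemma then removes
    the cutoff chi_n. *)
Lemma L1_dual w rho K : locint w -> cls rho ->
  (forall psi, test_in rho psi -> (forall x, `|psi x| <= 1) ->
     II (fun x => w x * psi x) <= K) ->
  (\int[mu]_(x in [set x | (0 < rho x)%R]) `|w x|%:E <= K%:E)%E.
Proof.
move=> lw cr hK; have mw : measurable_fun setT w by case: lw.
pose chi (n : nat) (x : rV) := step (n%:R * rho x - 1) * step (n%:R - sq x).
have chiP n := cutoffE n cr.
have mchi n : measurable_fun setT (chi n) by have [[/cls_meas]] := chiP n.
have iwc n : itg (fun x => w x * chi n x).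
  have [[_ [M hM] _] c01 _] := chiP n.
  apply: (@itg_locint _ _ _ _ M 1) => // x.
  by have /andP[c0 c1] := c01 x; rewrite ger0_norm.
have ign n : itg (fun x => `|w x| * chi n x).
  apply: itg_eq (itg_norm (iwc n)) => x; rewrite normrM [`|chi n x|]ger0_norm//.
  by have [_ c01 _] := chiP n; case/andP: (c01 x).
pose P := [set x : rV | 0 < w x].
have mP : measurable P.
  have := mw measurableT `]0, +oo[%classic (measurable_itv _).
  by rewrite setTI; congr measurable; apply/seteqP; split=> x /=; rewrite in_itv/= andbT.
have key n : II (fun x => `|w x| * chi n x) <= K.
  have [[cchi [M hM] [dl dl0 hdl]] c01' _] := chiP n.
  have c01 x : 0 <= chi n x <= 1 by exact: c01'.
  apply/ler_addgt0Pr => e e0.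
  have e20 : 0 < e / 2 by rewrite divr_gt0.
  have g0 x : 0 <= `|w x| * chi n x by rewrite mulr_ge0//; case/andP: (c01 x).
  have [p [cp p01 pe]] := measurable_approximable (ign n) g0 mP e20.
  pose q x := (2 * p x - 1) * chi n x.
  have cq : cls q.
    by apply: clsM => //; apply: clsB; [apply: clsM => //; exact: cls_cst|exact: cls_cst].
  have tq : test_in rho q.
    split=> //; first by exists M => x /hM cx; rewrite /q /chi cx mulr0.
    exists dl => // x; rewrite /q mulf_eq0 negb_or => /andP[_ h]; exact: hdl.
  have q1 x : `|q x| <= 1.
    rewrite /q normrM; have /andP[? ?] := c01 x; have /andP[? ?] := p01 x.
    rewrite mulr_ile1// ?ler_norml; apply/andP; split; lra.
  have iwq : itg (fun x => w x * q x).
    have [_ [M' hM'] _] := tq.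
    by apply: (@itg_locint _ _ _ _ M' 1) => //; exact: cls_meas.
  have iap := itg_approx (ign n) g0 mP (cls_meas cp) p01.
  have E : II (fun x => `|w x| * chi n x) <=
      II (fun x => w x * q x + 2 * (`|w x| * chi n x * `|\1_P x - p x|)).
    apply: II_le => //.
      by apply: itgD => //; exact: itgZ.
    move=> x; rewrite /q; have /andP[c0 c1] := c01 x.
    have h : `|w x| = w x * (2 * \1_P x - 1).
      rewrite indicE; have [w0|w0] := ltP 0 (w x).
        by rewrite mem_set//= mulr1 gtr0_norm//; ring.
      rewrite memNset /P /=; last by apply/negP; rewrite -leNgt.
      by rewrite mulr0 sub0r mulrN1 ler0_norm.
    rewrite {1}h -subr_ge0.
    have -> : w x * ((2 * p x - 1) * chi n x) +
       2 * (`|w x| * chi n x * `|\1_P x - p x|) - w x * (2 * \1_P x - 1) * chi n x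
      = 2 * chi n x * (`|w x| * `|\1_P x - p x| - w x * (\1_P x - p x)) by ring.
    apply: mulr_ge0; first by rewrite mulr_ge0.
    by rewrite subr_ge0 -normrM ler_norm.
  rewrite (le_trans E)// IID//; last exact: itgZ.
  rewrite IIZ// lerD ?hK//.
  by rewrite mulrC -ler_pdivlMr.
pose U := [set x : rV | 0 < rho x].
have mU : measurable U by exact: cls_pos_measurable.
pose G n x := (`|w x| * chi n x)%:E.
have mG n : measurable_fun setT (G n).
  by apply/measurable_EFinP; apply: measurable_funM => //; exact: measurableT_comp.
have G0 n x : (0 <= G n x)%E.
  by rewrite lee_fin mulr_ge0//; have [_ c01 _] := chiP n; case/andP: (c01 x).
have FT := @fatou _ _ _ mu setT measurableT G mG (fun n x _ => G0 n x).
rewrite integral_mkcond.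
have lim x : G ^~ x @ \oo --> ((fun x => `|w x|%:E) \_ U) x.
  rewrite patchE; case: ifPn => [|]; last first.
    rewrite notin_setE /U /= => /negP; rewrite -leNgt => r0.
    apply: cvg_near_cst; apply: nearW => n; have [_ _ c0] := chiP n.
    by rewrite /G (_ : chi n x = 0) ?mulr0//; exact: c0.
  rewrite inE /U /= => r0.
  apply: cvg_near_cst.
  (* For large n both factors of [chi n x] are 1: n rho(x) >= 2 and n >= |x|^2 + 1. *)
  have [n1 _ h1] := near_infty_natSinv_lt (PosNum (divr_gt0 r0 (ltr0n _ 2))).
  exists (maxn n1.+1 (Num.bound (sq x + 1)).+1) => //= n /=.
  rewrite geq_max => /andP[n1n n2n].
  rewrite /G /chi !step_eq1 ?mulr1//.
    rewrite lerBrDr addrC; apply: ltW; apply: lt_le_trans (archi_boundP _) _; first by rewrite addr_ge0// sq_ge0.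
    by rewrite ler_nat ltnW.
  case: n n1n n2n => // n n1n _.
  have h : n.+1%:R^-1 < rho x / 2 := h1 n n1n.
  have n0 : 0 < n.+1%:R :> R by rewrite ltr0n.
  have h2 : 1 < n.+1%:R * (rho x / 2).
    by rewrite -[ltLHS](mulfV (lt0r_neq0 n0)) ltr_pM2l.
  by rewrite lerBrDr; rewrite mulrA in h2; lra.
have -> : (\int[mu]_x ((fun x => `|w x|%:E) \_ U) x = \int[mu]_x limn_einf (G ^~ x))%E.
  apply: eq_integral => x _; rewrite is_cvg_limn_einfE; last by apply/cvg_ex; eexists; exact: lim.
  by apply/esym/cvg_lim => //; exact: lim.
apply: (le_trans FT); rewrite limn_einf_lim; apply: lime_le.
  exact: is_cvg_einfs.
apply: nearW => n; apply: (@le_trans _ _ (\int[mu]_x G n x)%E).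
  by apply: ereal_inf_lbound; exists n => /=.
by rewrite -EFin_II// lee_fin.
Qed.

Lemma fundamental_lemma w rho : locint w -> cls rho ->
  (forall psi, test_in rho psi -> II (fun x => w x * psi x) = 0) ->
  {ae mu, forall x, 0 < rho x -> w x = 0}.
Proof.
move=> lw cr h; have mU := cls_pos_measurable cr.
have mw : measurable_fun setT w by case: lw.
have : (\int[mu]_(x in [set x | (0 < rho x)%R]) `|(w x)%:E| = 0)%E.
  apply/eqP; rewrite eq_le integral_ge0// andbT.
  by apply: (@L1_dual w rho 0) => // psi tpsi _; rewrite h.
move=> /(iffLR (@ae_eq_integral_abs _ _ _ mu _ mU (EFin \o w)
  (iffRL (measurable_EFinP _ _) (measurable_funTS mw)))).
by apply: filterS => x /= hx r0; have [] := hx r0.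
Qed.

End duality.

(** * Paths and integration by parts *)

Section calculus1.
Context {R : realType}.
Implicit Types (N : R -> R) (a b x y t : R).

Lemma derive0_itv N a b : (forall t, a < t < b -> is_derive t 1 N 0) ->
  forall x y, a < x < b -> a < y < b -> N x = N y.
Proof.
move=> dN; suff H x y : a < x < b -> a < y < b -> x < y -> N x = N y.
  move=> x y hx hy; have [xy|yx|->//] := ltgtP x y; first exact: H.
  by apply/esym; exact: H.
move=> /andP[ax xb] /andP[ay yb] xy.
have [t _] : exists2 t, t \in `]x, y[ & N y - N x = 0 * (y - x).
  apply: (@MVT _ N (fun=> 0)) => // [t|].
    by rewrite in_itv/= => /andP[xt ty]; apply: dN; rewrite (lt_trans ax)//= (lt_trans ty).
  apply: derivable_within_continuous => t; rewrite in_itv/= => /andP[xt ty].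
  by apply: ex_derive; apply: dN; rewrite (lt_le_trans ax)//= (le_lt_trans ty).
by rewrite mul0r => /eqP; rewrite subr_eq0 => /eqP ->.
Qed.

Lemma derive2_itv N N' a b : (forall t, a < t < b -> is_derive t 1 N (N' t)) ->
  (forall t, a < t < b -> is_derive t 1 N' 0) ->
  forall x, a < x < b -> forall y, a < y < b -> N y = N x + N' x * (y - x).
Proof.
move=> dN dN' x hx y hy.
have cN' := derive0_itv dN'.
have d0 t : a < t < b -> is_derive t 1 (fun s => N s - N' x * s) 0.
  move=> ht; have h1 := dN t ht.
  have h2 : is_derive t 1 (fun s : R => N' x * s) (N' x).
    have := is_deriveZ (N' x) (is_derive_id t (1 : R)).
    by rewrite [_ *: 1]mulr1.
  have := is_deriveB h1 h2.
  by rewrite (cN' t x)// subrr.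
have := derive0_itv d0 hx hy => h; apply/eqP.
rewrite -subr_eq0; apply/eqP; transitivity ((N y - N' x * y) - (N x - N' x * x)).
  by ring.
by rewrite h subrr.
Qed.
End calculus1.

Section paths.
Context {R : realType} {d : nat}.
Local Notation rV := 'rV[R]_d.
Local Notation mu := (@lebesgue_measure_rV R d).
Implicit Types (f g w rho psi : rV -> R) (M C : R).

Lemma partial_near_eq f g i (x : rV) : (\near x, f x = g x) ->
  partial i f x = partial i g x.
Proof. by move=> fg; rewrite /partial (near_eq_derive _ fg). Qed.

Lemma partial_bsup f i M : bsup M f -> bsup M (partial i f).
Proof.
move=> fM x xM; rewrite (@partial_near_eq f (fun=> 0)) ?partial_cst//.
near=> y; apply: fM; near: y.
exact: (@norm_continuous _ rV x _ (lt_nbhsr xM)).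
Unshelve. all: by end_near. Qed.

Lemma bsup_bounded f M : continuous f -> bsup M f ->
  exists2 C, 0 <= C & forall x, `|f x| <= C.
Proof.
move=> cf fM; have [C C0 hC] := continuous_bounded_cball M cf.
exists C => // x; have [xM|xM] := leP `|x| M; first exact: hC.
by rewrite fM// normr0.
Qed.

Lemma itg_test w f M : locint w -> continuous f -> bsup M f -> itg (fun x => w x * f x).
Proof.
move=> lw cf fM; have [C C0 hC] := bsup_bounded cf fM.
by apply: (@itg_locint _ _ _ _ M C) => //; exact: continuous_measurable_rV.
Qed.

Lemma smooth_cont f : smooth f -> continuous f.
Proof. by move=> sf; have [] := sf [::]. Qed.

Lemma smooth_derivable f i x : smooth f -> derivable f x (delta_mx ord0 i).
Proof. by move=> sf; have [_] := sf [::]. Qed.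

Lemma smooth_partial f i : smooth f -> smooth (partial i f).
Proof. by move=> sf s; have := sf (rcons s i); rewrite foldr_rcons. Qed.

(** A derivative of a product is a sum of products, so smoothness of products is not inductive by
    itself; the span under sums and products is closed under [partial]. *)
Inductive smooth_span : (rV -> R) -> Prop :=
| smooth_span_base f : smooth f -> smooth_span f
| smooth_spanD f g : smooth_span f -> smooth_span g -> smooth_span (fun x => f x + g x)
| smooth_spanM f g : smooth_span f -> smooth_span g -> smooth_span (fun x => f x * g x).

Lemma smooth_span_continuous f : smooth_span f -> continuous f.
Proof.
elim=> [g sg|g h _ cg _ ch x|g h _ cg _ ch x]; first exact: smooth_cont.
- exact: cvgD (cg x) (ch x).
- exact: cvgM (cg x) (ch x).
Qed.

Lemma smooth_span_derivable f i x : smooth_span f -> derivable f x (delta_mx ord0 i).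
Proof.
elim=> [g sg|g h _ cg _ ch|g h _ cg _ ch]; first exact: smooth_derivable.
- exact: derivableD.
- exact: derivableM.
Qed.

Lemma smooth_span_partial f i : smooth_span f -> smooth_span (partial i f).
Proof.
elim=> [g sg|g h sg spg sh sph|g h sg spg sh sph].
- exact/smooth_span_base/smooth_partial.
- rewrite (_ : partial i _ = fun x => partial i g x + partial i h x).
    exact: smooth_spanD.
  by apply/funext => x; apply: partialD; exact: smooth_span_derivable.
- rewrite (_ : partial i _ = fun x => g x * partial i h x + h x * partial i g x).
    by apply: smooth_spanD; exact: smooth_spanM.
  by apply/funext => x; apply: partialM; exact: smooth_span_derivable.
Qed.

Lemma smooth_span_smooth f : smooth_span f -> smooth f.
Proof.
move=> sf s; suff sfs : smooth_span (foldr partial f s).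
  split; first exact: smooth_span_continuous.
  by move=> i x; exact: smooth_span_derivable.
by elim: s => //= i s; exact: smooth_span_partial.
Qed.

Lemma smoothD f g : smooth f -> smooth g -> smooth (fun x => f x + g x).
Proof.
by move=> sf sg; apply: smooth_span_smooth; apply: smooth_spanD; exact: smooth_span_base.
Qed.

Lemma smoothM f g : smooth f -> smooth g -> smooth (fun x => f x * g x).
Proof.
by move=> sf sg; apply: smooth_span_smooth; apply: smooth_spanM; exact: smooth_span_base.
Qed.

Lemma gradf_bounded f M : cls f -> bsup M f ->
  exists2 C, 0 <= C & forall x v, `|gradf f x v| <= C * `|v|.
Proof.
move=> cf fM.
have /choice[C hC] i : exists C, 0 <= C /\ forall x, `|partial i f x| <= C.
  have [C C0 hC] := bsup_bounded (cls_cont (cls_partial i cf)) (@partial_bsup _ i _ fM).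
  by exists C.
exists (\sum_i C i); first by apply: sumr_ge0 => i _; have [] := hC i.
move=> x v; rewrite /gradf (le_trans (ler_norm_sum _ _ _))// mulr_suml ler_sum// => i _.
rewrite normrM mulrC ler_pM//; first by have [_] := hC i.
by have /rV_norm_leP[] := lexx `|v|.
Qed.

Lemma gradf_bsup f M x v : bsup M f -> M < `|x| -> gradf f x v = 0.
Proof.
move=> fM xM; rewrite /gradf big1// => i _.
by rewrite (partial_bsup i fM)// mulr0.
Qed.

Lemma int_path w f (a b : R) (v : rV) (t0 M : R) : locint w -> cls f -> bsup M f ->
  0 < a + t0 * b ->
  is_derive t0 1 (fun t : R => II (fun x => w x * f ((a + t * b) *: x + t *: v)))
   (II (fun x => w x * gradf f ((a + t0 * b) *: x + t0 *: v) (b *: x + v))).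
Proof.
move=> lw cf fM ab0.
(* Half of the scale at t0. For |t - t0| < r the scale stays above c, which confines the supports of
   the whole family to the ball of radius M'. *)
pose c := (a + t0 * b) / 2.
have c0 : 0 < c by rewrite divr_gt0.
pose r := Num.min 1 (c / (`|b| + 1)).
have b1 : 0 < `|b| + 1 by rewrite ltr_wpDl.
have r0 : 0 < r by rewrite lt_min ltr01 divr_gt0.
have tc t : `|t - t0| < r -> c <= a + t * b.
  rewrite lt_min => /andP[_ h].
  have : `|(t - t0) * b| <= c.
    rewrite normrM; apply: (@le_trans _ _ (c / (`|b| + 1) * (`|b| + 1))).
      by rewrite ler_pM// ?(ltW h)// lerDl.
    by rewrite divfK// gt_eqF.
  rewrite ler_norml => /andP[h1 _].
  have -> : a + t * b = c + c + (t - t0) * b by rewrite -splitr; ring.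
  by lra.
pose M' := (Num.max M 0 + (`|t0| + 1) * `|v|) / c.
have tb t x : `|t - t0| < r -> M' < `|x| -> M < `|(a + t * b) *: x + t *: v|.
  move=> ht; have ct := tc t ht; rewrite /M' ltr_pdivrMr// => h.
  have t1 : `|t| <= `|t0| + 1.
    rewrite -(subrK t0 t) addrC (le_trans (ler_normD _ _))// lerD2l.
    by move: ht; rewrite lt_min => /andP[/ltW].
  have h1 : `|t *: v| <= (`|t0| + 1) * `|v| by rewrite normrZ ler_wpM2r.
  have h2 : `|x| * c <= `|(a + t * b) *: x|.
    by rewrite normrZ mulrC ler_wpM2r// (le_trans ct)// ler_norm.
  have h3 : `|(a + t * b) *: x| - `|t *: v| <= `|(a + t * b) *: x + t *: v|.
    by rewrite -[t *: v]opprK normrN; exact: lerB_dist.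
  have h4 : M <= Num.max M 0 by rewrite le_max lexx.
  by lra.
have [C C0 hC] := bsup_bounded (cls_cont cf) fM.
have [C' C'0 hC'] := gradf_bounded cf fM.
have cl t : cls (fun x => f ((a + t * b) *: x + t *: v)) by exact: cls_affine.
apply: (@int_deriv R d w (fun t x => f ((a + t * b) *: x + t *: v))
  (fun t x => gradf f ((a + t * b) *: x + t *: v) (b *: x + v)) t0 r C
  (C' * (`|b| * Num.max M' 0 + `|v|)) M') => //.
- by move=> t _; exact: cls_meas.
- by move=> t ht x xM; apply: fM; exact: tb.
- by move=> t x _; exact: cls_path_is_derive.
- move=> t x ht; have [xM|xM] := leP `|x| M'; last first.
    rewrite (gradf_bsup _ fM (tb _ _ ht xM)) normr0.
    by rewrite mulr_ge0// addr_ge0// mulr_ge0// le_max lexx orbT.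
  rewrite (le_trans (hC' _ _))// ler_wpM2l// (le_trans (ler_normD _ _))// lerD2r.
  by rewrite normrZ ler_wpM2l// le_max xM.
- by move=> t ht x xM; apply: gradf_bsup (fM) _; exact: tb.
Qed.

Lemma locint_cst c : locint (fun _ : rV => c : R).
Proof. exact: (locint_cont (cls_cont (cls_cst c))). Qed.

Lemma itg_bsup f M : continuous f -> bsup M f -> itg f.
Proof.
move=> cf fM; apply: itg_eq (itg_test (locint_cst 1) cf fM) => x.
by rewrite mul1r.
Qed.

(** The integral of f(x + t e_i) does not depend on t, and its derivative at 0 is the integral of
    the partial derivative. *)
Lemma II_partial0 f i M : smooth f -> bsup M f -> II (partial i f) = 0.
Proof.
move=> sf fM.
pose v : rV := delta_mx ord0 i.
have cf := smooth_cont sf.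
have cp := smooth_cont (smooth_partial i sf).
have pM := @partial_bsup _ i _ fM.
have [C C0 hC] := bsup_bounded cf fM.
have [C' C'0 hC'] := bsup_bounded cp pM.
have tb (t : R) x : `|t - 0| < 1 -> M + `|v| < `|x| -> M < `|x + t *: v|.
  rewrite subr0 => t1 xM.
  have h1 : `|t *: v| <= `|v| by rewrite normrZ ler_piMl// ltW.
  have h3 : `|x| - `|t *: v| <= `|x + t *: v|.
    by rewrite -[t *: v]opprK normrN; exact: lerB_dist.
  by lra.
have D := @int_deriv _ _ (fun=> 1) (fun t x => f (x + t *: v))
  (fun t x => partial i f (x + t *: v)) 0 1 C C' (M + `|v|) ltr01 (locint_cst 1).
have {}D : is_derive (0 : R) (1 : R) (fun t : R => II (fun x => 1 * f (x + t *: v)))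
    (II (fun x => 1 * partial i f (x + 0 *: v))).
  apply: D => //.
  - move=> t _; rewrite (_ : (fun x => _) = f \o affn 1 (t *: v)).
      apply: measurableT_comp (measurable_affn _ _).
      exact: continuous_measurable_rV.
    by apply/funext => x; rewrite /affn/= scale1r.
  - by move=> t ht x xM; apply: fM; exact: tb.
  - by move=> t x _; apply: is_derive_line; exact: smooth_derivable.
  - by move=> t ht x xM; apply: pM; exact: tb.
have E : (fun t : R => II (fun x => 1 * f (x + t *: v))) = fun=> II f.
  apply/funext => t.
  have iff := itg_bsup cf fM.
  rewrite [RHS](II_affn (t *: v) ltr01 iff) expr1n mul1r.
  by congr II; apply/funext => x; rewrite mul1r /affn scale1r.
have E' : II (fun x => 1 * partial i f (x + 0 *: v)) = II (partial i f).
  by congr II; apply/funext => x; rewrite mul1r scale0r addr0.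
rewrite E E' in D; have [_ <-] := D.
by rewrite derive_cst.
Qed.

Lemma ibp f g i M : smooth f -> smooth g -> bsup M g ->
  II (fun x => f x * partial i g x) = - II (fun x => partial i f x * g x).
Proof.
move=> sf sg gM.
have lf := locint_cont (smooth_cont sf).
have lpf := locint_cont (smooth_cont (smooth_partial i sf)).
have i1 := itg_test lf (smooth_cont (smooth_partial i sg)) (@partial_bsup _ i _ gM).
have i2 := itg_test lpf (smooth_cont sg) gM.
apply/eqP; rewrite -addr_eq0 -IID//; apply/eqP.
have fgM : bsup M (fun x => f x * g x) by move=> x xM; rewrite gM// mulr0.
rewrite -(II_partial0 i (smoothM sf sg) fgM); congr II; apply/funext => x.
rewrite (partialM (@smooth_derivable _ i x sf) (@smooth_derivable _ i x sg)).
by rewrite [X in _ = _ + X]mulrC.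
Qed.

End paths.

(** * Schatten norms *)

Section schatten.
Context {R : realType}.

Section basics.
Variable d : nat.
Implicit Types (M N : 'M[R]_d) (s t : 'rV[R]_d) (q : \bar R).

(** [singular_values] is a choice, determined only up to order. What the characteristic polynomial
    of the Gram matrix determines is the multiset of the squares, so norms are compared through
    it. *)
Definition sqseq s := [seq s ord0 i ^+ 2 | i <- index_enum 'I_d].

Lemma lp_norm_perm q s t : perm_eq (sqseq s) (sqseq t) -> lp_norm q s = lp_norm q t.
Proof.
have E (u : 'rV[R]_d) i : `|u ord0 i| = Num.sqrt (u ord0 i ^+ 2) by rewrite sqrtr_sqr.
move=> st; case: q => [q| |]//=.
- congr (_ `^ _).
  have F (u : 'rV[R]_d) : \sum_i `|u ord0 i| `^ q = \sum_(z <- sqseq u) Num.sqrt z `^ q.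
    by rewrite big_map; apply: eq_bigr => i _; rewrite E.
  by rewrite !F; exact: perm_big.
- have le (u v : 'rV[R]_d) : perm_eq (sqseq u) (sqseq v) ->
      \big[Num.max/0]_i `|u ord0 i| <= \big[Num.max/0]_i `|v ord0 i|.
    move=> uv; apply/bigmax_leP; split; first by rewrite bigmax_idl le_max lexx.
    move=> i _; have : u ord0 i ^+ 2 \in sqseq v.
      by rewrite -(perm_mem uv); apply/mapP; exists i => //; exact: mem_index_enum.
    by move=> /mapP[j _ ij]; rewrite E ij -E; exact: (le_bigmax _ (fun j => `|v ord0 j|)).
  by apply/eqP; rewrite eq_le !le// perm_sym.
Qed.

Lemma singular_values_perm M s t : is_singular_values M s -> is_singular_values M t ->
  perm_eq (sqseq s) (sqseq t).
Proof.
move=> [_ hs] [_ ht]; apply: prod_XsubC_eq.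
by rewrite !big_map -hs -ht.
Qed.

Lemma schatten_normE q M s : is_singular_values M s -> schatten_norm q M = lp_norm q s.
Proof.
move=> Ms; apply: lp_norm_perm.
exact: singular_values_perm (singular_valuesP M) Ms.
Qed.

(** This gives invariance under left multiplication by an orthogonal matrix. *)
Lemma schatten_norm_gram q M N : M^T *m M = N^T *m N ->
  schatten_norm q M = schatten_norm q N.
Proof.
move=> MN; rewrite (schatten_normE q (s := singular_values N))//.
by have := singular_valuesP N; rewrite /is_singular_values MN.
Qed.

Lemma char_poly_scale (a : R) M : a != 0 ->
  char_poly (a *: M) = (a ^+ d)%:P * (char_poly M \Po (a^-1 *: 'X)).
Proof.
move=> a0; rewrite /char_poly -[_ \Po _]/(comp_poly _ _) -det_map_mx rmorphXn/= -detZ.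
congr (\det _); apply/matrixP => i j; rewrite !mxE rmorphB/= comp_polyC.
rewrite mulrBr polyCM; congr (_ - _).
case: (i == j); last by rewrite !mulr0n comp_poly0 mulr0.
by rewrite !mulr1n comp_polyX mul_polyC scalerA mulfV// scale1r.
Qed.

Lemma is_singular_valuesZ (a : R) M s : is_singular_values M s ->
  is_singular_values (a *: M) (`|a| *: s).
Proof.
move=> [s0 hs]; split=> [i|]; first by rewrite mxE mulr_ge0.
have [->|a0] := eqVneq a 0.
  rewrite scale0r trmx0 mul0mx normr0 scale0r.
  rewrite char_poly_trig ?mx0_is_trig//; apply: eq_bigr => i _.
  by rewrite !mxE expr0n.
have aa0 : a ^+ 2 != 0 by rewrite expf_neq0.
have -> : (a *: M)^T = a *: M^T by apply/matrixP => i j; rewrite !mxE.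
rewrite -scalemxAl -scalemxAr scalerA -expr2 char_poly_scale// hs.
rewrite rmorph_prod/= -[d in _ ^+ d]card_ord -prodr_const rmorph_prod/= -big_split/=.
apply: eq_bigr => i _.
rewrite rmorphB/= comp_polyX comp_polyC mulrBr mul_polyC scalerA mulfV// scale1r.
by rewrite -polyCM mxE exprMn real_normK ?num_real.
Qed.

Lemma schatten_normZ q (a : R) M : (1 <= q)%E ->
  schatten_norm q (a *: M) = `|a| * schatten_norm q M.
Proof.
move=> q1; rewrite (schatten_normE q (is_singular_valuesZ a (singular_valuesP M))).
rewrite /schatten_norm; set s := singular_values M.
case: q q1 => [q| |]//= q1.
- have q0 : 0 < q by rewrite (lt_le_trans ltr01)//.
  rewrite -[X in _ = X * _](powRr1 (normr_ge0 _)) -(mulfV (lt0r_neq0 q0)) powRrM.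
  rewrite -powRM ?powR_ge0//; last by apply: sumr_ge0 => i _; exact: powR_ge0.
  rewrite mulr_sumr; congr (_ `^ _); apply: eq_bigr => i _.
  by rewrite mxE normrM normr_id powRM.
- under eq_bigr do rewrite mxE normrM normr_id.
  apply/eqP; rewrite eq_le; apply/andP; split.
    apply/bigmax_leP; split; first by rewrite mulr_ge0// bigmax_idl le_max lexx.
    by move=> i _; rewrite ler_wpM2l//; exact: (le_bigmax _ (fun j => `|s ord0 j|)).
  have [->|a0] := eqVneq a 0; first by rewrite normr0 mul0r bigmax_idl le_max lexx.
  have {}a0 : 0 < `|a| by rewrite normr_gt0.
  rewrite -ler_pdivlMl//; apply/bigmax_leP; split.
    by rewrite mulr_ge0// ?invr_ge0// bigmax_idl le_max lexx.
  move=> i _; rewrite ler_pdivlMl//.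
  exact: (le_bigmax _ (fun j => `|a| * `|s ord0 j|)).
Qed.

(** Both sides are the trace of M^T M, the left one read off from the subleading coefficient of its
    characteristic polynomial. *)
Lemma sum_singular_values M s : is_singular_values M s ->
  \sum_i s ord0 i ^+ 2 = \sum_i \sum_j M i j ^+ 2.
Proof.
case: (posnP d) M s => [d0|d0] M s [_ hs].
  have h (F : 'I_d -> R) : \sum_i F i = 0.
    by rewrite big1// => -[i hi]; exfalso; move: (hi); rewrite d0.
  by rewrite !h.
have sz : size (sqseq s) = d by rewrite size_map -[RHS](size_enum_ord d) enumT.
have sz0 : size (sqseq s) != 0%N by rewrite sz -lt0n.
have h1 := coefPn_prod_XsubC sz0; rewrite sz in h1.
have h2 := char_poly_trace (M^T *m M) d0.
have h3 : \prod_(z <- sqseq s) ('X - z%:P) = char_poly (M^T *m M).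
  by rewrite hs big_map.
rewrite h3 h2 in h1; have {}h1 := oppr_inj h1.
transitivity (\sum_(z <- sqseq s) z); first by rewrite big_map.
rewrite -h1 /mxtrace exchange_big; apply: eq_bigr => i _; rewrite mxE.
by apply: eq_bigr => j _; rewrite mxE expr2.
Qed.

(** Each singular value is at most the Frobenius norm, hence at most d * B; the exact constant does
    not matter. *)
Lemma schatten_norm_bound q : (0 < d)%N -> (1 <= q)%E -> exists2 C, 0 < C &
  forall M B, (forall i j, `|M i j| <= B) -> schatten_norm q M <= C * B.
Proof.
move=> d0 q1.
have sB M B : 0 <= B -> (forall i j, `|M i j| <= B) ->
    forall i, `|singular_values M ord0 i| <= d%:R * B.
  move=> B0 MB i; rewrite -sqrtr_sqr.
  rewrite -[leRHS](ger0_norm (mulr_ge0 (ler0n _ _) B0)) -[leRHS]sqrtr_sqr.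
  rewrite ler_wsqrtr//.
  apply: (@le_trans _ _ (\sum_i \sum_j M i j ^+ 2)).
    rewrite -(sum_singular_values (singular_valuesP M)) (bigD1 i)//= lerDl.
    by apply: sumr_ge0 => j _; exact: sqr_ge0.
  apply: (@le_trans _ _ (\sum_(i < d) \sum_(j < d) B ^+ 2)).
    apply: ler_sum => k _; apply: ler_sum => j _.
    by rewrite -real_normK ?num_real// lerXn2r// nnegrE.
  by rewrite !sumr_const !card_ord -mulrnA -[leLHS]mulr_natl natrM exprMn [_%:R ^+ 2]expr2.
have B0 M B : (forall i j, `|M i j| <= B) -> 0 <= B.
  by move=> MB; apply: le_trans (MB (Ordinal d0) (Ordinal d0)).
have dR : 0 < d%:R :> R by rewrite ltr0n.
case: q q1 => [q| |]//= q1.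
- have q0 : 0 < q by rewrite (lt_le_trans ltr01).
  exists (d%:R `^ q^-1 * d%:R) => [|M B MB]; first by rewrite mulr_gt0// powR_gt0.
  have dB : 0 <= d%:R * B by rewrite mulr_ge0// (B0 M B).
  rewrite /schatten_norm/=.
  apply: (@le_trans _ _ ((\sum_(i < d) (d%:R * B) `^ q) `^ q^-1)).
    apply: ge0_ler_powR; rewrite ?invr_ge0 ?(ltW q0)// ?nnegrE.
    - by apply: sumr_ge0 => i _; exact: powR_ge0.
    - by apply: sumr_ge0 => i _; exact: powR_ge0.
    - apply: ler_sum => i _; apply: ge0_ler_powR; rewrite ?(ltW q0)// ?nnegrE//.
      by apply: sB => //; exact: (B0 M B).
  rewrite sumr_const card_ord -[X in X `^ _]mulr_natl (powRM _ (ler0n _ _) (powR_ge0 _ _)).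
  by rewrite -powRrM mulfV ?gt_eqF// powRr1// mulrA.
- exists d%:R => // M B MB; rewrite /schatten_norm/=.
  have B0' := B0 M B MB.
  apply/bigmax_leP; split; first by rewrite mulr_ge0// ltW.
  by move=> i _; exact: sB.
Qed.
End basics.

End schatten.

(** * Rank-one perturbations of scalar matrices, and a trace bound for projections *)

Section schatten_rank1.
Context {R : realType}.

(** Matrix determinant lemma, by eliminating either off-diagonal block of the block matrix with rows
    (1, r) and (c, a). The ring will be that of polynomials, so a is not inverted: one factor a is
    cancelled at the end. *)
Lemma det_sub_rank1 (T : idomainType) n (a : T) (c : 'cV[T]_n.+1) (r : 'rV[T]_n.+1) :
  a != 0 -> \det (a%:M - c *m r) = a ^+ n * (a - (r *m c) ord0 ord0).
Proof.
move=> a0; pose B : 'M[T]_(1 + n.+1) := block_mx 1%:M r c a%:M.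
have e1 : block_mx 1%:M 0 (- c) 1%:M *m B = block_mx 1%:M r 0 (a%:M - c *m r).
  rewrite mulmx_block !mul1mx !mul0mx !addr0 mulmx1 addNr mulNmx.
  by congr block_mx; rewrite addrC.
have e2 : B *m block_mx a%:M 0 (- c) 1%:M = block_mx (a%:M - r *m c) r 0 a%:M.
  rewrite mulmx_block !mul1mx !mulmx0 !mulmx1 !mulmxN !add0r.
  by rewrite mul_mx_scalar mul_scalar_mx subrr.
have d1 := congr1 determinant e1; have d2 := congr1 determinant e2.
rewrite det_mulmx det_lblock det_ublock !det1 !mul1r in d1.
rewrite det_mulmx det_lblock det_ublock det1 mulr1 !det_scalar expr1 in d2.
apply: (mulIf a0); rewrite -d1 d2 det_mx11 !mxE mulr1n exprS.
by rewrite [a * _]mulrC mulrA; congr (_ * _); rewrite mulrC.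
Qed.

Section rank1.
Variable n : nat.
Implicit Types (x : 'rV[R]_n.+1) (al be : R).

Definition rank1 x : 'M[R]_n.+1 := x^T *m x.

Lemma rank1E x i j : rank1 x i j = x ord0 i * x ord0 j.
Proof. by rewrite !mxE big_ord1 !mxE. Qed.

Lemma rank1_sq x : rank1 x *m rank1 x = sq x *: rank1 x.
Proof.
apply/matrixP => i j; rewrite mxE [RHS]mxE rank1E /sq mulr_suml.
under eq_bigr do rewrite !rank1E.
by apply: eq_bigr => k _; ring.
Qed.

(** Absolute values of the eigenvalues of al + be x x^T: al + be |x|^2 along x, and al on the
    orthogonal complement. *)
Definition sv_rank1 al be x : 'rV[R]_n.+1 :=
  \row_i (if i == ord0 then `|al + be * sq x| else `|al|).

Lemma is_singular_values_rank1 al be x :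
  is_singular_values (al%:M + be *: rank1 x) (sv_rank1 al be x).
Proof.
split=> [i|]; first by rewrite mxE; case: ifP.
set a := al ^+ 2; set g := 2 * al * be + be ^+ 2 * sq x.
have -> : (al%:M + be *: rank1 x)^T *m (al%:M + be *: rank1 x) =
    a%:M + g *: rank1 x.
  have -> : (al%:M + be *: rank1 x)^T = al%:M + be *: rank1 x.
    rewrite linearD linearZ/= tr_scalar_mx; congr (_ + _ *: _).
    by apply/matrixP => i j; rewrite mxE !rank1E mulrC.
  rewrite mulmxDl !mulmxDr -!scalemxAl -!scalemxAr rank1_sq !scalerA.
  rewrite -scalar_mxM mul_scalar_mx mul_mx_scalar !scalerA -addrA -!scalerDl.
  congr (_%:M + _ *: _).
  by rewrite /g; ring.
have E : char_poly_mx (a%:M + g *: rank1 x) = ('X - a%:P)%:M -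
     map_mx polyC (g *: x^T) *m map_mx polyC x.
  rewrite -map_mxM -scalemxAl -/(rank1 x) /char_poly_mx map_mxD map_scalar_mx.
  by rewrite opprD addrA -raddfB.
have Xa : 'X - a%:P != 0 :> {poly R} by rewrite polyXsubC_eq0.
rewrite /char_poly E det_sub_rank1//.
have -> : (map_mx polyC x *m map_mx polyC (g *: x^T)) ord0 ord0 = (g * sq x)%:P.
  rewrite -map_mxM mxE; congr (_%:P); rewrite mxE /sq mulr_sumr.
  by apply: eq_bigr => i _; rewrite !mxE; ring.
rewrite big_ord_recl mulrC; congr (_ * _).
  rewrite mxE eqxx real_normK ?num_real// -addrA -opprD -polyCD; congr ('X - _%:P).
  by rewrite /a /g; ring.
rewrite -[n in LHS]card_ord -prodr_const; apply: eq_bigr => i _.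
by rewrite mxE /= real_normK ?num_real.
Qed.
End rank1.

Section svd.
Variable C : numClosedFieldType.
Local Open Scope sesquilinear_scope.

Lemma gram_diag m n (A : 'M[C]_(m, n)) i : (A *m A^t*) i i = \sum_k `|A i k| ^+ 2.
Proof. by rewrite !mxE; apply: eq_bigr => k _; rewrite !mxE normCK. Qed.

(** With B = diag(s) T, the trace is the sum of s_i times the inner product of the i-th rows of T P
    and S P, and w_i is the mean of the squared norms of these rows. Each is at most 1 because P is
    a projection, and they sum to at most n - 1 because of its trace. Keeping both constraints on w
    is what makes the later Hoelder bound sharp. *)
Lemma trace_svd n (S B P : 'M[C]_n) (s : 'I_n -> C) :
  S *m S^t* = 1%:M -> (forall i, 0 <= s i) ->
  B *m B^t* = diag_mx (\row_i (s i ^+ 2)) ->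
  P^t* = P -> P *m P = P -> \tr P <= n%:R - 1 ->
  exists2 w : 'I_n -> C, (forall i, 0 <= w i <= 1) /\ \sum_i w i <= n%:R - 1 &
    `|\tr (P *m S^t* *m B)| <= \sum_i s i * w i.
Proof.
move=> SS s0 BB Ph PP trP.
(* The inverse of 0 is 0: where [s i] vanishes, the row of [T] vanishes, and so does the row of
   [B]. *)
pose T := diag_mx (\row_i (s i)^-1) *m B.
have BT : B = diag_mx (\row_i s i) *m T.
  apply/matrixP => i j; rewrite /T !mul_diag_mx !mxE.
  have [si0|si0] := eqVneq (s i) 0; last by rewrite mulrA mulfV// mul1r.
  rewrite si0 mul0r.
  have : (B *m B^t*) i i = 0 by rewrite BB !mxE eqxx si0 expr0n.
  rewrite gram_diag => /eqP; rewrite psumr_eq0//.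
  by move=> /allP/(_ j (mem_index_enum _))/=; rewrite expf_eq0/= normr_eq0 => /eqP.
have TT : T *m T^t* = diag_mx (\row_i (s i != 0)%:R).
  have -> : T *m T^t* = diag_mx (\row_i (s i)^-1) *m (B *m B^t*) *m
      diag_mx (\row_i ((s i)^-1)^*).
    rewrite /T trmx_mul map_mxM/= tr_diag_mx map_diag_mx !mulmxA.
    by congr (_ *m diag_mx _); apply/rowP => i; rewrite !mxE.
  rewrite BB; apply/matrixP => i j.
  rewrite [LHS]mxE (bigD1 j)//= big1 ?addr0; last first.
    by move=> k kj; rewrite [diag_mx _ k j]mxE (negbTE kj) mulr0n mulr0.
  rewrite mxE (bigD1 i)//= big1 ?addr0; last first.
    by move=> k ki; rewrite mxE eq_sym (negbTE ki) mulr0n mul0r.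
  rewrite !mxE !eqxx.
  have [->|] := eqVneq i j; last by rewrite !mulr0n mulr0 mul0r.
  rewrite !mulr1n; have [sj0|sj0] := eqVneq (s j) 0.
    by rewrite sj0 expr0n/= mulr0 mul0r.
  rewrite (_ : (s j)^-1^* = (s j)^-1).
    by rewrite expr2 mulKf// mulfV.
  by apply/CrealP; rewrite rpredV; apply: ger0_real.
pose n1 i := ((T *m P) *m (T *m P)^t*) i i.
pose n2 i := ((S *m P) *m (S *m P)^t*) i i.
have projQ (Q A : 'M[C]_n) : Q^t* = Q -> Q *m Q = Q ->
    (A *m Q) *m (A *m Q)^t* = A *m Q *m A^t*.
  by move=> Qh QQ; rewrite trmx_mul map_mxM/= Qh mulmxA -(mulmxA A Q Q) QQ.
have proj (A : 'M[C]_n) := projQ P A Ph PP.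
have le (A : 'M[C]_n) i : ((A *m P) *m (A *m P)^t*) i i <= (A *m A^t*) i i.
  have Qh : (1%:M - P)^t* = 1%:M - P.
    rewrite -[in RHS]Ph; apply/matrixP => j k; rewrite !mxE rmorphB/=; congr (_ - _).
    by rewrite eq_sym conjC_nat.
  have QQ : (1%:M - P) *m (1%:M - P) = 1%:M - P.
    by rewrite mulmxBr mulmx1 mulmxBl mul1mx PP subrr subr0.
  have : 0 <= ((A *m (1%:M - P)) *m (A *m (1%:M - P))^t*) i i.
    by rewrite gram_diag sumr_ge0// => k _; rewrite exprn_ge0.
  rewrite projQ// mulmxBr mulmx1 mulmxBl -proj.
  by rewrite mxE [X in _ + X]mxE subr_ge0.
have n10 i : 0 <= n1 i by rewrite /n1 gram_diag sumr_ge0// => k _; rewrite exprn_ge0.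
have n20 i : 0 <= n2 i by rewrite /n2 gram_diag sumr_ge0// => k _; rewrite exprn_ge0.
have n11 i : n1 i <= (s i != 0)%:R.
  by rewrite /n1 (le_trans (le _ _))// TT !mxE eqxx mulr1n.
have n21 i : n2 i <= 1 by rewrite /n2 (le_trans (le _ _))// SS mxE eqxx.
have tr2 : \sum_i n2 i <= n%:R - 1.
  rewrite (_ : \sum_i n2 i = \tr P)//.
  rewrite -[LHS]/(\tr ((S *m P) *m (S *m P)^t*)) proj mxtrace_mulC mulmxA.
  by rewrite (mulmx1C SS) mul1mx.
(* Either all [s i] are nonzero, T is unitary and the sum is the trace of P; or one row of T is 0
   and the other n - 1 rows contribute at most 1 each. *)
have tr1 : \sum_i n1 i <= n%:R - 1.
  have [/forallP s1|] := boolP [forall i, s i != 0].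
    have TT1 : T *m T^t* = 1%:M.
      by rewrite TT; apply/matrixP => i j; rewrite !mxE s1.
    rewrite (_ : \sum_i n1 i = \tr P)//.
    rewrite -[LHS]/(\tr ((T *m P) *m (T *m P)^t*)) proj mxtrace_mulC mulmxA.
    by rewrite (mulmx1C TT1) mul1mx.
  rewrite negb_forall => /existsP[i0]; rewrite negbK => /eqP si0.
  rewrite (bigD1 i0)//=.
  have -> : n1 i0 = 0.
    by apply/eqP; rewrite eq_le n10 andbT (le_trans (n11 _))// si0 eqxx.
  rewrite add0r (@le_trans _ _ (\sum_(i | i != i0) 1))//.
    by apply: ler_sum => i _; rewrite (le_trans (n11 _))// lern1 leq_b1.
  have h : \sum_(i < n) 1 = n%:R :> C by rewrite sumr_const card_ord.
  by rewrite lerBrDl -h [leRHS](bigD1 i0).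
exists (fun i => (n1 i + n2 i) / 2).
  split=> [i|].
    rewrite divr_ge0 ?addr_ge0//= ler_pdivrMr// mul1r (natrD _ 1 1) lerD//.
    by rewrite (le_trans (n11 _))// lern1 leq_b1.
  by rewrite -mulr_suml big_split/= ler_pdivrMr// mulr_natr mulr2n lerD.
have -> : \tr (P *m S^t* *m B) = \sum_i s i * ((T *m P) *m (S *m P)^t*) i i.
  rewrite {1}BT mulmxA mxtrace_mulC mulmxA mxtrace_mulC.
  rewrite /mxtrace; apply: eq_bigr => i _.
  rewrite mul_diag_mx mxE [X in X * _]mxE; congr (_ * _).
  by rewrite trmx_mul map_mxM/= Ph -(mulmxA T P) (mulmxA P P) PP.
rewrite (le_trans (ler_norm_sum _ _ _))// ler_sum// => i _.
rewrite normrM ger0_norm// ler_wpM2l// mxE (le_trans (ler_norm_sum _ _ _))//.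
rewrite /n1 /n2 !gram_diag -big_split/= mulr_suml ler_sum// => k _.
rewrite !mxE normrM norm_conjC ler_pdivlMr//.
set u := `|_|; set v := `|_|; rewrite -subr_ge0.
have -> : u ^+ 2 + v ^+ 2 - u * v * 2 = (u - v) ^+ 2 by ring.
by rewrite real_exprn_even_ge0// rpredB// /u /v normr_real.
Qed.
End svd.
End schatten_rank1.
From mathcomp Require complex.

Section trace_bound.
Context {R : realType}.
Import complex.
Local Open Scope sesquilinear_scope.
Variable n : nat.

(** For x != 0, the orthogonal projection onto the complement of x. Up to the factor -1/|x| it is
    the Hessian of the cone inside the ball. *)
Definition proj_mx x : 'M[R]_n.+1 := 1%:M - (sq x)^-1 *: rank1 x.

Lemma proj_mx_tr x : (proj_mx x)^T = proj_mx x.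
Proof.
rewrite linearB linearZ/= trmx1; congr (_ - _ *: _).
by apply/matrixP => i j; rewrite mxE !rank1E mulrC.
Qed.

Lemma proj_mx_idem x : sq x != 0 -> proj_mx x *m proj_mx x = proj_mx x.
Proof.
move=> x0; rewrite mulmxBr mulmx1 mulmxBl mul1mx -scalemxAl -scalemxAr rank1_sq.
by rewrite !scalerA -mulrA mulVf// mulr1 subrr subr0.
Qed.

Lemma tr_proj_mx x : sq x != 0 -> \tr (proj_mx x) = n%:R.
Proof.
move=> x0; rewrite linearB linearZ/= mxtrace1 (_ : \tr (rank1 x) = sq x).
  by rewrite mulVf// -natr1 addrK.
by rewrite /mxtrace /sq; apply: eq_bigr => i _; rewrite rank1E expr2.
Qed.

(** The spectral theorem is applied over the complex numbers. If S diagonalizes E^T E, then B = S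
    E^T has Gram matrix B B^* diagonal, and the trace in [trace_svd] becomes that of P E^T, which
    equals that of P E. *)
Lemma trace_singular_values (E : 'M[R]_n.+1) x : sq x != 0 ->
  exists s w : 'rV[R]_n.+1, [/\ is_singular_values E s,
    forall i, 0 <= w ord0 i <= 1, \sum_i w ord0 i <= n%:R &
    `|\tr (proj_mx x *m E)| <= \sum_i s ord0 i * w ord0 i].
Proof.
move=> x0.
pose iC : {rmorphism R -> complex R} := real_complex R.
have conj_iC r : Num.conj (iC r) = iC r by exact: (conjc_real r).
have ge0_iC r : (0 <= iC r) = (0 <= r) by rewrite -(rmorph0 iC) lecR.
have ReK (z : complex R) : 0 <= z -> iC (complex.Re z) = z.
  by case: z => a b; rewrite lecE/= => /andP[/eqP -> _].
pose EC := map_mx iC E.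
have hEC m k (M : 'M[R]_(m, k)) : (map_mx iC M)^t* = map_mx iC M^T.
  by apply/matrixP => i j; rewrite !mxE; exact: conj_iC.
pose A := EC^T *m EC.
have AE0 : A = map_mx iC (E^T *m E) by rewrite /A /EC map_mxM map_trmx.
have Asym : A \is normalmx.
  apply/normalmxP; suff -> : A ^t* = A by [].
  by rewrite AE0 hEC trmx_mul trmxK.
have /orthomx_spectralP AE := Asym.
set S := spectralmx A in AE; set D := spectral_diag A in AE.
have Su : S \is unitarymx by exact: spectral_unitarymx.
have SS : S *m S^t* = 1%:M by exact/unitarymxP.
have SS' : S^t* *m S = 1%:M by exact: mulmx1C.
pose B := S *m EC^T.
have DE : B *m B^t* = diag_mx D.
  have hB : (EC^T)^t* = EC by rewrite /EC map_trmx hEC trmxK.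
  rewrite /B trmx_mul map_mxM/= hB mulmxA -(mulmxA S) -/A.
  by rewrite AE invmx_unitary// !mulmxA SS mul1mx -mulmxA SS mulmx1.
have D0 i : 0 <= D ord0 i.
  have := gram_diag B i; rewrite DE mxE eqxx mulr1n => ->.
  by apply: sumr_ge0 => j _; rewrite exprn_ge0.
pose s : 'rV[R]_n.+1 := \row_i Num.sqrt (complex.Re (D ord0 i)).
have sE i : iC (s ord0 i) ^+ 2 = D ord0 i.
  by rewrite -rmorphXn/= mxE sqr_sqrtr ?ReK// -ge0_iC ReK.
have s0 i : 0 <= s ord0 i by rewrite mxE sqrtr_ge0.
have svs : is_singular_values E s.
  split=> //; apply: (@map_poly_inj _ _ iC).
  rewrite map_char_poly -AE0 AE.
  have SV : S \in unitmx := unitarymx_unit Su.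
  have -> : char_poly (invmx S *m diag_mx D *m S) = char_poly (diag_mx D).
    rewrite /char_poly; have -> : char_poly_mx (invmx S *m diag_mx D *m S) =
        map_mx polyC (invmx S) *m char_poly_mx (diag_mx D) *m map_mx polyC S.
      rewrite /char_poly_mx mulmxBr mulmxBl !map_mxM; congr (_ - _).
      by rewrite scalar_mxC -mulmxA -map_mxM mulVmx// map_mx1 mulmx1.
    by rewrite !det_mulmx mulrAC -det_mulmx -map_mxM mulVmx// map_mx1 det1 mul1r.
  rewrite char_poly_trig ?diag_mx_is_trig// rmorph_prod; apply: eq_bigr => i _.
  rewrite rmorphB/= map_polyX map_polyC; congr ('X - _%:P).
  by rewrite [LHS]mxE eqxx mulr1n -sE -(rmorphXn iC).
have [|||||w [w01 wn] hw] := @trace_svd _ _ S B (map_mx iC (proj_mx x)) (fun i => iC (s ord0 i)) SS.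
- by move=> i; rewrite ge0_iC.
- by rewrite DE; congr diag_mx; apply/rowP => i; rewrite [RHS]mxE sE.
- by rewrite hEC proj_mx_tr.
- by rewrite -map_mxM proj_mx_idem.
- by rewrite trace_map_mx tr_proj_mx// rmorph_nat -natr1 addrK.
have wE i : iC (complex.Re (w i)) = w i by apply: ReK; case/andP: (w01 i).
exists s, (\row_i complex.Re (w i)); split => //.
- by move=> i; rewrite mxE -!lecR; have := w01 i; rewrite -(wE i).
- rewrite -lecR -[leLHS]/(iC _) -[leRHS]/(iC _).
  have -> : iC (\sum_i (\row_i complex.Re (w i)) ord0 i) = \sum_i w i.
    by rewrite rmorph_sum; apply: eq_bigr => i _; rewrite mxE wE.
  by rewrite (le_trans wn)// -natr1 addrK rmorph_nat.
- have tE : \tr (map_mx iC (proj_mx x) *m S^t* *m B) = iC (\tr (proj_mx x *m E)).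
    rewrite /B !mulmxA -(mulmxA _ (S^t*)) SS' mulmx1 /EC map_trmx -map_mxM trace_map_mx.
    by rewrite -mxtrace_tr trmx_mul trmxK proj_mx_tr mxtrace_mulC.
  rewrite tE in hw.
  have nE r : `|iC r| = iC `|r|.
    have [r0|r0] := leP 0 r; first by rewrite !ger0_norm// ge0_iC.
    by rewrite !ltr0_norm ?rmorphN// -(rmorph0 iC) ltcR.
  rewrite nE in hw; rewrite -lecR -[leLHS]/(iC _) -[leRHS]/(iC _) (le_trans hw)// rmorph_sum.
  by apply: ler_sum => i _; rewrite rmorphM/= mxE wE.
Qed.
End trace_bound.

(** * The extremal matrix and the sharp trace inequality *)

Section extremal.
Context {R : realType}.
Variable n : nat.
Implicit Types (x : 'rV[R]_n.+1) (c tau : R).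

(** Eigenvalue -c on the complement of x and tau along x; tau is the size of a radial
    perturbation. *)
Definition extremal_mx c tau x : 'M[R]_n.+1 := - c *: proj_mx x + (tau / sq x) *: rank1 x.

Lemma extremal_mxE c tau x : extremal_mx c tau x =
  (- c)%:M + ((c + tau) / sq x) *: rank1 x.
Proof.
rewrite /extremal_mx scalerBr scalemx1 scalerA -addrA -scaleNr -scalerDl.
by congr (_ + _ *: _); ring.
Qed.

Lemma extremal_schatten q c tau x : sq x != 0 ->
  schatten_norm q (extremal_mx c tau x) =
  lp_norm q (\row_(i < n.+1) (if i == ord0 then `|tau| else `|c|)).
Proof.
move=> x0; rewrite extremal_mxE.
rewrite (schatten_normE q (is_singular_values_rank1 (- c) ((c + tau) / sq x) x)).
congr lp_norm; apply/rowP => i; rewrite !mxE normrN.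
by rewrite divfK// addKr.
Qed.

(** The first clause is Hoelder's inequality between the singular values of E and the weights w,
    whose sum is at most n. The second compares (1 + |tau|^q)^(1/q) with 1 + |tau|^q, where q > 1;
    for p = 1 the norm is max(1, |tau|), which is 1 for small tau. *)
Lemma schatten_extremal (p : R) (q := hoelder_conjugate p%:E) : (0 < n)%N -> 1 <= p ->
  (1 <= q)%E /\ exists2 c, 0 < c &
   (forall x E, sq x != 0 -> schatten_norm q E <= 1 -> `|\tr (proj_mx x *m E)| <= c * n%:R)
   /\ (forall e, 0 < e -> exists2 t0, 0 < t0 & forall x tau, sq x != 0 -> `|tau| <= t0 ->
         schatten_norm q (extremal_mx c tau x) <= 1 + e * `|tau|).
Proof.
move=> n0; rewrite le_eqVlt => /predU1P[p1|p1].
  have -> : q = +oo%E by rewrite /q -p1 hoelder_conjugate1.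
  split; first by rewrite leey.
  exists 1 => //; split=> [x E x0 E1|e e0].
    have [s [w [svs w01 wn le]]] := trace_singular_values E x0.
    rewrite (le_trans le)// mul1r (le_trans _ wn)//; apply: ler_sum => i _.
    have /andP[w0 w1] := w01 i; rewrite ler_piMl//.
    rewrite (le_trans (ler_norm _))// (le_trans _ E1)// (schatten_normE _ svs)/=.
    exact: (le_bigmax _ (fun j => `|s ord0 j|)).
  exists 1; first exact: ltr01.
  move=> x tau x0 tau1; rewrite extremal_schatten//=.
  apply: (@le_trans _ _ 1); last by rewrite lerDl mulr_ge0// ltW.
  apply/bigmax_leP; split=> // i _; rewrite mxE.
  by case: ifP => _; rewrite ?normr_id// normr1.
have p0 : 0 < p by rewrite (lt_trans ltr01).
have p10 : 0 < p - 1 by rewrite subr_gt0.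
pose r := p / (p - 1).
have r0 : 0 < r by rewrite divr_gt0.
have r1 : 1 < r by rewrite ltr_pdivlMr// mul1r ltrBlDr ltrDl.
have pr : p^-1 + r^-1 = 1 by rewrite /r invf_div; field; rewrite gt_eqF.
have qE : q = r%:E.
  apply/esym/hoelder_conjugateP; first by rewrite ltNyr.
    by rewrite gt_eqF// lte_fin.
  by rewrite !inver !gt_eqF// -EFinD pr.
rewrite qE; split; first by rewrite lee_fin ltW.
have nR : 0 < n%:R :> R by rewrite ltr0n.
pose c : R := n%:R `^ (- r^-1).
have c0 : 0 < c by rewrite powR_gt0.
have ncr : n%:R * c `^ r = 1.
  by rewrite /c -powRrM mulNr mulVf ?gt_eqF// powR_inv1 ?ltW// mulfV ?gt_eqF.
have cn : c * n%:R = n%:R `^ p^-1.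
  rewrite /c -[X in _ * X](powRr1 (ltW nR)) -powRD; last by rewrite (gt_eqF nR) implybT.
  by congr (_ `^ _); rewrite -pr; ring.
exists c => //; split=> [x E x0 E1|e e0].
- have [s [w [svs w01 wn le]]] := trace_singular_values E x0.
  have s0 i : 0 <= s ord0 i by case: svs.
  have S1 : \sum_i s ord0 i `^ r <= 1.
    move: E1; rewrite (schatten_normE _ svs)/=.
    under eq_bigr do rewrite ger0_norm//.
    set S := \sum_i _ => S1.
    have S0 : 0 <= S by apply: sumr_ge0 => i _; exact: powR_ge0.
    have -> : S = (S `^ r^-1) `^ r by rewrite -powRrM mulVf ?gt_eqF// powRr1.
    apply: (@le_trans _ _ (1 `^ r)); last by rewrite powR1.
    by apply: ge0_ler_powR => //; rewrite ?nnegrE ?powR_ge0// ltW.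
  (* Young's inequality is applied to s = (s t) t^-1. This t makes t^r and n t^-p both equal to
     n^(1/p), so that the two terms add up to n^(1/p) (1/r + 1/p). *)
  pose t : R := n%:R `^ (p^-1 * r^-1).
  have t0 : 0 < t by rewrite powR_gt0.
  have tr : t `^ r = n%:R `^ p^-1 by rewrite /t -powRrM mulfVK// gt_eqF.
  have tp : t^-1 `^ p * n%:R = n%:R `^ p^-1.
    rewrite -cn; congr (_ * _); rewrite -powR_inv1 ?ltW// -!powRrM /c.
    by congr (_ `^ _); field; rewrite !gt_eqF.
  have key i : s ord0 i <= t `^ r / r * s ord0 i `^ r + t^-1 `^ p / p.
    have := @conjugate_powR R (s ord0 i * t) t^-1 r p _ _ r0 p0 _.
    rewrite mulfK ?gt_eqF// => /(_ _ _ _)/le_trans; apply.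
    - by rewrite mulr_ge0// ltW.
    - by rewrite invr_ge0 ltW.
    - by rewrite addrC.
    - by rewrite powRM ?(ltW t0)// lerD2r le_eqVlt; apply/orP; left; apply/eqP; ring.
  rewrite (le_trans le)// cn.
  apply: (@le_trans _ _ (\sum_i (t `^ r / r * s ord0 i `^ r + t^-1 `^ p / p * w ord0 i))).
    apply: ler_sum => i _; have /andP[w0 w1] := w01 i.
    apply: (@le_trans _ _ ((t `^ r / r * s ord0 i `^ r + t^-1 `^ p / p) * w ord0 i)).
      by rewrite ler_wpM2r.
    by rewrite mulrDl lerD2r ler_piMr// mulr_ge0// ?divr_ge0 ?powR_ge0// ltW.
  rewrite big_split/= -!mulr_sumr.
  apply: (@le_trans _ _ (t `^ r / r * 1 + t^-1 `^ p / p * n%:R)).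
    by rewrite lerD// ler_wpM2l// divr_ge0 ?powR_ge0// ltW.
  rewrite mulr1 mulrAC tp tr -mulrDr [_ + _]addrC.
  by rewrite pr mulr1.
- have rm : 0 < r - 1 by rewrite subr_gt0.
  (* The value of |tau| at which |tau|^(r - 1) = e. *)
  exists (e `^ (r - 1)^-1); first by rewrite powR_gt0.
  move=> x tau x0 taue; rewrite extremal_schatten//= big_ord_recl mxE/= normr_id.
  under eq_bigr do rewrite mxE/= normr_id gtr0_norm//.
  rewrite sumr_const card_ord -mulr_natl ncr.
  have h1 : 1 <= `|tau| `^ r + 1 by rewrite lerDr powR_ge0.
  apply: le_trans (ler1_powR h1 _) _; first by rewrite invf_le1// ltW.
  rewrite addrC lerD2l -(mulr_powRB1 (normr_ge0 _) r0) mulrC ler_wpM2r//.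
  have Ee : e = (e `^ (r - 1)^-1) `^ (r - 1).
    by rewrite -powRrM mulVf ?gt_eqF// powRr1// ltW.
  rewrite [leRHS]Ee.
  by apply: ge0_ler_powR => //; rewrite ?nnegrE ?powR_ge0// ltW.
Qed.
End extremal.

(** * The distributional Hessian as a pairing *)

(* Sealed, because unification would otherwise unfold derivatives and integrals. *)
HB.lock Definition div2 {R : realType} {d : nat} (E : 'rV[R]_d -> 'M[R]_d) (x : 'rV[R]_d) : R :=
  \sum_i \sum_j partial i (partial j (fun y => E y i j)) x.

HB.lock Definition pairing {R : realType} {d : nat} (f : 'rV[R]_d -> R)
  (E : 'rV[R]_d -> 'M[R]_d) : R := II (fun x => f x * div2 E x).

Section pairing.
Context {R : realType} {d : nat}.
Local Notation rV := 'rV[R]_d.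
Local Notation mu := (@lebesgue_measure_rV R d).
Implicit Types (f g : rV -> R) (E F G : rV -> 'M[R]_d) (M C : R).

Lemma div2E E x : div2 E x = \sum_i \sum_j partial i (partial j (fun y => E y i j)) x.
Proof. by rewrite unlock. Qed.

Lemma pairingE f E : pairing f E = II (fun x => f x * div2 E x).
Proof. by rewrite unlock. Qed.

Lemma eq_pairing f E F : (forall x, f x * div2 E x = f x * div2 F x) ->
  pairing f E = pairing f F.
Proof.
by move=> h; rewrite !pairingE (_ : (fun x => _) = (fun x => f x * div2 F x))//; exact/funext.
Qed.

Definition msmooth E := forall i j, smooth (fun x => E x i j).
Definition mcls E := forall i j, cls (fun x => E x i j).
Definition mbsup M E := forall x, M < `|x| -> E x = 0.
Definition tfield E := msmooth E /\ exists M, mbsup M E.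

Lemma mbsup_entry M E i j : mbsup M E -> bsup M (fun x => E x i j).
Proof. by move=> h x /h ->; rewrite mxE. Qed.

Lemma test_fieldP E : test_field setT E <-> tfield E.
Proof.
split=> [[sE cE _]|[sE [M hM]]].
  split => //; have [M [_ hM]] := compact_bounded cE.
  exists (M + 1) => x xM; apply/eqP; apply/negPn/negP => Ex.
  have : closure [set x | E x != 0] x by exact: subset_closure.
  have M1 : M < M + 1 by rewrite ltrDl.
  by move/(hM _ M1); rewrite /= leNgt xM.
have sub : closure [set x | E x != 0] `<=` [set x | `|x| <= M].
  have cl : closed [set x : rV | `|x| <= M].
    by apply: compact_closed; [exact: norm_hausdorff|exact: compact_cball].
  apply: (subset_trans _ cl); apply: closureS => x /=; apply: contraNT.
  by rewrite -ltNge => /hM ->.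
split => //; apply: subclosed_compact (compact_cball (M := M)) sub.
exact: closed_closure.
Qed.

Lemma eq_smooth f g : f =1 g -> smooth f -> smooth g.
Proof. by move=> /funext ->. Qed.

Lemma eq_tfield E F : E =1 F -> tfield E -> tfield F.
Proof. by move=> /funext ->. Qed.

Lemma smooth_cst (c : R) : smooth (fun _ : rV => c).
Proof. exact: cls_smooth (cls_cst c). Qed.

Lemma tfieldD E F : tfield E -> tfield F -> tfield (fun x => E x + F x).
Proof.
move=> [sE [M hM]] [sF [N hN]]; split=> [i j|].
  by apply: eq_smooth (smoothD (sE i j) (sF i j)) => x; rewrite mxE.
exists (Num.max M N) => x; rewrite gt_max => /andP[/hM -> /hN ->].
by rewrite addr0.
Qed.

Lemma tfieldM g E : smooth g -> tfield E -> tfield (fun x => g x *: E x).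
Proof.
move=> sg [sE [M hM]]; split=> [i j|].
  by apply: eq_smooth (smoothM sg (sE i j)) => x; rewrite mxE.
by exists M => x /hM ->; rewrite scaler0.
Qed.

Lemma tfieldZ c E : tfield E -> tfield (fun x => c *: E x).
Proof. by move=> tE; apply: tfieldM => //; exact: smooth_cst. Qed.

Lemma tfield0 : tfield (fun=> 0).
Proof.
split=> [i j|]; first by apply: eq_smooth (smooth_cst 0) => x; rewrite mxE.
by exists 0.
Qed.

Lemma tfield_sum (I : Type) (s : seq I) (E : I -> rV -> 'M[R]_d) :
  (forall i, tfield (E i)) -> tfield (fun x => \sum_(i <- s) E i x).
Proof.
move=> tE; elim: s => [|i s IH].
  by apply: eq_tfield tfield0 => x; rewrite big_nil.
by apply: eq_tfield (tfieldD (tE i) IH) => x; rewrite big_cons.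
Qed.

Lemma smooth_sum (I : Type) (s : seq I) (F : I -> rV -> R) :
  (forall i, smooth (F i)) -> smooth (fun x => \sum_(i <- s) F i x).
Proof.
move=> tE; elim: s => [|i s IH].
  by apply: eq_smooth (smooth_cst 0) => x; rewrite big_nil.
by apply: eq_smooth (smoothD (tE i) IH) => x; rewrite big_cons.
Qed.

Lemma div2_cont_bsup E M : msmooth E -> mbsup M E ->
  continuous (div2 E) /\ bsup M (div2 E).
Proof.
move=> sE hM; split.
  apply: smooth_cont; rewrite (_ : div2 E = fun x =>
    \sum_i \sum_j partial i (partial j (fun y => E y i j)) x); last first.
    by apply/funext => x; rewrite div2E.
  apply: smooth_sum => i; apply: smooth_sum => j.
  by apply: smooth_partial; exact: smooth_partial.
move=> x xM; rewrite !div2E big1// => i _; rewrite big1// => j _.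
rewrite (@partial_bsup _ _ _ i M)//.
by apply: partial_bsup; exact: mbsup_entry.
Qed.

Lemma itg_pairing f E : locint f -> tfield E -> itg (fun x => f x * div2 E x).
Proof.
move=> lf [sE [M hM]]; have [cE bE] := div2_cont_bsup sE hM.
exact: itg_test cE bE.
Qed.

Lemma smooth_partialD f g i x : smooth f -> smooth g ->
  partial i (fun x => f x + g x) x = partial i f x + partial i g x.
Proof. by move=> sf sg; apply: partialD; exact: smooth_derivable. Qed.

Lemma smooth_partialDE f g i : smooth f -> smooth g ->
  partial i (fun x => f x + g x) = fun x => partial i f x + partial i g x.
Proof. by move=> sf sg; apply/funext => x; exact: smooth_partialD. Qed.

Lemma smooth_partialZE c f i : smooth f ->
  partial i (fun x => c * f x) = fun x => c * partial i f x.
Proof.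
move=> sf; apply/funext => x.
have dc : derivable (fun _ : rV => c) x (delta_mx ord0 i).
  exact: smooth_derivable (smooth_cst c).
rewrite (partialM dc (@smooth_derivable _ _ _ i x sf)).
by rewrite partial_cst mulr0 addr0.
Qed.

Lemma div2D E F x : msmooth E -> msmooth F ->
  div2 (fun x => E x + F x) x = div2 E x + div2 F x.
Proof.
move=> sE sF; rewrite !div2E -big_split/=; apply: eq_bigr => i _.
rewrite -big_split/=; apply: eq_bigr => j _.
under eq_fun do rewrite mxE.
rewrite (@smooth_partialDE _ _ j (sE i j) (sF i j)) smooth_partialD//;
  exact: smooth_partial.
Qed.

Lemma div2Z c E x : msmooth E -> div2 (fun x => c *: E x) x = c * div2 E x.
Proof.
move=> sE; rewrite !div2E mulr_sumr; apply: eq_bigr => i _.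
rewrite mulr_sumr; apply: eq_bigr => j _.
under eq_fun do rewrite mxE.
rewrite (@smooth_partialZE c _ j (sE i j)).
by rewrite (@smooth_partialZE c _ i (smooth_partial j (sE i j))).
Qed.

Lemma pairingD f E F : locint f -> tfield E -> tfield F ->
  pairing f (fun x => E x + F x) = pairing f E + pairing f F.
Proof.
move=> lf tE tF; rewrite !pairingE -IID; [|exact: itg_pairing..].
congr II; apply/funext => x; rewrite div2D ?mulrDr//; [by case: tE|by case: tF].
Qed.

Lemma pairingZ f c E : locint f -> tfield E ->
  pairing f (fun x => c *: E x) = c * pairing f E.
Proof.
move=> lf tE; rewrite !pairingE -IIZ; last exact: itg_pairing.
congr II; apply/funext => x; rewrite div2Z; first by ring.
by case: tE.
Qed.

Lemma pairingB f E F : locint f -> tfield E -> tfield F ->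
  pairing f (fun x => E x - F x) = pairing f E - pairing f F.
Proof.
move=> lf tE tF; have -> : (fun x => E x - F x) = (fun x => E x + -1 *: F x).
  by apply/funext => x; rewrite scaleN1r.
rewrite (pairingD lf tE (tfieldZ (-1) tF)) (pairingZ _ lf tF).
by rewrite mulN1r.
Qed.

Lemma pairing0 f : pairing f (fun=> 0) = 0.
Proof.
rewrite !pairingE -[RHS](@II0 R d); congr II; apply/funext => x.
rewrite !div2E big1 ?mulr0// => i _; rewrite big1// => j _.
rewrite (_ : (fun y : rV => _) = (fun=> 0)) ?partial_cst ?partial_cst//.
by apply/funext => y; rewrite mxE.
Qed.

Lemma pairing_sum f (I : Type) (s : seq I) (E : I -> rV -> 'M[R]_d) :
  locint f -> (forall i, tfield (E i)) ->
  pairing f (fun x => \sum_(i <- s) E i x) = \sum_(i <- s) pairing f (E i).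
Proof.
move=> lf tE; elim: s => [|i s IH].
  rewrite big_nil -(pairing0 f); congr (pairing f).
  by apply/funext => x; rewrite big_nil.
rewrite (_ : (fun x => _) = (fun x => E i x + \sum_(k <- s) E k x)); last first.
  by apply/funext => x; rewrite big_cons.
by rewrite big_cons pairingD// ?IH//; exact: tfield_sum.
Qed.

Lemma pairingDl f g E : locint f -> locint g -> tfield E ->
  pairing (fun x => f x + g x) E = pairing f E + pairing g E.
Proof.
move=> lf lg tE; rewrite !pairingE -IID; [|exact: itg_pairing..].
by congr II; apply/funext => x; rewrite mulrDl.
Qed.

Lemma pairingZl f c E : locint f -> tfield E ->
  pairing (fun x => c * f x) E = c * pairing f E.
Proof.
move=> lf tE; rewrite !pairingE -IIZ; last exact: itg_pairing.
by congr II; apply/funext => x; rewrite mulrA.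
Qed.

Lemma partial_eq_on (U : set rV) f g i : open U -> {in U, f =1 g} ->
  {in U, partial i f =1 partial i g}.
Proof.
move=> oU fg x; rewrite inE => Ux; apply: partial_near_eq.
near=> y; apply: fg; rewrite inE; near: y; exact: open_nbhs_nbhs.
Unshelve. all: by end_near. Qed.

Lemma div2_eq_on (U : set rV) E F : open U -> {in U, E =1 F} ->
  {in U, div2 E =1 div2 F}.
Proof.
move=> oU EF x Ux; rewrite !div2E; apply: eq_bigr => i _; apply: eq_bigr => j _.
apply: (@partial_eq_on U _ _ i oU _ x Ux) => y Uy.
apply: (@partial_eq_on U _ _ j oU _ y Uy) => z Uz.
by rewrite EF.
Qed.

Lemma open_cls_gt f (a : R) : cls f -> open [set x | a < f x].
Proof.
move=> cf; rewrite (_ : mkset _ = f @^-1` [set y | a < y]); last by [].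
by apply: open_comp => [x _|]; [exact: cls_cont|exact: open_gt].
Qed.

Lemma open_cls_lt f (a : R) : cls f -> open [set x | f x < a].
Proof.
move=> cf; rewrite (_ : mkset _ = f @^-1` [set y | y < a]); last by [].
by apply: open_comp => [x _|]; [exact: cls_cont|exact: open_lt].
Qed.

Lemma hvarE (p : \bar R) f : locint f ->
  hessian_schatten_variation p f setT =
  ereal_sup [set (pairing f E)%:E | E in [set E | tfield E /\
     forall x, schatten_norm (hoelder_conjugate p) (E x) <= 1]].
Proof.
move=> lf; congr ereal_sup; apply/seteqP; split=> y [E [/= tE E1] <-].
  exists E; first by split=> //; exact/test_fieldP.
  rewrite pairingE EFin_II; last by apply: itg_pairing => //; exact/test_fieldP.
  apply: eq_integral => x _; congr EFin; rewrite div2E mulr_sumr.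
  by apply: eq_bigr => i _; rewrite mulr_sumr.
exists E; first by split=> //; exact/test_fieldP.
rewrite pairingE EFin_II; last exact: itg_pairing.
apply: eq_integral => x _; congr EFin; rewrite div2E mulr_sumr.
by apply: eq_bigr => i _; rewrite mulr_sumr.
Qed.

End pairing.

(** * The cone inside the ball *)

Section radial.
Context {R : realType} {n : nat}.
Local Notation d := n.+1.
Local Notation rV := 'rV[R]_d.
Implicit Types (f g : rV -> R) (E F G : rV -> 'M[R]_d) (x : rV).

Lemma nbhs_infty_gerS (r : R) : \forall m \near \oo%classic, r <= m.+1%:R.
Proof.
near=> m; have h : r <= m%:R by near: m; exact: nbhs_infty_ger.
by rewrite (le_trans h)// ler_nat.
Unshelve. all: by end_near. Qed.

Lemma fcone_outer (x : rV) : 1 <= sq x -> fcone x = 0.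
Proof.
move=> x1; rewrite /fcone max_r// subr_le0 /euclidean_norm -/(sq x).
by rewrite -[leLHS]sqrtr1 ler_wsqrtr.
Qed.

Lemma fcone_inner (x : rV) : sq x <= 1 -> fcone x = 1 - Num.sqrt (sq x).
Proof.
move=> x1; rewrite /fcone max_l// subr_ge0 /euclidean_norm -/(sq x).
by rewrite -[leRHS]sqrtr1 ler_wsqrtr.
Qed.

Lemma locint_fcone : locint (@fcone R d).
Proof.
apply: locint_cont => x.
have cs : {for x, continuous (fun y : rV => Num.sqrt (sq y))}.
  apply: continuous_comp; first exact: (cls_cont cls_sq).
  exact: sqrt_continuous.
apply: (@continuous_max _ _ (fun y : rV => 1 - Num.sqrt (sq y)) (fun=> 0)).
  apply: (@continuousB R R^o rV (fun=> 1) (fun y => Num.sqrt (sq y))) => //.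
  exact: cst_continuous.
exact: cst_continuous.
Qed.

Lemma tfield_bounded E : tfield E -> exists2 B, 0 < B & forall x i j, `|E x i j| <= B.
Proof.
move=> [sE [M hM]].
have /choice[B hB] (ij : 'I_d * 'I_d) : exists B, 0 <= B /\ forall x, `|E x ij.1 ij.2| <= B.
  have [B B0 hB] := bsup_bounded (smooth_cont (sE ij.1 ij.2)) (mbsup_entry ij.1 ij.2 hM).
  by exists B.
exists (\sum_ij B ij + 1) => [|x i j].
  by rewrite ltr_wpDl// sumr_ge0// => ij _; have [] := hB ij.
have [_ h] := hB (i, j); rewrite (le_trans (h x))//.
rewrite (bigD1 (i, j))//= -addrA lerDl addr_ge0// sumr_ge0// => ij _.
by have [] := hB ij.
Qed.

Lemma partial_sq i : partial i (@sq R d) = fun x => 2 * x ord0 i.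
Proof.
have c k : cls (fun x : rV => x ord0 k ^+ 2).
  by under eq_fun do rewrite expr2; apply: clsM; exact: cls_coord.
have H (s : seq 'I_d) : partial i (fun x : rV => \sum_(k <- s) x ord0 k ^+ 2) =
    fun x => \sum_(k <- s) (i == k)%:R * (2 * x ord0 k).
  elim: s => [|k s IH]; first by under eq_fun do rewrite big_nil;
    rewrite partial_cst; apply/funext => x; rewrite big_nil.
  rewrite (_ : (fun x : rV => _) =
      (fun x => x ord0 k ^+ 2 + \sum_(k <- s) x ord0 k ^+ 2)); last first.
    by apply/funext => x; rewrite big_cons.
  rewrite partialDE//; last exact: cls_sum.
  rewrite IH; apply/funext => x; rewrite big_cons; congr (_ + _).
  rewrite (_ : (fun x : rV => x ord0 k ^+ 2) = (fun x => x ord0 k * x ord0 k)); last first.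
    by apply/funext => y; rewrite expr2.
  rewrite partialME; [|exact: cls_coord..].
  by rewrite partial_coord; ring.
rewrite /sq H; apply/funext => x; rewrite (bigD1 i)//= eqxx mul1r big1 ?addr0//.
by move=> k ki; rewrite eq_sym (negbTE ki) mul0r.
Qed.

Lemma proj_mxE x i j : proj_mx x i j = (i == j)%:R - (sq x)^-1 * (x ord0 i * x ord0 j).
Proof.
by rewrite /proj_mx mxE [X in X + _]mxE [X in _ + X]mxE [X in - X]mxE rank1E.
Qed.

Variable a : R.
Hypothesis a0 : 0 < a.

(** |x|^2 made positive at the origin and left unchanged where |x|^2 >= a. There [irad] is 1/|x|,
    and [pcone] agrees with the cone inside the ball, but both are smooth everywhere. *)
Definition reg x := sq x + e0 (a - sq x).
Definition irad x := (Num.sqrt (reg x))^-1.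
Definition pcone x := 1 - Num.sqrt (reg x).

Lemma cls_reg : cls reg.
Proof.
apply: clsD; first exact: cls_sq.
by apply: cls_e0; apply: clsB; [exact: cls_cst|exact: cls_sq].
Qed.

Lemma reg_gt0 x : 0 < reg x.
Proof.
rewrite /reg; have [x0|x0] := leP (sq x) 0.
  rewrite ltr_wpDl ?sq_ge0// e0_gt0 subr_gt0; exact: le_lt_trans x0 a0.
by rewrite ltr_wpDr// e0_ge0.
Qed.

Lemma reg_neq0 x : reg x != 0. Proof. by rewrite gt_eqF// reg_gt0. Qed.

Lemma reg_eq x : a <= sq x -> reg x = sq x.
Proof. by move=> ax; rewrite /reg e0_eq0 ?addr0// subr_le0. Qed.

Lemma cls_regV : cls (fun x => (reg x)^-1).
Proof. by apply: clsV; [exact: cls_reg|exact: reg_neq0]. Qed.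

Lemma cls_sqrt_reg : cls (fun x => Num.sqrt (reg x)).
Proof. by apply: cls_sqrt; [exact: cls_reg|exact: reg_gt0]. Qed.

Lemma sqrt_reg_neq0 x : Num.sqrt (reg x) != 0.
Proof. by rewrite gt_eqF// sqrtr_gt0 reg_gt0. Qed.

Lemma cls_irad : cls irad.
Proof. by apply: clsV; [exact: cls_sqrt_reg|exact: sqrt_reg_neq0]. Qed.

Lemma irad_ge0 x : 0 <= irad x.
Proof. by rewrite /irad invr_ge0 sqrtr_ge0. Qed.

Lemma cls_pcone : cls pcone.
Proof. by apply: clsB; [exact: cls_cst|exact: cls_sqrt_reg]. Qed.

Let U : set rV := [set x | a < sq x].
Let oU : open U. Proof. by apply: open_cls_gt; exact: cls_sq. Qed.

Lemma partial_sqrt_reg i : {in U, partial i (fun x => Num.sqrt (reg x)) =1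
  fun x => irad x * x ord0 i}.
Proof.
move=> x Ux; rewrite (partial_sqrt i cls_reg reg_gt0).
rewrite (@partial_eq_on _ _ U reg (@sq R d) i oU _ x Ux).
  rewrite partial_sq /irad; have := sqrt_reg_neq0 x; set s := Num.sqrt _ => s0.
  by field.
by move=> y; rewrite inE => /ltW; exact: reg_eq.
Qed.

Lemma partial_pcone i : {in U, partial i pcone =1 fun x => - 1 * (irad x * x ord0 i)}.
Proof.
move=> x Ux.
rewrite /pcone (_ : (fun x => _) = (fun x => 1 + -1 * Num.sqrt (reg x))); last first.
  by apply/funext => y; rewrite mulN1r.
rewrite partialDE; [|exact: cls_cst|by apply: clsM; [exact: cls_cst|exact: cls_sqrt_reg]].
rewrite partialME; [|exact: cls_cst|exact: cls_sqrt_reg].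
by rewrite !partial_cst mulr0 addr0 add0r partial_sqrt_reg.
Qed.

Lemma hess_pcone i j x : a < sq x ->
  partial j (partial i pcone) x = - irad x * proj_mx x i j.
Proof.
move=> ax; have Ux : x \in U by rewrite inE.
rewrite (@partial_eq_on _ _ U (partial i pcone) _ j oU (partial_pcone i) x Ux).
rewrite partialME; [|exact: cls_cst|by apply: clsM; [exact: cls_irad|exact: cls_coord]].
rewrite partialME; [|exact: cls_irad|exact: cls_coord].
rewrite partial_cst partial_coord mulr0 addr0.
rewrite /irad partialVE; [|exact: cls_sqrt_reg|exact: sqrt_reg_neq0].
rewrite partial_sqrt_reg// proj_mxE.
have rE : (sq x)^-1 = (Num.sqrt (reg x))^-1 * (Num.sqrt (reg x))^-1.
  rewrite -invfM -expr2 sqr_sqrtr; last exact/ltW/reg_gt0.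
  by rewrite reg_eq// ltW.
rewrite rE /irad eq_sym; set b := (i == j)%:R.
ring.
Qed.

(** A polynomial that, for a < 1, is positive exactly on the shell a < |x|^2 < 1. A lower bound
    [kap <= shell x] expresses distance from both of its boundaries. *)
Definition shell x := (sq x - a) * (1 - sq x).

Lemma cls_shell : cls shell.
Proof. by apply: clsM; apply: clsB; (exact: cls_cst || exact: cls_sq). Qed.

Lemma shell_gt0 x : a < 1 -> 0 < shell x -> a < sq x < 1.
Proof.
rewrite /shell => a1; have [h|h|->] := ltgtP a (sq x); last by rewrite subrr mul0r ltxx.
  by rewrite pmulr_rgt0 ?subr_gt0.
rewrite nmulr_rgt0 ?subr_lt0// => h1; lra.
Qed.

(** On the support of G the cone coincides with the smooth [pcone]; two integrations by parts move
    the Hessian -|x|^-1 P onto it. *)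
Lemma pairing_inner G kap : a < 1 -> 0 < kap -> tfield G ->
  (forall x, G x != 0 -> kap <= shell x) ->
  let h x := - irad x * \tr (proj_mx x *m G x) in
  itg h /\ pairing fcone G = II h.
Proof.
move=> a1 k0 tG hG h0.
have G0 x : shell x < kap -> G x = 0.
  by move=> h; apply/eqP; apply: contraTT h => /hG; rewrite -leNgt.
have dG0 x : shell x < kap -> div2 G x = 0.
  move=> h; rewrite (@div2_eq_on _ _ [set x | shell x < kap] G (fun=> 0)) ?inE//.
  - rewrite div2E big1// => i _; rewrite big1// => j _.
    rewrite (_ : (fun y : rV => _) = (fun=> 0)) ?partial_cst ?partial_cst//.
    by apply/funext => y; rewrite mxE.
  - by apply: open_cls_lt; exact: cls_shell.
  - by move=> y; rewrite inE => /= /G0.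
have -> : pairing fcone G = pairing pcone G.
  rewrite !pairingE; congr II; apply/funext => x; have [/dG0 ->|h] := ltP (shell x) kap; first by rewrite !mulr0.
  have /andP[h1 h2] := shell_gt0 a1 (lt_le_trans k0 h).
  by rewrite fcone_inner ?(ltW h2)// /pcone reg_eq// ltW.
have [sG [M hM]] := tG; have sp := cls_smooth cls_pcone.
have bM i j := mbsup_entry i j hM.
have spp i : smooth (partial i pcone) by exact: smooth_partial.
have i1 i j : itg (fun x => pcone x * partial i (partial j (fun y => G y i j)) x).
  apply: (@itg_test _ _ _ _ M); first exact/locint_cont/cls_cont/cls_pcone.
    by apply: smooth_cont; apply: smooth_partial; exact: smooth_partial.
  by do 2 apply: partial_bsup.
have i2 i j : itg (fun x => partial j (partial i pcone) x * G x i j).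
  apply: (@itg_test _ _ _ _ M) => //; last exact: smooth_cont.
  by apply/locint_cont/smooth_cont/smooth_partial.
have h0E : (fun x => \sum_i \sum_j partial j (partial i pcone) x * G x i j) = h0.
  apply/funext => x; rewrite /h0; have [h|h] := ltP (shell x) kap.
    rewrite G0// mulmx0 linear0 mulr0 big1// => i _; rewrite big1// => j _.
    by rewrite mxE mulr0.
  have /andP[h1 h2] := shell_gt0 a1 (lt_le_trans k0 h).
  rewrite -mxtrace_tr trmx_mul proj_mx_tr mxtrace_mulC /mxtrace mulr_sumr.
  apply: eq_bigr => i _; rewrite !mxE mulr_sumr; apply: eq_bigr => j _.
  by rewrite hess_pcone// [_^T _ _]mxE mulrA.
rewrite -h0E; split; first by apply: itg_sum => i; exact: itg_sum.
rewrite pairingE; transitivity (II (fun x => \sum_i \sum_j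
    pcone x * partial i (partial j (fun y => G y i j)) x)).
  congr II; apply/funext => x; rewrite div2E mulr_sumr.
  by apply: eq_bigr => i _; rewrite mulr_sumr.
rewrite !II_sum; [|by move=> i; exact: itg_sum..].
apply: eq_bigr => i _; rewrite !II_sum//; apply: eq_bigr => j _.
rewrite (@ibp _ _ _ _ _ M)//; last 2 first.
- exact: smooth_partial.
- exact: partial_bsup.
by rewrite (@ibp _ _ _ _ _ M)// opprK.
Qed.

End radial.

(** * Test fields compared with almost maximizing fields *)

Section variational.
Context {R : realType} {n : nat}.
Local Notation d := n.+1.
Local Notation rV := 'rV[R]_d.
Variables (q : \bar R) (c V lam : R) (f1 : rV -> R).
Implicit Types (f g phi : rV -> R) (E F G : rV -> 'M[R]_d).

Definition admissible E := tfield E /\ forall x, schatten_norm q (E x) <= 1.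

Hypothesis n0 : (0 < n)%N.
Hypothesis q1 : (1 <= q)%E.
Hypothesis c0 : 0 < c.
Hypothesis hoelder : forall x (M : 'M[R]_d), sq x != 0 -> schatten_norm q M <= 1 ->
  `|\tr (proj_mx x *m M)| <= c * n%:R.
Hypothesis perturb : forall e : R, 0 < e -> exists2 t0 : R, 0 < t0 & forall (x : rV) tau, sq x != 0 ->
  `|tau| <= t0 -> schatten_norm q (extremal_mx c tau x) <= 1 + e * `|tau|.
Hypothesis lf1 : locint f1.
Hypothesis lam0 : 0 < lam.
Hypothesis maximizing : forall e : R, 0 < e ->
  exists2 E, admissible E & V - e <= pairing fcone E.
(** This is all that is kept of the convex combination: f2 enters only through T_f2(E) <= V, and the
    factor lam is the loss that results. *)
Hypothesis transfer : forall E e, admissible E ->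
  V - lam * e <= pairing fcone E -> V - e <= pairing f1 E.
Hypothesis upper : forall E, admissible E -> pairing f1 E <= V.

Local Notation T := (pairing f1).

Lemma V_ge0 : 0 <= V.
Proof.
have := @upper (fun=> 0) _; rewrite pairing0; apply; split; first exact: tfield0.
move=> x; rewrite -(scale0r (0 : 'M[R]_d)) schatten_normZ// normr0 mul0r.
exact: ler01.
Qed.

Lemma schatten0 : schatten_norm q (0 : 'M[R]_d) = 0.
Proof. by rewrite -(scale0r (0 : 'M[R]_d)) schatten_normZ// normr0 mul0r. Qed.

Lemma pairing_le K G : 0 < K -> tfield G -> (forall x, schatten_norm q (G x) <= K) ->
  T G <= K * V.
Proof.
move=> K0 tG GK.
have aG : admissible (fun x => K^-1 *: G x).
  split=> [|x]; first exact: tfieldZ.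
  by rewrite schatten_normZ// gtr0_norm ?invr_gt0// ler_pdivrMl// mulr1.
by have := upper aG; rewrite pairingZ// ler_pdivrMl// mulrC.
Qed.

Lemma pairing_entry_bound : exists2 C, 0 < C & forall B G, 0 < B -> tfield G ->
  (forall x i j, `|G x i j| <= B) -> `|T G| <= C * B * V.
Proof.
have [C C0 hC] := @schatten_norm_bound R d q (ltn0Sn n) q1.
exists C => // B G B0 tG GB.
have K0 : 0 < C * B by rewrite mulr_gt0.
rewrite ler_norml; apply/andP; split; last by apply: pairing_le => // x; exact: hC.
rewrite lerNl -mulN1r -pairingZ//; apply: pairing_le => //; first exact: tfieldZ.
by move=> x; apply: hC => i j; rewrite mxE mulN1r normrN.
Qed.

Lemma pairing_eq0 G : tfield G -> T G <= 0 -> T (fun x => - 1 *: G x) <= 0 -> T G = 0.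
Proof.
move=> tG h1; rewrite pairingZ// mulN1r oppr_le0 => h2.
by apply/eqP; rewrite eq_le h1 h2.
Qed.

Lemma schatten_cutoff (t : R) (M : 'M[R]_d) : 0 <= t <= 1 ->
  schatten_norm q M <= 1 -> schatten_norm q (t *: M) <= 1.
Proof.
move=> /andP[t0 t1] M1; rewrite schatten_normZ// ger0_norm//.
have s0 : 0 <= schatten_norm q M.
  rewrite /schatten_norm; case: (q) => [r| |]//=; first exact: powR_ge0.
  by rewrite bigmax_idl le_max lexx.
exact: mulr_ile1.
Qed.

Definition supp_outer G := exists2 dl, 0 < dl & forall x, G x != 0 -> 1 + dl <= sq x.

(** A cutoff of an almost maximizing field outside a neighbourhood of the closed ball does not
    change its pairing with the cone and makes room for a multiple of G of norm at most 1. The sum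
    is admissible, which bounds T G above; -G gives the other sign. *)
Lemma pairing_outer G : tfield G -> supp_outer G -> T G = 0.
Proof.
suff H G' : tfield G' -> supp_outer G' -> T G' <= 0.
  move=> tG [dl dl0 hG]; apply: pairing_eq0 => //; first by apply: H => //; exists dl.
  apply: H; first exact: tfieldZ.
  by exists dl => // x; rewrite scaler_eq0 negb_or => /andP[_]; exact: hG.
move=> {G} tG [dl dl0 hG]; rename G' into G.
have [K K0 hK] : exists2 K, 0 < K & forall x, schatten_norm q (G x) <= K.
  have [C C0 hC] := @schatten_norm_bound R d q (ltn0Sn n) q1.
  have [B B0 hB] := tfield_bounded tG.
  by exists (C * B) => [|x]; [rewrite mulr_gt0|exact: hC].
suff : T (fun x => K^-1 *: G x) <= 0 by rewrite pairingZ// pmulr_rle0// invr_gt0.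
apply/ler_addgt0Pr => e e0; rewrite add0r.
have [E [tE E1] EV] := maximizing (mulr_gt0 lam0 e0).
(* The cutoff decreases from 1 to 0 between |x|^2 = 1 + dl / 3 and 1 + 2 dl / 3: it is 1 on a
   neighbourhood of the closed ball and 0 on the support of G. *)
pose z (x : rV) := 1 - step ((sq x - 1 - dl / 3) * (3 / dl)).
have cz : cls z.
  apply: clsB; first exact: cls_cst.
  apply: cls_step; apply: clsM; last exact: cls_cst.
  by do 2 (apply: clsB; last exact: cls_cst); exact: cls_sq.
have z01 x : 0 <= z x <= 1.
  by have /andP[? ?] := step_itv ((sq x - 1 - dl / 3) * (3 / dl)); rewrite /z; apply/andP; split; lra.
have d3 : 0 < 3 / dl by rewrite divr_gt0.
have z1 x : sq x < 1 + dl / 3 -> z x = 1.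
  move=> h; rewrite /z step_eq0 ?subr0// pmulr_lle0//; lra.
have z0 x : 1 + dl <= sq x -> z x = 0.
  move=> h; rewrite /z step_eq1 ?subrr// -(ler_pM2r (_ : 0 < dl / 3)) ?divr_gt0//.
  have -> : (sq x - 1 - dl / 3) * (3 / dl) * (dl / 3) = sq x - 1 - dl / 3.
    by field; rewrite gt_eqF.
  lra.
have tzE : tfield (fun x => z x *: E x) by apply: tfieldM => //; exact: cls_smooth.
have azE : admissible (fun x => z x *: E x).
  by split=> // x; exact: schatten_cutoff.
have tGK := tfieldZ K^-1 tG.
have aF : admissible (fun x => z x *: E x + K^-1 *: G x).
  split=> [|x]; first exact: tfieldD.
  have [G0|/hG /z0 ->] := eqVneq (G x) 0.
    by rewrite G0 scaler0 addr0; exact: schatten_cutoff.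
  rewrite scale0r add0r schatten_normZ// gtr0_norm ?invr_gt0//.
  by rewrite ler_pdivrMl// mulr1.
have eT : pairing fcone (fun x => z x *: E x) = pairing fcone E.
  apply: eq_pairing => x.
  have [x1|x1] := ltP (sq x) (1 + dl / 3).
    rewrite (@div2_eq_on _ _ [set x | sq x < 1 + dl / 3] _ E)//.
    - by apply: open_cls_lt; exact: cls_sq.
    - by move=> y; rewrite inE => /= h; rewrite z1// scale1r.
    - by rewrite inE.
  rewrite (@fcone_outer _ _ x); first by rewrite !mul0r.
  by rewrite (le_trans _ x1)// lerDl divr_ge0// ltW.
have h1 := upper aF; rewrite (pairingD lf1 tzE tGK) in h1.
have h2 : V - e <= T (fun x => z x *: E x) by apply: (transfer azE); rewrite eT; exact: EV.
by move: h1 h2; lra.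
Qed.

Section inner_part.
Variable a : R.
Hypotheses (a0 : 0 < a) (a1 : a < 1).
Local Notation shell := (shell a).
Local Notation irad := (irad a).
Local Notation reg := (reg a).

Lemma shell_outer (x : rV) : 1 < `|x| -> shell x <= 0.
Proof.
move=> x1; have s1 : 1 < sq x.
  by rewrite (lt_le_trans _ (norm_le_sq x))// exprn_egt1.
by rewrite /shell mulr_ge0_le0// ?subr_ge0 ?subr_le0 ?(ltW s1)// (le_trans (ltW a1) (ltW s1)).
Qed.

Lemma shell_sq (kap : R) (x : rV) : 0 < kap -> kap <= shell x -> a < sq x /\ sq x < 1.
Proof. by move=> k0 h; apply/andP; apply: shell_gt0 => //; exact: lt_le_trans k0 h. Qed.

Definition extremal_field (x : rV) : 'M[R]_d := - c *: (1%:M - (reg x)^-1 *: rank1 x).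

Lemma extremal_fieldE x : a <= sq x -> extremal_field x = extremal_mx c 0 x.
Proof.
by move=> ax; rewrite /extremal_field reg_eq// /extremal_mx mul0r scale0r addr0.
Qed.

Lemma cls_rank1 i j : cls (fun x : rV => rank1 x i j).
Proof. by under eq_fun do rewrite rank1E; apply: clsM; exact: cls_coord. Qed.

Lemma extremal_field_entry x i j : extremal_field x i j =
  - c * ((i == j)%:R - (reg x)^-1 * rank1 x i j).
Proof.
rewrite /extremal_field mxE [X in - c * X]mxE [X in X + _]mxE [X in _ + X]mxE.
by rewrite [X in _ - X]mxE.
Qed.

Lemma mcls_extremal_field : mcls extremal_field.
Proof.
move=> i j; rewrite (_ : (fun x => _) =
    (fun x => - c * ((i == j)%:R - (reg x)^-1 * rank1 x i j))); last first.
  by apply/funext => x; exact: extremal_field_entry.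
apply: clsM; first exact: cls_cst.
apply: clsB; first exact: cls_cst.
by apply: clsM; [exact: cls_regV|exact: cls_rank1].
Qed.

Lemma schatten_extremal_field x : a <= sq x -> schatten_norm q (extremal_field x) <= 1.
Proof.
move=> ax; have [t0 t00 h] := perturb ltr01.
have := h x 0; rewrite normr0 mulr0 addr0 extremal_fieldE//; apply; last exact: ltW.
by rewrite gt_eqF// (lt_le_trans a0 ax).
Qed.

Definition bump (k : R) (x : rV) : R := step (k * shell x - 1).

Lemma cls_bump k : cls (bump k).
Proof.
apply: cls_step; apply: clsB; last exact: cls_cst.
by apply: clsM; [exact: cls_cst|exact: cls_shell].
Qed.

Lemma bump_neq0 k x : 0 < k -> bump k x != 0 -> k^-1 <= shell x.
Proof.
move=> k0; apply: contraNT; rewrite -ltNge => h; rewrite /bump step_eq0//.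
by rewrite subr_le0 mulrC -ler_pdivlMr// mul1r ltW.
Qed.

Lemma bump_eq1 k x : 2 <= k * shell x -> bump k x = 1.
Proof. by move=> h; rewrite /bump step_eq1// lerBrDr. Qed.

Lemma bump_le0 k x : 0 < k -> shell x <= 0 -> bump k x = 0.
Proof.
move=> k0 h; apply/eqP; apply/negPn/negP => /(bump_neq0 k0).
by rewrite leNgt (le_lt_trans h)// invr_gt0.
Qed.

(* [pairing_inner] turns the trace bound [hoelder] into an upper bound for the
   pairing of the cone, attained by the extremal field; the loss comes only from
   the gap between the two cutoffs, which vanishes in the limit. *)
Lemma replacement kap e : 0 < kap -> 0 < e -> exists2 E, admissible E &
  V - e <= pairing fcone E /\ forall x, kap <= shell x -> E x = extremal_field x.
Proof.
move=> k0 e0; have e20 : 0 < e / 2 by rewrite divr_gt0.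
have [E [tE E1] EV] := maximizing e20.
(* The wide cutoff [bump (2 * m.+1)] removes E and the narrow one [bump m.+1] inserts the extremal
   field. The wide one is 1 wherever the narrow one is nonzero, so the two fields never overlap. *)
pose loss (m : nat) x := irad x * (bump (2 * m.+1%:R) x - bump m.+1%:R x).
have m0 (m : nat) : 0 < m.+1%:R :> R by [].
have m20 (m : nat) : 0 < 2 * m.+1%:R :> R by rewrite mulr_gt0.
have mi0 (m : nat) : 0 < m.+1%:R^-1 :> R by rewrite invr_gt0.
pose G x : R := irad x * \1_[set x : rV | `|x| <= 1] x.
have iG : itg G.
  apply: (@itg_locint _ _ irad (\1_[set x : rV | `|x| <= 1]) 1 1).
  - exact/locint_cont/cls_cont/cls_irad.
  - by apply: measurable_indic; exact: measurable_cball.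
  - move=> x; have /andP[i0 i1] := indic_itv [set x : rV | `|x| <= 1] x.
    by rewrite ger0_norm.
  - by move=> x x1; rewrite indicE memNset//= => h; rewrite ltNge h in x1.
have cl m : cls (loss m).
  by apply: clsM; [exact: cls_irad|apply: clsB; exact: cls_bump].
have lossG m x : `|loss m x| <= G x.
  rewrite /loss /G normrM (ger0_norm (irad_ge0 _ _)).
  rewrite ler_wpM2l ?irad_ge0//.
  have [x1|x1] := leP `|x| 1; last first.
    rewrite !bump_le0 ?shell_outer// subrr normr0.
    by have /andP[] := indic_itv [set x : rV | `|x| <= 1] x.
  rewrite indicE mem_set//= ler_norml.
  have /andP[? ?] := step_itv (2 * m.+1%:R * shell x - 1).
  have /andP[? ?] := step_itv (m.+1%:R * shell x - 1).
  by rewrite /bump; apply/andP; split; lra.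
have loss0 x : loss m x @[m --> \oo] --> (0 : R).
  apply: cvg_near_cst; have [h|h] := leP (shell x) 0.
    by apply: nearW => m; rewrite /loss !bump_le0// subrr mulr0.
  near=> m; rewrite /loss !bump_eq1 ?subrr ?mulr0//.
    rewrite -ler_pdivrMr//; near: m; exact: nbhs_infty_gerS.
  rewrite -ler_pdivrMr//.
  have h1 : 2 / shell x <= m.+1%:R by near: m; exact: nbhs_infty_gerS.
  by rewrite (le_trans h1)// ler_peMl// ler1n.
have [_] := II_dct (fun m => cls_meas (cl m)) (cls_meas (cls_cst 0)) iG lossG loss0.
rewrite II0 => /cvgrPdist_le/(_ (e / 2 / (c * n%:R))).
have cn0 : 0 < c * n%:R by rewrite mulr_gt0// ltr0n.
move=> /(_ (divr_gt0 e20 cn0)) lossN.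
have [m [mk ml]] : exists m : nat, 2 / kap <= m.+1%:R /\ `|0 - II (loss m)| <= e / 2 / (c * n%:R).
  near \oo => m; exists m; split; last by near: m.
  by near: m; exact: nbhs_infty_gerS.
rewrite sub0r normrN in ml.
pose k := 2 * m.+1%:R : R; pose b x := bump k x; pose b' x := bump m.+1%:R x.
have tbE : tfield (fun x => b x *: E x).
  by apply: tfieldM => //; exact/cls_smooth/cls_bump.
have tbF : tfield (fun x => b' x *: extremal_field x).
  split=> [i j|].
    apply: eq_smooth (smoothM (cls_smooth (cls_bump m.+1%:R)) (cls_smooth (mcls_extremal_field i j))).
    by move=> x; rewrite [RHS]mxE.
  by exists 1 => x /shell_outer h; rewrite /b' bump_le0// scale0r.
have tbEE : tfield (fun x => E x - b x *: E x).
  by apply: eq_tfield (tfieldD tE (tfieldZ (-1) tbE)) => x; rewrite scaleN1r.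
exists (fun x => (E x - b x *: E x) + b' x *: extremal_field x).
  split=> [|x]; first exact: tfieldD.
  have [b0|b0] := eqVneq (b' x) 0.
    rewrite b0 scale0r addr0 -[X in X - _]scale1r -scalerBl.
    apply: schatten_cutoff (E1 x).
    by have /andP[? ?] := step_itv (k * shell x - 1); apply/andP; split; rewrite /b /bump; lra.
  have hk := bump_neq0 (m0 m) b0.
  have [ax _] := shell_sq (mi0 m) hk.
  have -> : b x = 1.
    apply: bump_eq1; rewrite -mulrA ler_peMr// -(ler_pM2l (mi0 m)) mulr1 mulKf ?gt_eqF//.
  rewrite scale1r subrr add0r; apply: schatten_cutoff; last exact/schatten_extremal_field/ltW.
  exact: step_itv.
have hbE x : b x *: E x != 0 -> k^-1 <= shell x.
  by rewrite scaler_eq0 negb_or => /andP[bx _]; exact: (bump_neq0 (m20 m) bx).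
have hbF x : b' x *: extremal_field x != 0 -> k^-1 <= shell x.
  rewrite scaler_eq0 negb_or => /andP[/(bump_neq0 (m0 m)) bx _]; rewrite (le_trans _ bx)//.
  by rewrite lef_pV2 ?posrE ?m20// /k ler_peMl ?ler1n.
have k'0 : 0 < k^-1 by rewrite invr_gt0; exact: m20.
have [iE eE] := pairing_inner a0 a1 k'0 tbE hbE.
have [iF eF] := pairing_inner a0 a1 k'0 tbF hbF.
have lc : locint (@fcone R d) by exact: locint_fcone.
have eq : pairing fcone (fun x => (E x - b x *: E x) + b' x *: extremal_field x) =
    pairing fcone E - pairing fcone (fun x => b x *: E x)
      + pairing fcone (fun x => b' x *: extremal_field x).
  by rewrite (pairingD lc tbEE tbF) (pairingB lc tE tbE).
split; last first.
  move=> x kx; have s0 := lt_le_trans k0 kx.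
  have h : 2 <= m.+1%:R * shell x.
    rewrite -ler_pdivrMr// (le_trans _ mk)// ler_wpM2l// lef_pV2 ?posrE//.
  rewrite /b /b' !bump_eq1 ?scale1r ?subrr ?add0r// /k -mulrA.
  by rewrite (le_trans h)// ler_peMl ?ler1n// (le_trans _ h).
rewrite eq eE eF; set hE := fun x => _; set hF := fun x => _ in iF *.
have il : itg (loss m) by apply: itg_le (cls_meas (cl m)) (lossG m) iG.
(* Pointwise, the inserted field contributes exactly irad c n b', and the removed part of E had
   contributed at most irad c n b by [hoelder]. *)
have : - (c * n%:R) * II (loss m) <= II hF - II hE.
  rewrite -IIB// -IIZ//; apply: II_le; [exact: itgZ|exact: itgB|move=> x].
  rewrite /loss /hE /hF -/(b x) -/(b' x).
  have [Fx FxE] : exists M, M = extremal_field x by exists (extremal_field x).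
  rewrite -FxE.
  rewrite -!scalemxAr !mxtraceZ.
  have [h|h] := leP (shell x) 0.
    rewrite /b /b' !bump_le0//; last exact: m20.
    by rewrite subr0 !mul0r !mulr0 subr0.
  have /andP[ax _] := shell_gt0 a1 h; have x0 : sq x != 0 by rewrite gt_eqF// (lt_trans a0).
  have -> : \tr (proj_mx x *m Fx) = - c * n%:R.
    rewrite FxE extremal_fieldE ?ltW// /extremal_mx mul0r scale0r addr0 -scalemxAr.
    by rewrite proj_mx_idem// mxtraceZ tr_proj_mx.
  have := hoelder x0 (E1 x); rewrite ler_norml => /andP[h1 _].
  have b0 : 0 <= b x by have /andP[] := step_itv (k * shell x - 1).
  have h2 : 0 <= irad x * b x * (\tr (proj_mx x *m E x) + c * n%:R).
    apply: mulr_ge0; last by move: h1; lra.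
    by apply: mulr_ge0 => //; exact: irad_ge0.
  rewrite -subr_ge0; apply: le_trans h2 _; rewrite -subr_ge0 le_eqVlt; apply/orP; left.
  by rewrite eq_sym; apply/eqP; rewrite -/(b x) -/(b' x); ring.
have : c * n%:R * II (loss m) <= e / 2.
  rewrite mulrC -ler_pdivlMr//; exact: le_trans (ler_norm _) ml.
by move: EV; lra.
Unshelve. all: by end_near. Qed.

(** The field given by [replacement] is the extremal field on the support of H, so E + H has norm at
    most K everywhere; T(E + H) <= K V and T(E) >= V - e are then compared. *)
Lemma inner_test kap K H : 0 < kap -> 1 <= K -> tfield H ->
  (forall x, H x != 0 -> kap <= shell x) ->
  (forall x, kap <= shell x -> schatten_norm q (extremal_field x + H x) <= K) ->
  T H <= (K - 1) * V.
Proof.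
move=> k0 K1 tH hH HK; apply/ler_addgt0Pr => e e0.
have [E [tE E1] [EV EF]] := replacement k0 (mulr_gt0 lam0 e0).
have K0 : 0 < K := lt_le_trans ltr01 K1.
have h1 := transfer (conj tE E1) EV.
have : T (fun x => E x + H x) <= K * V.
  apply: pairing_le => // [|x]; first exact: tfieldD.
  have [H0|/hH h] := eqVneq (H x) 0; first by rewrite H0 addr0 (le_trans (E1 x)).
  by rewrite EF//; exact: HK.
by rewrite (pairingD lf1 tE tH) mulrBl mul1r; move: h1; lra.
Qed.

Definition shell_test kap (psi : rV -> R) :=
  [/\ 0 < kap, cls psi & forall x, psi x != 0 -> kap <= shell x].

Lemma shell_test_bsup kap psi : shell_test kap psi -> bsup 1 psi.
Proof.
move=> [k0 _ h] x /shell_outer x1; apply/eqP/negPn/negP => /h.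
by rewrite leNgt (le_lt_trans x1).
Qed.

Lemma shell_testM kap psi g : shell_test kap psi -> cls g ->
  shell_test kap (fun x => psi x * g x).
Proof.
move=> [k0 cp h] cg; split=> // [|x]; first exact: clsM.
by rewrite mulf_eq0 negb_or => /andP[/h].
Qed.

Lemma shell_test_tfield kap psi E : shell_test kap psi -> mcls E ->
  tfield (fun x => psi x *: E x).
Proof.
move=> hp cE; have [k0 cp h] := hp; split=> [i j|].
  apply: eq_smooth (smoothM (cls_smooth cp) (cls_smooth (cE i j))) => x.
  by rewrite [RHS]mxE.
by exists 1 => x /(shell_test_bsup hp) ->; rewrite scale0r.
Qed.

Lemma mcls_rank1 : mcls (@rank1 R n). Proof. by move=> i j; exact: cls_rank1. Qed.

Lemma mcls_mulmx (A : 'M[R]_d) E : mcls E -> mcls (fun x => A *m E x).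
Proof.
move=> cE i j; under eq_fun do rewrite mxE.
by apply: cls_sum => k; apply: clsM; [exact: cls_cst|exact: cE].
Qed.

Lemma shell_test_neq0 kap psi E x : shell_test kap psi -> psi x *: E x != 0 ->
  kap <= shell x.
Proof. by move=> [_ _ h]; rewrite scaler_eq0 negb_or => /andP[/h]. Qed.

(** Divided by [reg], the multiple t phi of x x^T turns the extremal field into
    [extremal_mx c (t * phi x) x]. After division by t, [inner_test] bounds the pairing by an
    arbitrarily small multiple of V. *)
Lemma pairing_rank1 kap psi : shell_test kap psi ->
  T (fun x => psi x *: rank1 x) = 0.
Proof.
move=> hp; have tG := shell_test_tfield hp mcls_rank1.
have regK x : psi x = psi x * reg x * (reg x)^-1 by rewrite mulfK// reg_neq0.
suff H phi : shell_test kap phi -> T (fun x => (phi x * (reg x)^-1) *: rank1 x) <= 0.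
  apply: pairing_eq0 => //.
    rewrite (_ : (fun x => _) = (fun x => (psi x * reg x * (reg x)^-1) *: rank1 x)).
      by apply: H; apply: shell_testM hp _; exact: cls_reg.
    by apply/funext => x; rewrite -regK.
  rewrite (_ : (fun x => _) = (fun x => (psi x * (-1 * reg x) * (reg x)^-1) *: rank1 x)).
    apply: H; apply: shell_testM hp _; apply: clsM; [exact: cls_cst|exact: cls_reg].
  by apply/funext => x; rewrite scalerA mulrCA -mulrA {1}(regK x).
move=> {}hp; have tp := shell_test_tfield (shell_testM hp (cls_regV a0)) mcls_rank1.
have [k0 cp hs] := hp.
have [B B0 hB] := bsup_bounded (cls_cont cp) (shell_test_bsup hp).
apply/ler_addgt0Pr => e e0; rewrite add0r.
have BV0 : 0 < (B + 1) * (V + 1) by rewrite mulr_gt0// ltr_wpDl// V_ge0.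
have [t0 t00 ht] := perturb (divr_gt0 e0 BV0).
have B1 : 0 < B + 1 by rewrite ltr_wpDl.
have t1 : 0 < t0 / (B + 1) by rewrite divr_gt0.
set e' := e / _ in ht; have e'0 : 0 < e' by rewrite divr_gt0.
set t := t0 / (B + 1) in t1.
have := @inner_test kap (1 + e' * (t * (B + 1)))
  (fun x => t *: ((phi x * (reg x)^-1) *: rank1 x)) k0.
have te : 0 < e' * (t * (B + 1)) := mulr_gt0 e'0 (mulr_gt0 t1 B1).
have K1 : 1 <= 1 + e' * (t * (B + 1)) by rewrite lerDl ltW.
move=> /(_ K1 (tfieldZ t tp)).
have s1 x : t *: ((phi x * (reg x)^-1) *: rank1 x) != 0 -> kap <= shell x.
  by rewrite scaler_eq0 negb_or => /andP[_]; exact: (shell_test_neq0 (shell_testM hp (cls_regV a0))).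
move=> /(_ s1).
have s2 x : kap <= shell x -> schatten_norm q
    (extremal_field x + t *: ((phi x * (reg x)^-1) *: rank1 x)) <= 1 + e' * (t * (B + 1)).
  move=> kx; have [ax _] := shell_sq k0 kx.
  have x0 : sq x != 0 by rewrite gt_eqF// (lt_trans a0).
  have -> : extremal_field x + t *: ((phi x * (reg x)^-1) *: rank1 x) =
      extremal_mx c (t * phi x) x.
    by rewrite /extremal_mx /extremal_field reg_eq ?ltW// scalerA mulrA.
  have tph : `|t * phi x| <= t * (B + 1).
    by rewrite normrM gtr0_norm// ler_pM2l// (le_trans (hB x))// lerDl.
  rewrite (le_trans (ht x (t * phi x) x0 _))//; last by rewrite lerD2l ler_pM2l.
  by rewrite (le_trans tph)// /t divfK// gt_eqF.
move=> /(_ s2); rewrite (pairingZ _ lf1 tp) => h.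
suff h' : T (fun x => (phi x * (reg x)^-1) *: rank1 x) <= e' * ((B + 1) * V).
  apply: (le_trans h'); rewrite /e'.
  have V1 : 0 < V + 1 by rewrite ltr_wpDl// V_ge0.
  have -> : (e / ((B + 1) * (V + 1))) * ((B + 1) * V) = e * (V / (V + 1)).
    by field; rewrite !gt_eqF.
  by rewrite ler_piMr ?(ltW e0)// ler_pdivrMr// mul1r lerDl.
rewrite -(ler_pM2l t1); apply: (le_trans h); rewrite le_eqVlt; apply/orP; left.
by apply/eqP; ring.
Qed.

(** The double divergence is the contraction of A with the Hessian of phi, which is symmetric. *)
Lemma pairing_skew (A : 'M[R]_d) (phi : rV -> R) M : cls phi -> bsup M phi ->
  A^T = - A -> T (fun x => phi x *: A) = 0.
Proof.
move=> cp hM AT; have Aji i j : A j i = - A i j.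
  by have /matrixP/(_ i j) := AT; rewrite mxE [RHS]mxE.
rewrite -(pairing0 f1); apply: eq_pairing => x; congr (_ * _).
have -> : div2 (fun=> 0 : 'M[R]_d) x = 0.
  rewrite div2E big1// => i _; rewrite big1// => j _.
  rewrite (_ : (fun y : rV => _) = (fun=> 0)) ?partial_cst ?partial_cst//.
  by apply/funext => y; rewrite mxE.
rewrite div2E; have sp := cls_smooth cp.
have E i j : partial i (partial j (fun y => (phi y *: A) i j)) x =
    A i j * partial i (partial j phi) x.
  rewrite (_ : (fun y : rV => _) = (fun y => A i j * phi y)); last first.
    by apply/funext => y; rewrite mxE mulrC.
  by rewrite !smooth_partialZE//; exact: smooth_partial.
set S := (X in X = _); suff : S = - S by move=> h; apply/eqP; move: h; lra.
rewrite /S {1}exchange_big/= -sumrN; apply: eq_bigr => i _.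
rewrite -sumrN; apply: eq_bigr => j _.
by rewrite !E Aji partialC// mulNr.
Qed.

(** P projects onto a plane and A is the quarter turn in it. The coefficients are sin and 1 - cos of
    the angle 2 arctan s; this rational form keeps the entries in [cls] when s is a function in
    it. *)
Lemma rotation_orthogonal (A P : 'M[R]_d) (s : R)
    (Q := 1%:M + (2 * s / (1 + s ^+ 2)) *: A - (2 * s ^+ 2 / (1 + s ^+ 2)) *: P) :
  A^T = - A -> P^T = P -> A *m A = - P -> A *m P = A -> P *m A = A -> P *m P = P ->
  Q^T *m Q = 1%:M.
Proof.
move=> AT PT AA AP PA PP.
have Aji i j : A j i = - A i j.
  by have /matrixP/(_ i j) := AT; rewrite mxE [RHS]mxE.
have Pji i j : P j i = P i j by have /matrixP/(_ i j) := PT; rewrite mxE.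
have -> : Q^T = 1%:M - (2 * s / (1 + s ^+ 2)) *: A - (2 * s ^+ 2 / (1 + s ^+ 2)) *: P.
  apply/matrixP => i j; rewrite /Q; move: (2 * s / _) (2 * s ^+ 2 / _) => x y.
  by rewrite !mxE Aji Pji eq_sym; ring.
rewrite /Q; clear Q.
rewrite !(mulmxBl, mulmxBr, mulmxDl, mulmxDr, mulNmx, mulmxN, mulmx1, mul1mx).
rewrite -!scalemxAl -!scalemxAr AA AP PA PP.
have s1 : 1 + s ^+ 2 != 0 by rewrite gt_eqF// ltr_pwDl// sqr_ge0.
apply/matrixP => i j; rewrite !mxE; set b := (i == j)%:R.
move: s1; move: (A i j) (P i j) => x y s1; field.
by rewrite s1.
Qed.

(* Cayley rotations of the extremal field are admissible and agree with it up to
   [2 * t * phi *: (A *m extremal_field)] and a remainder of order [t ^+ 2]. *)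
Lemma pairing_rotation (A P : 'M[R]_d) kap psi : A^T = - A -> P^T = P ->
  A *m A = - P -> A *m P = A -> P *m A = A -> P *m P = P -> shell_test kap psi ->
  T (fun x => psi x *: (A *m extremal_field x)) = 0.
Proof.
move=> AT PT AA AP PA PP.
suff H phi : shell_test kap phi -> T (fun x => phi x *: (A *m extremal_field x)) <= 0.
  move=> hp; apply: pairing_eq0; last 2 first.
  - exact: H.
  - have := H _ (shell_testM hp (cls_cst (-1))); congr (T _ <= _).
    by apply/funext => x; rewrite scalerA mulrC.
  by apply: (shell_test_tfield hp); exact/mcls_mulmx/mcls_extremal_field.
move=> hp; have [k0 cp hs] := hp.
have mA M := mcls_mulmx M mcls_extremal_field.
have t1 := shell_test_tfield hp (mA A); have t2 := shell_test_tfield hp (mA P).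
have [B1 B10 hB1] := tfield_bounded t1; have [B2 B20 hB2] := tfield_bounded t2.
have [B B0 hB] := bsup_bounded (cls_cont cp) (shell_test_bsup hp).
have [C C0 hC] := pairing_entry_bound.
set E1 := fun x => _ in t1 hB1 *; set E2 := fun x => _ in t2 hB2.
(* Bound on the entries of the remainder [G] below, uniform for 0 < t <= 1; the summand 1 makes it
   positive. *)
pose K := 2 * B ^+ 2 * B1 + 2 * B * B2 + 1.
have K0 : 0 < K.
  by rewrite /K ltr_wpDl// addr_ge0// !mulr_ge0// ?sqr_ge0// ltW.
have key t : 0 < t <= 1 -> T E1 <= t * (C * K * V / 2).
  move=> /andP[t0 tl1].
  pose D x := 1 + (t * phi x) ^+ 2.
  have D1 x : 1 <= D x by rewrite /D lerDl sqr_ge0.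
  have D0 x : D x != 0 by rewrite gt_eqF// (lt_le_trans ltr01).
  have cD : cls (fun x => (D x)^-1).
    apply: clsV => //; apply: clsD; first exact: cls_cst.
    under eq_fun do rewrite expr2.
    by apply: clsM; apply: clsM => //; exact: cls_cst.
  pose H x := (2 * t * (D x)^-1) *: E1 x + (- 2 * t ^+ 2 * phi x * (D x)^-1) *: E2 x.
  pose G x := (2 * t * phi x * phi x * (D x)^-1) *: E1 x + (2 * phi x * (D x)^-1) *: E2 x.
  have tH : tfield H.
    apply: tfieldD; apply: tfieldM => //; apply: cls_smooth.
      by apply: clsM => //; exact: cls_cst.
    by apply: clsM => //; apply: clsM => //; exact: cls_cst.
  have tG : tfield G.
    apply: tfieldD; apply: tfieldM => //; apply: cls_smooth; apply: clsM => //.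
      by do 2 apply: clsM => //; exact: cls_cst.
    by apply: clsM => //; exact: cls_cst.
  have TG : T G <= C * K * V.
    apply: le_trans (ler_norm _) (hC _ _ K0 tG _) => x i j.
    have Di : 0 <= (D x)^-1 <= 1.
      rewrite invr_ge0 (le_trans ler01 (D1 x))/= invf_le1//.
      exact: lt_le_trans ltr01 (D1 x).
    have /andP[Di0 Di1] := Di.
    have nD : `|(D x)^-1| <= 1 by rewrite ger0_norm.
    rewrite /G [X in `|X|]mxE [X in X + _]mxE [X in _ + X]mxE.
    rewrite (le_trans (ler_normD _ _))// /K.
    have p1 : `|2 * t * phi x * phi x * (D x)^-1 * E1 x i j| <= 2 * B ^+ 2 * B1.
      rewrite !normrM normr_nat (gtr0_norm t0).
      have -> : 2 * B ^+ 2 * B1 = 2 * 1 * B * B * 1 * B1 by ring.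
      by rewrite !ler_pM ?mulr_ge0 ?normr_ge0 ?(ltW t0) ?hB ?nD ?hB1.
    have p2 : `|2 * phi x * (D x)^-1 * E2 x i j| <= 2 * B * B2.
      rewrite !normrM normr_nat.
      have -> : 2 * B * B2 = 2 * B * 1 * B2 by ring.
      by rewrite !ler_pM ?mulr_ge0 ?normr_ge0 ?hB ?nD ?hB2.
    by rewrite (le_trans (lerD p1 p2))// lerDl.
  have TH : T H <= 0.
    rewrite -[leRHS](mul0r V) -(subrr 1); apply: (@inner_test kap) => // x.
      apply: contraR; rewrite -ltNge => kx; apply/eqP; rewrite /H /E1 /E2.
      have -> : phi x = 0 by apply/eqP; apply: contraTT kx => /hs; rewrite -leNgt.
      by rewrite !scale0r !scaler0 addr0.
    move=> kx; have [ax _] := shell_sq k0 kx.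
    pose Q : 'M[R]_d := 1%:M + (2 * (t * phi x) / D x) *: A
      - (2 * (t * phi x) ^+ 2 / D x) *: P.
    have -> : extremal_field x + H x = Q *m extremal_field x.
      rewrite /H /E1 /E2 /Q; move: (extremal_field x) => F.
      rewrite mulmxBl mulmxDl mul1mx -!scalemxAl !scalerA -addrA.
      rewrite -scaleNr; move: (D x)^-1 (phi x) => Di ph.
      by congr (_ + (_ *: _ + _ *: _)); ring.
    rewrite (schatten_norm_gram q (N := extremal_field x)).
      exact/schatten_extremal_field/ltW.
    rewrite trmx_mul mulmxA -(mulmxA _ Q^T).
    by rewrite (rotation_orthogonal (t * phi x) AT PT AA AP PA PP) mulmx1.
  have TE : 2 * t * T E1 = T H + t ^+ 2 * T G.
    rewrite -(pairingZ _ lf1 t1) -(pairingZ _ lf1 tG) -(pairingD lf1 tH (tfieldZ _ tG)).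
    congr (T _); apply/funext => x; rewrite /H /G; move: (E1 x) (E2 x) => X Y.
    rewrite scalerDr !scalerA addrACA -!scalerDl.
    have -> : - 2 * t ^+ 2 * phi x * (D x)^-1 + t ^+ 2 * (2 * phi x * (D x)^-1) = 0 by ring.
    rewrite scale0r addr0; congr (_ *: _).
    by move: (D0 x); rewrite /D => Dx; field.
  have t20 : 0 < 2 * t by rewrite mulr_gt0.
  rewrite -(ler_pM2l t20) TE.
  have -> : 2 * t * (t * (C * K * V / 2)) = t ^+ 2 * (C * K * V) by field.
  by rewrite -[leRHS]add0r lerD// ler_wpM2l// sqr_ge0.
have M0 : 0 <= C * K * V / 2 by rewrite divr_ge0// !mulr_ge0 ?V_ge0// ltW.
apply/ler_addgt0Pr => e e0; rewrite add0r; set M := C * K * V / 2 in key M0.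
have Me : 0 < M + e by rewrite ltr_wpDl.
have := key (e / (M + e)); rewrite divr_gt0// ler_pdivrMr// mul1r lerDr M0 => /(_ isT) h.
rewrite (le_trans h)// mulrAC ler_pdivrMr// ler_pM2l// lerDl; exact: ltW.
Qed.

(** Multiplied by A, the extremal field is -c (A - A x x^T / reg). The rotation argument kills the
    whole and [pairing_skew] kills the term with constant A; the factor reg / c in the test
    functions normalizes what remains. *)
Lemma pairing_skew_rank1 (k j : 'I_d) kap psi : shell_test kap psi ->
  T (fun x => psi x *: ((delta_mx k j - delta_mx j k) *m rank1 x)) = 0.
Proof.
move=> hp; have [<-|kj] := eqVneq k j.
  by rewrite -(pairing0 f1); congr (T _); apply/funext => x; rewrite subrr mul0mx scaler0.
have jk : j != k by rewrite eq_sym.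
set A := _ - _; pose P : 'M[R]_d := delta_mx k k + delta_mx j j.
have dm := (mul_delta_mx_cond, eqxx, negbTE kj, negbTE jk, mulr1n, mulr0n).
have AT : A^T = - A by rewrite /A linearB/= !trmx_delta opprB.
have PT : P^T = P by rewrite /P linearD/= !trmx_delta.
have AA : A *m A = - P.
  by rewrite /A /P !(mulmxBl, mulmxBr) !dm sub0r subr0 opprD.
have AP : A *m P = A.
  by rewrite /A /P !(mulmxBl, mulmxDr) !dm add0r addr0.
have PA : P *m A = A.
  by rewrite /A /P !(mulmxDl, mulmxBr) !dm subr0 sub0r.
have PP : P *m P = P.
  by rewrite /P !(mulmxDl, mulmxDr) !dm addr0 add0r.
have cr := @cls_reg R n a.
have hp1 := shell_testM hp (clsM cr (cls_cst c^-1)).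
have hp2 := shell_testM hp cr.
have [k2 c2 _] := hp2.
have t1 := shell_test_tfield hp1 (mcls_mulmx A mcls_extremal_field).
have t2 := shell_test_tfield hp2 (E := fun=> A) (fun i j => cls_cst (A i j)).
have := pairing_rotation AT PT AA AP PA PP hp1.
have := pairing_skew c2 (shell_test_bsup hp2) AT.
move=> e2 e1; rewrite -[RHS]addr0 -{1}e1 -e2 -(pairingD lf1 t1 t2).
congr (T _); apply/funext => x; rewrite /extremal_field.
rewrite -scalemxAr mulmxBr mulmx1 -scalemxAr scalerA scalerBr scalerA.
rewrite addrAC -scalerDl -scaleNr.
have c0' : c != 0 by rewrite gt_eqF.
have r0 := reg_neq0 a0 x.
have -> : psi x * (reg x * c^-1) * - c + psi x * reg x = 0 by field.
by rewrite scale0r add0r; congr (_ *: _); field; rewrite r0 c0'.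
Qed.

Definition column_field (k : 'I_d) (x : rV) : 'M[R]_d :=
  \matrix_(i, j) ((i == k)%:R * x ord0 j).

Lemma mcls_column_field k : mcls (column_field k).
Proof.
by move=> i j; under eq_fun do rewrite mxE; apply: clsM; [exact: cls_cst|exact: cls_coord].
Qed.

(** The algebraic identity behind it is |x|^2 e_k x^T = x_k x x^T + sum_j x_j (e_k e_j^T - e_j
    e_k^T) x x^T. *)
Lemma pairing_column_shell k kap psi : shell_test kap psi ->
  T (fun x => psi x *: column_field k x) = 0.
Proof.
move=> hp; have [k0 _ hs] := hp.
have hq j : shell_test kap (fun x => psi x * ((reg x)^-1 * x ord0 j)).
  by apply: shell_testM hp _; apply: clsM; [exact: cls_regV|exact: cls_coord].
have tr := shell_test_tfield (hq k) mcls_rank1.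
have ts j := shell_test_tfield (hq j) (mcls_mulmx (delta_mx k j - delta_mx j k) mcls_rank1).
have := pairing_rank1 (hq k).
have e2 : T (fun x => \sum_j (psi x * ((reg x)^-1 * x ord0 j)) *:
    ((delta_mx k j - delta_mx j k) *m rank1 x)) = 0.
  by rewrite (pairing_sum _ lf1 ts) big1// => j _; exact: pairing_skew_rank1.
move=> e1; rewrite -[RHS]addr0 -{1}e1 -e2 -(pairingD lf1 tr (tfield_sum _ ts)).
congr (T _); apply/funext => x.
have [p0|/hs kx] := eqVneq (psi x) 0.
  by rewrite p0 mul0r !scale0r add0r big1// => j _; rewrite mul0r scale0r.
have [ax _] := shell_sq k0 kx.
apply/matrixP => i l; rewrite mxE [column_field k x i l]mxE [RHS]mxE [X in X + _]mxE summxE.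
rewrite reg_eq ?ltW//; have x0 : sq x != 0 by rewrite gt_eqF// (lt_trans a0).
have E j : ((psi x * ((sq x)^-1 * x ord0 j)) *:
    ((delta_mx k j - delta_mx j k) *m rank1 x)) i l =
    psi x * (sq x)^-1 * ((i == k)%:R * x ord0 l * x ord0 j ^+ 2
      - (i == j)%:R * (x ord0 k * x ord0 l * x ord0 j)).
  rewrite mxE mulmxBl [X in _ * X]mxE [X in _ + X]mxE.
  have M (p r : 'I_d) : (delta_mx p r *m rank1 x) i l = (i == p)%:R * (x ord0 r * x ord0 l).
    rewrite mxE (bigD1 r)//= big1 ?addr0 => [|s sr]; last first.
      by rewrite mxE (negbTE sr) andbF mul0r.
    by rewrite mxE eqxx andbT rank1E.
  by rewrite !M; ring.
under eq_bigr do rewrite E.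
rewrite -mulr_sumr sumrB -mulr_sumr -/(sq x).
rewrite [X in _ - X](bigD1 i)//= eqxx big1 ?addr0 => [|j ji]; last first.
  by rewrite eq_sym (negbTE ji) mul0r.
rewrite rank1E; set b := (i == k)%:R; rewrite -[true%:R]/(1 : R).
field.
exact: x0.
Qed.

End inner_part.

(** The origin is filled in: e_k x^T has entries of size at most s for |x| <= s, so by
    [pairing_entry_bound] the part cut out there contributes O(s), however steep the cutoff is. *)
Lemma pairing_column k (phi : rV -> R) dl : 0 < dl -> cls phi ->
  (forall x, phi x != 0 -> sq x <= 1 - dl) -> T (fun x => phi x *: column_field k x) = 0.
Proof.
move=> dl0 cp hp.
have hM : bsup 1 phi.
  move=> x x1; apply/eqP/negPn/negP => /hp; rewrite leNgt => /negP; apply.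
  have : 1 < sq x by rewrite (lt_le_trans _ (norm_le_sq x))// exprn_egt1.
  by apply: le_lt_trans; rewrite lerBlDr lerDl ltW.
have [B B0 hB] := bsup_bounded (cls_cont cp) hM.
have [C C0 hC] := pairing_entry_bound.
have tG : tfield (fun x => phi x *: column_field k x).
  split=> [i j|].
    apply: eq_smooth (smoothM (cls_smooth cp) (cls_smooth (mcls_column_field k i j))) => x.
    by rewrite [RHS]mxE.
  by exists 1 => x /hM ->; rewrite scale0r.
have key s : 0 < s < 1 -> `|T (fun x => phi x *: column_field k x)| <= s * (C * (B + 1) * V).
  (* The cutoff [chi] rises from 0 at |x|^2 = 2 a to 1 at |x|^2 = 3 a = s^2, so its support keeps
     away from the inner boundary |x|^2 = a of the shell. *)
  move=> /andP[s0 s1]; pose a := s ^+ 2 / 3.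
  have s20 : 0 < s ^+ 2 by rewrite exprn_gt0.
  have s21 : s ^+ 2 < 1 by rewrite exprn_ilt1// ltW.
  have a0 : 0 < a by rewrite divr_gt0.
  have a1 : a < 1 by rewrite /a; lra.
  pose chi (x : rV) := step (sq x * a^-1 - 2).
  have cc : cls chi.
    apply: cls_step; apply: clsB; last exact: cls_cst.
    by apply: clsM; [exact: cls_sq|exact: cls_cst].
  have chi0 x : chi x != 0 -> 2 * a <= sq x.
    apply: contraNT; rewrite -ltNge => h; rewrite /chi step_eq0//.
    by rewrite subr_le0 ler_pdivrMr// ltW.
  have chi1 x : s ^+ 2 <= sq x -> chi x = 1.
    move=> h; rewrite /chi step_eq1// lerBrDr ler_pdivlMr//.
    by rewrite (le_trans _ h)// /a; lra.
  have hs : shell_test a (a * dl) (fun x => phi x * chi x).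
    split=> [||x]; [by rewrite mulr_gt0|exact: clsM|].
    rewrite mulf_eq0 negb_or => /andP[/hp h1 /chi0 h2].
    by rewrite /shell ler_pM ?(ltW a0) ?(ltW dl0)//; lra.
  have t1 := shell_test_tfield a1 hs (mcls_column_field k).
  have t2 : tfield (fun x => (1 - chi x) *: (phi x *: column_field k x)).
    by apply: tfieldM => //; apply/cls_smooth/clsB => //; exact: cls_cst.
  have -> : T (fun x => phi x *: column_field k x) =
      T (fun x => (1 - chi x) *: (phi x *: column_field k x)).
    rewrite -[RHS]addr0 -{1}(pairing_column_shell a0 a1 k hs) -(pairingD lf1 t2 t1).
    by congr (T _); apply/funext => x; rewrite !scalerA -scalerDl; congr (_ *: _); ring.
  have Bs : 0 < (B + 1) * s by rewrite mulr_gt0// ltr_wpDl.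
  have -> : s * (C * (B + 1) * V) = C * ((B + 1) * s) * V by ring.
  apply: hC => // x i j.
  have [h|h] := leP (s ^+ 2) (sq x).
    by rewrite chi1// subrr scale0r mxE normr0 ltW.
  rewrite mxE [X in _ * X]mxE [X in _ * (_ * X)]mxE.
  have /andP[c1 c2] := step_itv (sq x * a^-1 - 2).
  have p1 : `|1 - chi x| <= 1 by rewrite ler_norml /chi; apply/andP; split; lra.
  have p2 : `|x ord0 j| <= s.
    rewrite -(@ler_pXn2r _ 2) ?nnegrE ?normr_ge0 ?(ltW s0)//.
    by rewrite real_normK ?num_real// (le_trans _ (ltW h))// /sq (bigD1 j)//= lerDl sumr_ge0// => l _; exact: sqr_ge0.
  have p3 : `|(i == k)%:R : R| <= 1 by case: (i == k); rewrite ?normr1 ?normr0.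
  rewrite !normrM; have -> : (B + 1) * s = 1 * ((B + 1) * (1 * s)) by ring.
  by rewrite !ler_pM ?mulr_ge0 ?normr_ge0// (le_trans (hB x))// lerDl.
apply/normr0_eq0/eqP; rewrite eq_le normr_ge0 andbT.
set M := C * (B + 1) * V in key.
have M0 : 0 <= M by rewrite /M !mulr_ge0 ?V_ge0 ?addr_ge0// ltW.
apply/ler_addgt0Pr => e e0; rewrite add0r.
have Me : 0 < M + e + e by rewrite -addrA ltr_wpDl// addr_gt0.
have := key (e / (M + e + e)); rewrite divr_gt0// ltr_pdivrMr// mul1r.
rewrite ltrDr ltr_wpDl// => /(_ isT) h.
rewrite (le_trans h)// mulrAC ler_pdivrMr// ler_pM2l//.
by move: e0; lra.
Qed.

End variational.

(** * Euler operators, translations and dilations *)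

Section euler.
Context {R : realType} {n : nat}.
Local Notation d := n.+1.
Local Notation rV := 'rV[R]_d.
Implicit Types (f g phi psi w : rV -> R) (x v b : rV) (M : R).

Lemma sum_delta (F : 'I_d -> R) k : \sum_i F i * (k == i)%:R = F k.
Proof.
rewrite (bigD1 k)//= eqxx mulr1 big1 ?addr0// => i ik.
by rewrite eq_sym (negbTE ik) mulr0.
Qed.

Lemma partial_affn phi (s : R) b i : cls phi ->
  partial i (fun x => phi (s *: x + b)) = fun x => s * partial i phi (s *: x + b).
Proof.
move=> cp; apply/funext => x.
have dp : is_diff (s *: x + b) phi (gradf phi (s *: x + b)).
  have h := cls_diff cp (s *: x + b).
  by apply: DiffDef => //; rewrite diff_gradf.
have da : is_diff x (fun y : rV => s *: y + b) (fun v => s *: v + 0).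
  exact: is_diffD.
have h : is_diff x (phi \o (fun y => s *: y + b))
    (gradf phi (s *: x + b) \o (fun v => s *: v + 0)) by exact: is_diff_comp.
rewrite (is_diff_partial i h) /= addr0 /gradf (bigD1 i)//= big1 ?addr0.
  by rewrite !mxE !eqxx mulr1.
by move=> j ji; rewrite !mxE (negbTE ji) andbF mulr0 mul0r.
Qed.

Lemma partial_sumE (I : Type) (s : seq I) (F : I -> rV -> R) i : (forall k, cls (F k)) ->
  partial i (fun x => \sum_(k <- s) F k x) = fun x => \sum_(k <- s) partial i (F k) x.
Proof.
move=> cF; elim: s => [|k s IH].
  rewrite (_ : (fun x => _) = (fun=> 0)) ?partial_cst; last first.
    by apply/funext => x; rewrite big_nil.
  by apply/funext => x; rewrite big_nil.
rewrite (_ : (fun x => _) = (fun x => F k x + \sum_(k <- s) F k x)); last first.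
  by apply/funext => x; rewrite big_cons.
rewrite partialDE//; last exact: cls_sum.
by rewrite IH; apply/funext => x; rewrite big_cons.
Qed.

Lemma partialZE c f i : cls f -> partial i (fun x => c * f x) = fun x => c * partial i f x.
Proof. by move=> cf; apply: smooth_partialZE; exact: cls_smooth. Qed.

Definition dirg v phi x := gradf phi x v.
Definition eul phi x := gradf phi x x.
(** The operator x . grad + k. For k = d it is the divergence of phi x; for natural k it is t d/dt
    of t^k phi(t x) at t = 1. *)
Definition eulk (k : R) phi x := eul phi x + k * phi x.

Lemma cls_dirg v phi : cls phi -> cls (dirg v phi).
Proof.
by move=> cp; apply: cls_sum => i; apply: clsM; [exact: cls_cst|exact: cls_partial].
Qed.

Lemma cls_eul phi : cls phi -> cls (eul phi).
Proof.
by move=> cp; apply: cls_sum => i; apply: clsM; [exact: cls_coord|exact: cls_partial].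
Qed.

Lemma cls_eulk k phi : cls phi -> cls (eulk k phi).
Proof.
move=> cp; apply: clsD; first exact: cls_eul.
by apply: clsM => //; exact: cls_cst.
Qed.

Lemma eul_bsup M phi : bsup M phi -> bsup M (eul phi).
Proof. by move=> h x xM; exact: gradf_bsup h xM. Qed.

Lemma dirg_bsup M v phi : bsup M phi -> bsup M (dirg v phi).
Proof. by move=> h x xM; exact: gradf_bsup h xM. Qed.

Lemma eulk_bsup M k phi : bsup M phi -> bsup M (eulk k phi).
Proof. by move=> h x xM; rewrite /eulk (eul_bsup h)// h// mulr0 addr0. Qed.

Lemma divergence_coord phi x : cls phi ->
  \sum_i partial i (fun y => phi y * y ord0 i) x = eulk d%:R phi x.
Proof.
move=> cp; rewrite /eulk /eul /gradf mulr_natl.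
rewrite -[X in _ *+ X](card_ord d) -sumr_const -big_split/=; apply: eq_bigr => i _.
by rewrite (partialME i cp (cls_coord i)) partial_coord eqxx mulr1 addrC.
Qed.

Lemma partial_eulk k (a : R) phi : cls phi ->
  partial k (eulk a phi) = eulk (a + 1) (partial k phi).
Proof.
move=> cp; apply/funext => x.
rewrite /eulk partialDE; [|exact: cls_eul|by apply: clsM => //; exact: cls_cst].
rewrite partialZE// /eul /gradf partial_sumE; last first.
  by move=> i; apply: clsM; [exact: cls_coord|exact: cls_partial].
under eq_bigr => i _ do rewrite (partialME k (cls_coord i) (cls_partial i cp)) partial_coord.
have h1 : \sum_i x ord0 i * partial k (partial i phi) x =
    \sum_i x ord0 i * partial i (partial k phi) x.
  by apply: eq_bigr => i _; rewrite (partialC k i cp).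
have h2 : \sum_i partial i phi x * (k == i)%:R = partial k phi x.
  exact: (sum_delta (fun i => partial i phi x)).
rewrite (etrans (big_split _ _ _ _ _) (f_equal2 +%R h1 h2)).
by move: (\sum_i _) (partial k phi x) => S p; ring.
Qed.

Lemma eul_dilation phi (s : R) x : cls phi -> eul (fun y => phi (s *: y)) x = eul phi (s *: x).
Proof.
move=> cp; rewrite /eul /gradf; apply: eq_bigr => i _.
have -> : (fun y => phi (s *: y)) = (fun y => phi (s *: y + 0)).
  by apply/funext => y; rewrite addr0.
by rewrite partial_affn// addr0 mxE mulrA [x ord0 i * s]mulrC.
Qed.

Lemma eulk_dilation k phi (s : R) : cls phi ->
  eulk k (fun y => phi (s *: y)) = fun x => eulk k phi (s *: x).
Proof. by move=> cp; apply/funext => x; rewrite /eulk eul_dilation. Qed.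

Lemma cls_dilation phi (s : R) : cls phi -> cls (fun x => phi (s *: x)).
Proof.
move=> cp; rewrite (_ : (fun x => _) = (fun x => phi (s *: x + 0))); first exact: cls_affine.
by apply/funext => x; rewrite addr0.
Qed.

Lemma cls_shift phi b : cls phi -> cls (fun x => phi (x + b)).
Proof.
move=> cp; rewrite (_ : (fun x => _) = (fun x => phi (1 *: x + b))); first exact: cls_affine.
by apply/funext => x; rewrite scale1r.
Qed.

Lemma dirg_shift v phi b : cls phi ->
  dirg v (fun y => phi (y + b)) = fun x => dirg v phi (x + b).
Proof.
move=> cp; apply/funext => x; rewrite /dirg /gradf; apply: eq_bigr => i _.
have -> : (fun y => phi (y + b)) = (fun y => phi (1 *: y + b)).
  by apply/funext => y; rewrite scale1r.
by rewrite partial_affn// scale1r mul1r.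
Qed.

Lemma path_shift w phi v M (t : R) : locint w -> cls phi -> bsup M phi ->
  is_derive t 1 (fun t : R => II (fun x => w x * phi (x + t *: v)))
    (II (fun x => w x * dirg v phi (x + t *: v))).
Proof.
move=> lw cp hM; have t1 : 0 < 1 + t * 0 :> R by rewrite mulr0 addr0.
have := int_path v lw cp hM t1.
have -> : (fun t : R => II (fun x => w x * phi ((1 + t * 0) *: x + t *: v))) =
    (fun t : R => II (fun x => w x * phi (x + t *: v))).
  by apply/funext => s; congr II; apply/funext => x; rewrite mulr0 addr0 scale1r.
have -> // : (fun x => w x * gradf phi ((1 + t * 0) *: x + t *: v) (0 *: x + v)) =
    (fun x => w x * dirg v phi (x + t *: v)).
by apply/funext => x; rewrite mulr0 addr0 scale1r scale0r add0r.
Qed.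

Lemma path_dilation w phi M (t : R) : locint w -> cls phi -> bsup M phi -> 0 < t ->
  is_derive t 1 (fun t : R => II (fun x => w x * phi (t *: x)))
    (t^-1 * II (fun x => w x * eul phi (t *: x))).
Proof.
move=> lw cp hM t0; have t1 : 0 < 0 + t * 1 :> R by rewrite mulr1 add0r.
have := int_path 0 lw cp hM t1.
have -> : (fun t : R => II (fun x => w x * phi ((0 + t * 1) *: x + t *: 0))) =
    (fun t : R => II (fun x => w x * phi (t *: x))).
  by apply/funext => s; congr II; apply/funext => x; rewrite mulr1 add0r scaler0 addr0.
have -> // : II (fun x => w x * gradf phi ((0 + t * 1) *: x + t *: 0) (1 *: x + 0)) =
    t^-1 * II (fun x => w x * eul phi (t *: x)).
rewrite -IIZ.
  congr II; apply/funext => x; rewrite mulr1 add0r scaler0 !addr0 scale1r mulrCA.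
  congr (_ * _); rewrite /eul /gradf mulr_sumr; apply: eq_bigr => i _.
  by rewrite mxE mulrA mulKf// gt_eqF.
apply: (@itg_test _ _ _ _ (M / t)) => //.
  by apply/cls_cont/cls_dilation/cls_eul.
move=> x; rewrite ltr_pdivrMr// => h; apply: eul_bsup hM _ _.
by rewrite normrZ gtr0_norm// mulrC.
Qed.

Lemma div2_rank1_cst phi v x : cls phi ->
  div2 (fun y => phi y *: rank1 v) x = dirg v (dirg v phi) x.
Proof.
move=> cp; rewrite div2E /dirg /gradf; apply: eq_bigr => i _.
rewrite partial_sumE; last first.
  by move=> j; apply: clsM; [exact: cls_cst|exact: cls_partial].
rewrite mulr_sumr; apply: eq_bigr => j _.
rewrite (_ : (fun y : rV => (phi y *: rank1 v) i j) =
    (fun y => (v ord0 i * v ord0 j) * phi y)); last first.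
  by apply/funext => y; rewrite mxE rank1E mulrC.
rewrite (partialZE _ j cp) (partialZE _ i (cls_partial j cp)).
by rewrite (partialZE _ i (cls_partial j cp)) mulrA.
Qed.

(** The two Euler operators are the successive derivatives of t^(d+1) phi(t x); fields phi x x^T
    thus control the second derivative of a pairing along dilations. *)
Lemma div2_rank1 phi x : cls phi ->
  div2 (fun y => phi y *: rank1 y) x = eulk d%:R (eulk (d%:R + 1) phi) x.
Proof.
move=> cp; have ck := cls_eulk (d%:R + 1) cp.
rewrite div2E -(divergence_coord x ck); apply: eq_bigr => i _.
have cj j : cls (fun y => (phi y * y ord0 i) * y ord0 j).
  by apply: clsM; [apply: clsM => //|]; exact: cls_coord.
rewrite (_ : (fun y => _) = (fun y => \sum_j partial j (fun z => (phi z * z ord0 i) * z ord0 j) y)).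
  rewrite partial_sumE; last by move=> j; exact: cls_partial.
  apply: eq_bigr => j _; rewrite (_ : (fun y : rV => (phi y *: rank1 y) i j) =
    (fun z => (phi z * z ord0 i) * z ord0 j))//.
  by apply/funext => y; rewrite mxE rank1E mulrA.
apply/funext => y; rewrite divergence_coord; last by apply: clsM => //; exact: cls_coord.
rewrite /eulk /eul /gradf.
under [X in _ = X + _]eq_bigr => j _ do
  rewrite (partialME j cp (cls_coord i)) partial_coord mulrDr.
have h1 : \sum_j y ord0 j * (phi y * (j == i)%:R) = y ord0 i * phi y.
  under eq_bigr => j _ do rewrite mulrA eq_sym.
  exact: (sum_delta (fun j => y ord0 j * phi y)).
have h2 : \sum_j y ord0 j * (y ord0 i * partial j phi y) =
    y ord0 i * \sum_j y ord0 j * partial j phi y.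
  by rewrite mulr_sumr; apply: eq_bigr => j _; rewrite mulrCA.
rewrite (etrans (big_split _ _ _ _ _) (f_equal2 +%R h1 h2)); move: (\sum_j _) => S; ring.
Qed.

End euler.

(** * Weakly affine functions *)

Section weakly_affine.
Context {R : realType} {n : nat}.
Local Notation d := n.+1.
Local Notation rV := 'rV[R]_d.
Local Notation mu := (@lebesgue_measure_rV R d).
Implicit Types (f g phi psi w : rV -> R) (x v b z : rV) (M : R).

Lemma II_indic (A : set rV) : measurable A -> II (\1_A : rV -> R) = fine (mu A).
Proof. by move=> mA; rewrite /II /Rintegral integral_indic// setIT. Qed.

Lemma itg_indic (A : set rV) M : measurable A -> (forall x, A x -> `|x| <= M) ->
  itg (\1_A : rV -> R).
Proof.
move=> mA AM; apply: (itg_eq (f := fun x => 1 * \1_A x)); first by move=> x; rewrite mul1r.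
apply: (@itg_locint _ _ _ _ M 1); first exact: locint_cst.
- exact: measurable_indic.
- move=> x; have /andP[i0 i1] := indic_itv A x.
  by rewrite ger0_norm.
- by move=> x xM; rewrite indicE memNset// => /AM; rewrite leNgt xM.
Qed.

Lemma mu_ball_gt0 (c : rV) (r : R) : 0 < r -> 0 < fine (mu [set x | `|x - c| < r]).
Proof.
move=> r0; pose B (i : 'I_d) : set R := `]c ord0 i - r, c ord0 i + r[%classic.
have -> : [set x | `|x - c| < r] = [set x : rV | forall i, B i (x ord0 i)].
  apply/seteqP; split=> x /=.
    move=> /rV_norm_ltP[_ h] i; have := h i; rewrite !mxE ltr_norml => /andP[h1 h2].
    by rewrite /B /= in_itv/=; apply/andP; split; lra.
  move=> h; apply/rV_norm_ltP; split=> // i; have := h i; rewrite /B /= in_itv/= => /andP[h1 h2].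
  by rewrite !mxE ltr_norml; apply/andP; split; lra.
have -> : mu [set x : rV | forall i, B i (x ord0 i)] = (\prod_(i < d) (2 * r)%:E)%E.
  rewrite -[LHS]/(lebesgue_measure_rV d _) lebesgue_measure_rV_box => [|i]; last exact: measurable_itv.
  apply: eq_bigr => i _; rewrite /B lebesgue_measure_itv/= lte_fin ifT; last by lra.
  by rewrite -EFinD; congr EFin; lra.
rewrite prodEFin/= prodr_const; apply: exprn_gt0; lra.
Qed.

Lemma II_gt0 f x0 : continuous f -> (forall x, 0 <= f x) -> itg f -> 0 < f x0 -> 0 < II f.
Proof.
move=> cf f0 hf fx0; have a0 : 0 < f x0 / 2 by rewrite divr_gt0.
have /cvgrPdist_lt/(_ _ a0) := cf x0.
rewrite -(filter_from_ballE) => -[r /= r0 hr].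
have mB := @measurable_rV_ball R d x0 r.
have hB x : [set x | `|x - x0| < r] x -> `|x| <= `|x0| + r.
  move=> /= xr; rewrite -(subrK x0 x) (le_trans (ler_normD _ _))// addrC lerD2l; exact: ltW.
have iB := itg_indic mB hB.
apply: lt_le_trans (_ : f x0 / 2 * II (\1_[set x : rV | `|x - x0| < r] : rV -> R) <= _).
  by rewrite mulr_gt0// II_indic// mu_ball_gt0.
rewrite -IIZ//; apply: II_le => //; first exact: itgZ.
move=> x; rewrite indicE; case: (boolP (x \in _)) => [|_]; last by rewrite mulr0.
rewrite inE /= => xr; rewrite mulr1.
have : `|f x0 - f x| < f x0 / 2 by apply: hr; rewrite -ball_normE /= distrC.
by rewrite ltr_norml => /andP[_ h]; apply: ltW; move: h; lra.
Qed.

Lemma II_shift f b : itg f -> II (fun x => f (x + b)) = II f.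
Proof.
move=> hf; rewrite (II_affn b ltr01 hf) expr1n mul1r; congr II.
by apply/funext => x; rewrite /affn scale1r.
Qed.

Lemma itg_shift f b : itg f -> itg (fun x => f (x + b)).
Proof.
move=> hf; apply: (itg_eq _ (itg_affn b ltr01 hf)) => x.
by rewrite /affn scale1r.
Qed.

Lemma locint_shift w b : locint w -> locint (fun x => w (x + b)).
Proof.
move=> lw; have := locint_affn b ltr01 lw.
by congr locint; apply/funext => x; rewrite /affn scale1r.
Qed.

(** A radial bump of radius r / 2 is translated by its barycentre, which again has norm at most r /
    2. The changes of variables at hand have positive ratio, so the barycentre is moved to 0 instead
    of being computed by reflection. *)
Lemma centered_bump (r : R) : 0 < r -> exists psi, [/\ cls psi, bsup r psi, II psi = 1 &
  forall i, II (fun x => x ord0 i * psi x) = 0].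
Proof.
move=> r0; pose s := r / 2; have s0 : 0 < s by rewrite divr_gt0.
pose g x := e0 (s ^+ 2 - sq x).
have cg : cls g by apply: cls_e0; apply: clsB; [exact: cls_cst|exact: cls_sq].
have gs : bsup s g.
  move=> x xs; rewrite /g e0_eq0// subr_le0 (le_trans _ (norm_le_sq x))//.
  by rewrite lerXn2r ?nnegrE ?(ltW s0)// ltW.
have ig : itg g by apply: itg_bsup gs; exact: cls_cont.
have g0 x : 0 <= g x by exact: e0_ge0.
have I0 : 0 < II g.
  apply: (@II_gt0 _ 0) => //; first exact: cls_cont.
  rewrite /g e0_gt0 /sq big1 ?subr0 ?exprn_gt0// => i _.
  by rewrite mxE expr0n.
have ixg i : itg (fun x => x ord0 i * g x).
  apply: (@itg_bsup _ _ _ s); first by apply: cls_cont; apply: clsM => //; exact: cls_coord.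
  by move=> x /gs ->; rewrite mulr0.
pose m : rV := \row_i (II (fun x => x ord0 i * g x) / II g).
have mi i : `|m ord0 i| <= s.
  rewrite mxE normrM normfV (gtr0_norm I0) ler_pdivrMr// (le_trans (II_norm _))//.
  rewrite -IIZ//; apply: II_le => [||x]; [exact: itg_norm|exact: itgZ|].
  rewrite normrM (ger0_norm (g0 x)); have [/gs ->|xs] := ltP s `|x|; first by rewrite !mulr0.
  rewrite ler_wpM2r//; have /rV_norm_leP[_] := xs; exact.
have ms : `|m| <= s by apply/rV_norm_leP; split=> //; exact: ltW.
exists (fun x => (II g)^-1 * g (x + m)); split.
- by apply: clsM; [exact: cls_cst|exact: cls_shift].
- move=> x xr; rewrite gs ?mulr0//; rewrite -(addrK m x) in xr.
  have := lt_le_trans xr (ler_normB _ _); rewrite /s; move: ms; rewrite /s; lra.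
- by rewrite IIZ ?II_shift ?mulVf ?gt_eqF//; exact: itg_shift.
- move=> i; pose h (y : rV) := y ord0 i * g y - m ord0 i * g y.
  have ih : itg h by apply: itgB => //; exact: itgZ.
  rewrite (_ : (fun x => _) = (fun x : rV => (II g)^-1 * h (x + m))); last first.
    by apply/funext => x; rewrite /h mxE; ring.
  rewrite (IIZ _ (itg_shift m ih)) (II_shift m ih) /h IIB//; last exact: itgZ.
  by rewrite IIZ// mxE divfK ?gt_eqF// subrr mulr0.
Qed.

Lemma II_dirg w phi v M : locint w -> cls phi -> bsup M phi ->
  II (fun x => w x * dirg v phi x) = \sum_i v ord0 i * II (fun x => w x * partial i phi x).
Proof.
move=> lw cp hM.
have ip i : itg (fun x => w x * partial i phi x).
  by apply: (@itg_test _ _ _ _ M) => //; [exact/cls_cont/cls_partial|exact: partial_bsup].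
rewrite (_ : (fun x => _) = (fun x => \sum_i v ord0 i * (w x * partial i phi x))).
  by rewrite II_sum => [|i]; [apply: eq_bigr => i _; rewrite IIZ|exact: itgZ].
by apply/funext => x; rewrite /dirg /gradf mulr_sumr; apply: eq_bigr => i _; rewrite mulrCA.
Qed.

(** Joint integrability holds because x and z range over the ball of radius M, so x + z stays in the
    ball of radius 2 M, where w is integrable. *)
Lemma convolution_fubini w phi psi M : locint w -> continuous phi -> continuous psi ->
  bsup M phi -> bsup M psi ->
  II (fun z => II (fun x => w (x + z) * phi x) * psi z) =
  II (fun x => II (fun z => w (x + z) * psi z) * phi x).
Proof.
move=> lw cphi cpsi hphi hpsi.
pose h (p : rV * rV) : R := w (p.1 + p.2) * psi p.2 * phi p.1.
have mh : measurable_fun setT (EFin \o h).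
  apply/measurable_EFinP; apply: measurable_funM; last first.
    by apply: measurableT_comp => //; exact: continuous_measurable_rV.
  apply: measurable_funM; last first.
    by apply: measurableT_comp => //; exact: continuous_measurable_rV.
  have [mw _] := lw; apply: (measurableT_comp mw).
  apply: measurable_fun_coordP => i j; under eq_fun do rewrite mxE.
  by apply: measurable_funD;
    (apply: (measurableT_comp (measurable_coord i j)); [exact: measurable_fst || exact: measurable_snd]).
have i1 x : itg (fun z => w (x + z) * psi z).
  apply: (@itg_test _ _ _ _ M) => //.
  by have := locint_shift x lw; congr locint; apply/funext => z; rewrite addrC.
have i2 z : itg (fun x => w (x + z) * phi x).
  by apply: (@itg_test _ _ _ _ M) => //; exact: locint_shift.
have [C C0 hC] := bsup_bounded cpsi hpsi.
pose B := [set y : rV | `|y| <= M + M].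
have mB : measurable B by exact: measurable_cball.
have iwB : itg (fun y => `|w y * \1_B y|).
  apply: itg_norm; apply: (@itg_locint _ _ _ _ (M + M) 1) => //.
  - by move=> x; have /andP[? ?] := indic_itv B x; rewrite ger0_norm.
  - by move=> x xM; rewrite indicE memNset// /B/= leNgt xM.
pose K := C * II (fun y => `|w y * \1_B y|).
have bd x : phi x != 0 -> II (fun z => `|w (x + z) * psi z|) <= K.
  move=> px; have xM : `|x| <= M.
    by rewrite leNgt; apply: contraNN px => /hphi ->.
  rewrite /K -(II_shift x iwB) -IIZ; last exact: (itg_shift x iwB).
  apply: II_le => [||z]; [exact: itg_norm|exact: itgZ (itg_shift x iwB)|].
  have [/hpsi ->|zM] := ltP M `|z|; first by rewrite mulr0 normr0 mulr_ge0.
  rewrite [z + x]addrC indicE mem_set ?mulr1 ?normrM; first by rewrite mulrC ler_wpM2r.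
  by rewrite /B /= (le_trans (ler_normD _ _))// lerD.
have K0 : 0 <= K by rewrite /K mulr_ge0// II_ge0.
have ih : ((mu \x mu)%E).-integrable setT (EFin \o h).
  apply/(integrable12ltyP _ _ mh).
  have iK : itg (fun x => K * `|phi x|).
    by apply: itgZ; apply: itg_norm; exact: itg_bsup hphi.
  apply: (@le_lt_trans _ _ (\int[mu]_x (K * `|phi x|)%:E)%E); last first.
    by rewrite -EFin_II// ltry.
  apply: ge0_le_integral => //.
  - by move=> x _; exact: integral_ge0.
  - apply: (@measurable_fun_fubini_tonelli_F _ _ _ _ _ _ (fun p => `|(h p)%:E|%E)) => //.
    exact: measurableT_comp.
  - by apply/measurable_EFinP; exact: itg_meas iK.
  - move=> x _ /=; rewrite (_ : (fun y : rV => _) =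
        (fun z => (`|phi x| * `|w (x + z) * psi z|)%:E)); last first.
      by apply/funext => z; rewrite /h/= normrM mulrC.
    rewrite -EFin_II; last by apply: itgZ; exact: itg_norm.
    rewrite lee_fin IIZ; last exact: itg_norm.
    have [->|px] := eqVneq (phi x) 0; first by rewrite normr0 mul0r mulr0.
    by rewrite mulrC ler_wpM2r// bd.
have := Fubini ih; rewrite /II /Rintegral.
have -> : (fun x => (\int[mu]_y (EFin \o h) (x, y))%E) =
    (fun x => (II (fun z => w (x + z) * psi z) * phi x)%:E).
  apply/funext => x; rewrite mulrC -IIZ// EFin_II; last exact: itgZ.
  by apply: eq_integral => z _ /=; rewrite /h/= mulrC.
have -> : (fun y => (\int[mu]_x (EFin \o h) (x, y))%E) =
    (fun z => (II (fun x => w (x + z) * phi x) * psi z)%:E).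
  apply/funext => z; rewrite mulrC -IIZ// EFin_II; last exact: itgZ.
  by apply: eq_integral => x _ /=; congr EFin; rewrite /h/=; ring.
by rewrite /II /Rintegral => ->.
Qed.

End weakly_affine.

Section weak_affine.
Context {R : realType} {n : nat}.
Local Notation d := n.+1.
Local Notation rV := 'rV[R]_d.
Local Notation mu := (@lebesgue_measure_rV R d).
Implicit Types (f g phi psi w rho : rV -> R) (x v b z : rV) (M : R).

Lemma bsup_shift M phi b : bsup M phi -> bsup (M + `|b|) (fun x => phi (x + b)).
Proof.
move=> h x xM; apply: h; have := lerB_normD x b; move: xM; lra.
Qed.

(** The pairing of w with psi(x + t b) has second derivative 0 in t, so it is affine and its value
    at 1 is given by its 1-jet at 0. The margin eps puts both 0 and 1 inside an open interval. *)
Lemma shift_affine w psi b M (eps : R) : locint w -> cls psi -> bsup M psi -> 0 < eps ->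
  (forall t, - eps < t < 1 + eps ->
    II (fun x => w x * dirg b (dirg b (fun y => psi (y + t *: b))) x) = 0) ->
  II (fun x => w x * psi (x + b)) = II (fun x => w x * psi x) + II (fun x => w x * dirg b psi x).
Proof.
move=> lw cp hM e0 h2.
have := @derive2_itv R (fun t => II (fun x => w x * psi (x + t *: b)))
  (fun t => II (fun x => w x * dirg b psi (x + t *: b))) (- eps) (1 + eps).
move=> /(_ (fun t _ => path_shift b t lw cp hM)).
have d2 (t : R) : - eps < t < 1 + eps ->
    is_derive t 1 (fun t => II (fun x => w x * dirg b psi (x + t *: b))) 0.
  move=> ht; have := path_shift b t lw (cls_dirg b cp) (dirg_bsup b hM).
  have := h2 t ht; rewrite (dirg_shift b (t *: b) cp).
  by rewrite (dirg_shift b (t *: b) (cls_dirg b cp)) => ->.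
move=> /(_ d2 0) h; have i0 : - eps < 0 < 1 + eps by apply/andP; split; lra.
have i1 : - eps < 1 < 1 + eps by apply/andP; split; lra.
have := h i0 1 i1; rewrite subr0 mulr1 => h01.
have e1 : (fun x => w x * psi (x + 1 *: b)) = (fun x => w x * psi (x + b)).
  by apply/funext => x; rewrite scale1r.
have e2 : (fun x => w x * psi (x + 0 *: b)) = (fun x => w x * psi x).
  by apply/funext => x; rewrite scale0r addr0.
have e3 : (fun x => w x * dirg b psi (x + 0 *: b)) = (fun x => w x * dirg b psi x).
  by apply/funext => x; rewrite scale0r addr0.
by rewrite -e1 -e2 -e3.
Qed.

(* Convolve with a bump of mass 1 and mean 0: testing [w] against [psi] equals
   testing the (exactly affine) convolution of [w] against [psi], by Fubini. *)
Lemma weak_affine w rho rho' (eta dl : R) z0 : locint w -> cls rho' -> 0 < eta -> 0 < dl ->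
  (forall phi v, test_in rho phi -> II (fun x => w x * dirg v (dirg v phi) x) = 0) ->
  (forall z z', 0 < rho' z -> 0 < rho' z' -> exists2 eps : R, 0 < eps &
    forall t y, - eps < t < 1 + eps -> `|y - (z + t *: (z' - z))| <= eta -> dl <= rho y) ->
  0 < rho' z0 ->
  exists2 psi, test_in rho psi & {ae mu, forall x, 0 < rho' x ->
    w x = II (fun y => w y * psi y)
      - \sum_i (x ord0 i - z0 ord0 i) * II (fun y => w y * partial i psi y)}.
Proof.
move=> lw cr' eta0 dl0 weak buf z00.
have eta20 : 0 < eta / 2 by rewrite divr_gt0.
have eta2 : eta / 2 <= eta by lra.
have [psi0 [c0 s0 I0 m0]] := centered_bump (n := n) eta20.
have supp0 x : psi0 x != 0 -> `|x| <= eta / 2.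
  by move=> h; rewrite leNgt; apply: contraNN h => /s0 ->.
have cps b : cls (fun y => psi0 (y - b)) by exact: cls_shift.
pose psi y := psi0 (y - z0).
have cpsi : cls psi by exact: cps.
have bpsi : bsup (eta / 2 + `|- z0|) psi by exact: bsup_shift.
have testz z z' eps t : 0 < rho' z -> 0 < rho' z' ->
    (forall t y, - eps < t < 1 + eps -> `|y - (z + t *: (z' - z))| <= eta -> dl <= rho y) ->
    - eps < t < 1 + eps -> test_in rho (fun y => psi0 (y - (z + t *: (z' - z)))).
  move=> rz rz' h ht; split; first exact: cps.
    by exists (eta / 2 + `|- (z + t *: (z' - z))|); exact: bsup_shift.
  by exists dl => // y /supp0 hy; apply: (h t) => //; exact: le_trans hy eta2.
have tpsi : test_in rho psi.
  have [eps e0 he] := buf z0 z0 z00 z00.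
  have h0 : - eps < 0 < 1 + eps by apply/andP; split; lra.
  have := testz z0 z0 eps 0 z00 z00 he h0; rewrite subrr scaler0 addr0; exact.
pose A := II (fun y => w y * psi y).
pose G i := II (fun y => w y * partial i psi y).
pose l (x : rV) := A - \sum_i (x ord0 i - z0 ord0 i) * G i.
(* The bump travels along the segment from z to z0, which stays well inside the set where rho is
   positive by [buf]. *)
have key1 z : 0 < rho' z -> II (fun y => w y * psi0 (y - z)) = l z.
  move=> rz; have [eps e0 he] := buf z0 z z00 rz.
  have := @shift_affine w psi (z0 - z) _ eps lw cpsi bpsi e0.
  have h2 t : - eps < t < 1 + eps -> II (fun x => w x *
      dirg (z0 - z) (dirg (z0 - z) (fun y => psi (y + t *: (z0 - z)))) x) = 0.
    move=> ht; apply: weak; have := testz z0 z eps t z00 rz he ht.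
    congr test_in; apply/funext => y; rewrite /psi; congr psi0.
    by rewrite opprD -scalerN opprB addrA addrAC.
  move=> /(_ h2); rewrite (II_dirg _ lw cpsi bpsi) -/A => h.
  rewrite /l -sumrN; transitivity (II (fun x => w x * psi (x + (z0 - z)))).
    by congr II; apply/funext => y; rewrite /psi addrA addrAC addrK.
  rewrite h; congr (_ + _); apply: eq_bigr => i _; rewrite !mxE -/(G i); ring.
(* Here an arbitrary test function is translated by a small vector; the parameter range of length 2
   keeps the displacement below eta. *)
have key2 psi' x : test_in rho' psi' -> `|x| <= eta / 2 ->
    II (fun y => w y * psi' (y - x)) = II (fun y => w y * psi' y)
      - \sum_i x ord0 i * II (fun y => w y * partial i psi' y).
  move=> [c' [M' s'] [dl' dl'0 hdl']] xe.
  have half : 0 < 2^-1 :> R by rewrite invr_gt0.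
  have := @shift_affine w psi' (- x) _ _ lw c' s' half.
  have h2 t : - 2^-1 < t < 1 + 2^-1 -> II (fun y => w y *
      dirg (- x) (dirg (- x) (fun y => psi' (y + t *: - x))) y) = 0.
    move=> /andP[t1 t2]; apply: weak; split; first exact: cls_shift.
      by exists (M' + `|t *: - x|); exact: bsup_shift.
    exists dl => // y /hdl' hy; have rz := lt_le_trans dl'0 hy.
    have [eps e0 he] := buf _ _ rz rz; apply: (he 0); first by apply/andP; split; lra.
    rewrite subrr scaler0 addr0 opprD addrA subrr sub0r scalerN opprK.
    rewrite normrZ; have tl : `|t| <= 2 by rewrite ler_norml; apply/andP; split; lra.
    have -> : eta = 2 * (eta / 2) by field.
    exact: ler_pM.
  move=> /(_ h2) ->; rewrite (II_dirg _ lw c' s') -sumrN; congr (_ + _).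
  by apply: eq_bigr => i _; rewrite mxE mulNr.
exists psi => //.
have cl : cls l.
  apply: clsB; first exact: cls_cst.
  apply: cls_sum => i; apply: clsM; last exact: cls_cst.
  by apply: clsB; [exact: cls_coord|exact: cls_cst].
have ll : locint l by apply: locint_cont; exact: cls_cont.
have lwl : locint (fun x => w x + -1 * l x) by apply: locintD => //; exact: locintZ.
have := @fundamental_lemma R d _ rho' lwl cr' => fl.
suff : forall psi', test_in rho' psi' -> II (fun x => (w x + -1 * l x) * psi' x) = 0.
  move=> /fl; apply: filterS => x h rx; have := h rx.
  by rewrite mulN1r => /eqP; rewrite subr_eq0 => /eqP.
move=> psi' tp; have [c' [M' s'] [dl' dl'0 hdl']] := tp.
have ccont := cls_cont c'.
have iw : itg (fun x => w x * psi' x) by exact: itg_test ccont s'.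
have il : itg (fun x => l x * psi' x) by exact: itg_test ccont s'.
rewrite (_ : (fun x => _) = (fun x => w x * psi' x - l x * psi' x)); last first.
  by apply/funext => x; ring.
rewrite IIB//; apply/eqP; rewrite subr_eq0; apply/eqP.
have e1 : (fun x => l x * psi' x) =
    (fun z => II (fun x => w (x + z) * psi0 x) * psi' z).
  apply/funext => z; have [->|pz] := eqVneq (psi' z) 0; first by rewrite !mulr0.
  have rz := lt_le_trans dl'0 (hdl' z pz); rewrite -(key1 z rz); congr (_ * _).
  have iz : itg (fun y => w y * psi0 (y - z)).
    by apply: itg_test (bsup_shift (b := - z) s0) => //; exact: cls_cont.
  by rewrite -(II_shift z iz); congr II; apply/funext => x; rewrite addrK.
have s0' : bsup (Num.max (eta / 2) M') psi0.
  by move=> x; rewrite gt_max => /andP[/s0].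
have s'' : bsup (Num.max (eta / 2) M') psi'.
  by move=> x; rewrite gt_max => /andP[_ /s'].
rewrite e1 (convolution_fubini lw (cls_cont c0) ccont s0' s'').
pose g i := II (fun y => w y * partial i psi' y).
have ip0 : itg psi0 by apply: itg_bsup s0; exact: cls_cont.
have ixp0 i : itg (fun x => x ord0 i * psi0 x).
  apply: (@itg_bsup _ _ _ (eta / 2)).
    by apply: cls_cont; apply: clsM => //; exact: cls_coord.
  by move=> x /s0 ->; rewrite mulr0.
have e2 : (fun x => II (fun z => w (x + z) * psi' z) * psi0 x) =
    (fun x => II (fun y => w y * psi' y) * psi0 x - \sum_i g i * (x ord0 i * psi0 x)).
  apply/funext => x; have [p0|px] := eqVneq (psi0 x) 0.
    by rewrite p0 !mulr0 big1 ?subr0// => i _; rewrite !mulr0.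
  have iz : itg (fun y => w y * psi' (y - x)).
    by apply: itg_test (bsup_shift (b := - x) s') => //; exact/cls_cont/cls_shift.
  have -> : II (fun z => w (x + z) * psi' z) = II (fun y => w y * psi' (y - x)).
    by rewrite -(II_shift x iz); congr II; apply/funext => z; rewrite addrK addrC.
  rewrite (key2 psi' x tp (supp0 x px)) mulrBl mulr_suml; congr (_ - _).
  by apply: eq_bigr => i _; rewrite /g; ring.
rewrite e2 IIB; [|exact: itgZ|by apply: itg_sum => i; exact: itgZ].
rewrite IIZ// I0 mulr1 II_sum; last by move=> i; exact: itgZ.
by rewrite big1 ?subr0// => i _; rewrite IIZ// m0 mulr0.
Qed.

End weak_affine.

(** * Vanishing outside the ball *)

Section exterior.
Context {R : realType} {n : nat}.
Local Notation d := n.+1.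
Local Notation rV := 'rV[R]_d.
Local Notation mu := (@lebesgue_measure_rV R d).
Implicit Types (f g phi psi w rho : rV -> R) (x v b z : rV) (M : R).

Lemma sq_scale (t : R) (x : rV) : sq (t *: x) = t ^+ 2 * sq x.
Proof. by rewrite /sq mulr_sumr; apply: eq_bigr => i _; rewrite mxE exprMn. Qed.

Lemma coord_le_sq (x : rV) i : x ord0 i ^+ 2 <= sq x.
Proof. by rewrite /sq (bigD1 i)//= lerDl sumr_ge0// => j _; exact: sqr_ge0. Qed.

Lemma coord_le_norm (x : rV) i : `|x ord0 i| <= `|x|.
Proof. by have [_] := (rV_norm_leP x `|x|).1 (lexx _); exact. Qed.

Lemma sq_le_norm (x : rV) : sq x <= d%:R * `|x| ^+ 2.
Proof.
rewrite mulr_natl -[X in _ *+ X](card_ord d) -sumr_const; apply: ler_sum => i _.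
rewrite -real_normK ?num_real// lerXn2r ?nnegrE ?normr_ge0//; exact: coord_le_norm.
Qed.

Lemma tfield_rank1 phi M v : cls phi -> bsup M phi -> tfield (fun y => phi y *: rank1 v).
Proof.
move=> cp hM; split=> [i j|]; last by exists M => x /hM ->; rewrite scale0r.
apply: eq_smooth (smoothM (cls_smooth cp) (smooth_cst (rank1 v i j))) => x.
by rewrite [RHS]mxE.
Qed.

Lemma tfield_rank1_id phi M : cls phi -> bsup M phi -> tfield (fun y => phi y *: rank1 y).
Proof.
move=> cp hM; split=> [i j|]; last by exists M => x /hM ->; rewrite scale0r.
apply: eq_smooth (smoothM (cls_smooth cp) (cls_smooth (cls_rank1 i j))) => x.
by rewrite [RHS]mxE.
Qed.

Lemma pairing_rank1_cst w phi v : cls phi ->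
  pairing w (fun y => phi y *: rank1 v) = II (fun x => w x * dirg v (dirg v phi) x).
Proof.
by move=> cp; rewrite pairingE; congr II; apply/funext => x; rewrite div2_rank1_cst.
Qed.

Lemma II_ae0 w phi : locint w -> cls phi ->
  {ae mu, forall x, phi x != 0 -> w x = 0} -> II (fun x => w x * phi x) = 0.
Proof.
move=> [mw _] cp h; rewrite -[RHS](@II0 R d); apply: II_ae.
- by apply: measurable_funM => //; exact: cls_meas.
- exact: measurable_cst.
- apply: filterS h => x h; have [->|/h ->] := eqVneq (phi x) 0; first by rewrite mulr0.
  by rewrite mul0r.
Qed.

Variable u : rV -> R.
Hypothesis lu : locint u.
Hypothesis outer : forall G, tfield G -> supp_outer G -> pairing u G = 0.

(** A test function supported in s x_k > 1 is pushed in the direction e_i. It never meets the ball: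
    the push leaves x_k alone if i != k and increases s x_k if i = k and s = 1. Its pairing with u
    is affine in the time and vanishes at two late times, when the support has reached x_i > 2,
    hence also at time 0. *)
Lemma translate_null i k (s : R) : (i != k) || (s == 1) -> `|s| = 1 ->
  {ae mu, forall x, 2 < x ord0 i -> u x = 0} ->
  {ae mu, forall x, 1 < s * x ord0 k -> u x = 0}.
Proof.
move=> iks s1 h; pose rho (x : rV) := s * x ord0 k - 1.
have cr : cls rho.
  by apply: clsB; [apply: clsM; [exact: cls_cst|exact: cls_coord]|exact: cls_cst].
suff : {ae mu, forall x, 0 < rho x -> u x = 0}.
  by apply: filterS => x hx x1; apply: hx; rewrite /rho subr_gt0.
apply: fundamental_lemma => // psi [cp [M0 hM0] [dl dl0 hdl]].
pose M := `|M0| + 1; have M00 : 0 < M by rewrite ltr_wpDl.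
have hM : bsup M psi.
  by move=> x xM; apply: hM0; have := ler_norm M0; move: xM; rewrite /M; lra.
pose v : rV := - delta_mx ord0 i.
have vE j : v ord0 j = - (i == j)%:R by rewrite !mxE eqxx [j == i]eq_sym.
(* The support lies initially in |x_i| <= M, so from time M + 3 on it satisfies x_i >= 3. *)
pose T := M + 3.
have := @derive2_itv R (fun t => II (fun x => u x * psi (x + t *: v)))
  (fun t => II (fun x => u x * dirg v psi (x + t *: v))) (- (dl / 2)) (T + 2).
move=> /(_ (fun t _ => path_shift v t lu cp hM)).
have d2 (t : R) : - (dl / 2) < t < T + 2 ->
    is_derive t 1 (fun t => II (fun x => u x * dirg v psi (x + t *: v))) 0.
  move=> /andP[t1 t2]; have := path_shift v t lu (cls_dirg v cp) (dirg_bsup v hM).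
  suff -> : II (fun x => u x * dirg v (dirg v psi) (x + t *: v)) = 0 by [].
  have cs : cls (fun y => psi (y + t *: v)) by exact: cls_shift.
  have := pairing_rank1_cst u v cs.
  rewrite (dirg_shift v (t *: v) cp) (dirg_shift v (t *: v) (cls_dirg v cp)) => <-.
  apply: outer; first by apply: (tfield_rank1 (M := M + `|t *: v|)) => //; exact: bsup_shift.
  exists dl => // x; rewrite scaler_eq0 negb_or => /andP[/hdl + _].
  have vk : (x + t *: v) ord0 k = x ord0 k - t * (i == k)%:R.
    by rewrite mxE [X in _ + X]mxE vE mulrN.
  rewrite /rho vk => hx.
  have sx : 1 + dl / 2 <= s * x ord0 k.
    move: iks hx; have [_|_] := eqVneq i k; rewrite /= ?mulr1n ?mulr0n.
      by move=> /eqP ->; lra.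
    by move=> _; lra.
  have nx : 1 + dl / 2 <= `|x ord0 k|.
    rewrite (le_trans sx)// (le_trans (ler_norm _))// normrM s1 mul1r//.
  rewrite (le_trans _ (coord_le_sq x k))// -real_normK ?num_real//.
  have : (1 + dl / 2) ^+ 2 <= `|x ord0 k| ^+ 2 by rewrite lerXn2r ?nnegrE//; lra.
  by apply: le_trans; rewrite sqrrD expr1n mul1r; have := sqr_ge0 (dl / 2); lra.
have N0 (t : R) : T <= t -> II (fun x => u x * psi (x + t *: v)) = 0.
  move=> tT; apply: II_ae0 => //; first exact: cls_shift.
  apply: filterS h => x h px; apply: h.
  have xM : `|x + t *: v| <= M by rewrite leNgt; apply: contraNN px => /hM ->.
  have := le_trans (coord_le_norm _ i) xM; rewrite mxE [X in _ + X]mxE vE eqxx mulr1n.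
  by rewrite ler_norml => /andP[+ _]; move: tT; rewrite /T; lra.
move=> /(_ d2) h2.
have T0 : - (dl / 2) < T < T + 2 by rewrite /T; apply/andP; split; lra.
have T1 : - (dl / 2) < T + 1 < T + 2 by rewrite /T; apply/andP; split; lra.
have T2 : - (dl / 2) < 0 < T + 2 by rewrite /T; apply/andP; split; lra.
have eT := N0 T (lexx T).
have eT1 : II (fun x => u x * psi (x + (T + 1) *: v)) = 0 by apply: N0; rewrite lerDl.
have := h2 T T0 _ T1; rewrite eT eT1 add0r addrAC subrr add0r mulr1 => N1.
have := h2 T T0 _ T2; rewrite eT -N1 mul0r addr0 => <-.
by congr II; apply/funext => x; rewrite scale0r addr0.
Qed.

Lemma path_dilation_pow phi M (k : nat) (t : R) : cls phi -> bsup M phi -> 0 < t ->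
  is_derive t 1 (fun t => t ^+ k * II (fun x => u x * phi (t *: x)))
    (t^-1 * (t ^+ k * II (fun x => u x * eulk k%:R phi (t *: x)))).
Proof.
move=> cp hM t0; have t0' : t != 0 by rewrite gt_eqF.
have bd chi : cls chi -> bsup M chi -> itg (fun x => u x * chi (t *: x)).
  move=> cc hc; apply: (@itg_test _ _ _ _ (M / t)) => //.
    by apply/cls_cont/cls_dilation.
  move=> x; rewrite ltr_pdivrMr// => h; apply: hc.
  by rewrite normrZ gtr0_norm// mulrC.
have -> : II (fun x => u x * eulk k%:R phi (t *: x)) =
    II (fun x => u x * eul phi (t *: x)) + k%:R * II (fun x => u x * phi (t *: x)).
  rewrite -IIZ; last exact: bd. rewrite -IID; last 2 first.
  - by apply: bd; [exact: cls_eul|exact: eul_bsup].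
  - by apply: itgZ; exact: bd.
  by congr II; apply/funext => x; rewrite /eulk; ring.
have dS := path_dilation lu cp hM t0.
have dX : is_derive t 1 (fun t : R => t ^+ k) (k%:R * (t^-1 * t ^+ k)).
  apply: DeriveDef; first exact: exprn_derivable.
  rewrite exp_derive /GRing.scale/= mulr1; case: k => [|k]; first by rewrite mulr0n !mul0r.
  by rewrite /= exprS mulKf.
have h := is_deriveM dX dS.
set S1 := II (fun x => u x * eul phi (t *: x)) in h *.
set S0 := II (fun x => u x * phi (t *: x)) in h *.
rewrite (_ : t^-1 * (t ^+ k * (S1 + k%:R * S0)) =
  t ^+ k *: (t^-1 * S1) + S0 *: (k%:R * (t^-1 * t ^+ k))); first exact: h.
by rewrite /GRing.scale/=; ring.
Qed.

(** Translations give vanishing for |x_k| > 1 for every k; the side -x_k0 > 1 is reached only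
    through a second coordinate k1. For the region between sphere and cube, dilations with t < 1
    push the support outward: t^(d+1) times the pairing of u with psi(t x) is affine in t and
    vanishes for small t, hence at t = 1. *)
Lemma exterior_null (k0 k1 : 'I_d) : k0 != k1 ->
  {ae mu, forall x, 2 < x ord0 k0 -> u x = 0} -> {ae mu, forall x, 1 < sq x -> u x = 0}.
Proof.
move=> k01 h0.
have n1 : `|1 : R| = 1 by rewrite normr1.
have nN1 : `|-1 : R| = 1 by rewrite normrN1.
have other k : k0 != k -> forall s : R, `|s| = 1 -> {ae mu, forall x, 1 < s * x ord0 k -> u x = 0}.
  by move=> kk s s1; apply: (translate_null (i := k0)) => //; rewrite kk.
have first1 : {ae mu, forall x, 1 < 1 * x ord0 k0 -> u x = 0}.
  by apply: (translate_null (i := k0)); rewrite ?eqxx ?orbT.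
have firstN : {ae mu, forall x, 1 < -1 * x ord0 k0 -> u x = 0}.
  apply: (translate_null (i := k1)) => //; first by rewrite eq_sym k01.
  apply: filterS (other k1 k01 1 n1) => x hx x2; apply: hx; rewrite mul1r; lra.
have coords : {ae mu, forall x, forall k : 'I_d, 1 < `|x ord0 k| -> u x = 0}.
  apply: filter_forall => k.
  have [hp hn] : {ae mu, forall x, 1 < 1 * x ord0 k -> u x = 0} /\
      {ae mu, forall x, 1 < -1 * x ord0 k -> u x = 0}.
    by have [<-//|kk] := eqVneq k0 k; split; exact: other.
  apply: filterS2 hp hn => x hp hn; have [xk|xk] := leP 0 (x ord0 k).
    by rewrite ger0_norm// => h; apply: hp; rewrite mul1r.
  by rewrite ltr0_norm// => h; apply: hn; rewrite mulN1r.
have cube : {ae mu, forall x, 1 < `|x| -> u x = 0}.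
  apply: filterS coords => x h x1; apply: contrapT => ux.
  have : `|x| <= 1.
    apply/rV_norm_leP; split=> // k; rewrite leNgt; apply/negP => /h; exact: ux.
  by rewrite leNgt x1.
pose rho (x : rV) := sq x - 1.
have cr : cls rho by apply: clsB; [exact: cls_sq|exact: cls_cst].
suff : {ae mu, forall x, 0 < rho x -> u x = 0}.
  by apply: filterS => x hx x1; apply: hx; rewrite /rho subr_gt0.
apply: fundamental_lemma => // psi [cp [M hM] [dl dl0 hdl]].
(* Chosen so that (1 + 3 eps) (1 + dl / 2) <= 1 + dl: for t < 1 + eps the dilated support still
   satisfies |x|^2 >= 1 + dl / 2. *)
pose eps := dl / (6 * (1 + dl)).
have dl1 : 0 < 6 * (1 + dl) by lra.
have eps0 : 0 < eps by rewrite divr_gt0.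
have eps1 : eps * (6 * (1 + dl)) = dl by rewrite /eps divfK// gt_eqF.
have epsd : eps <= 1 by rewrite /eps ler_pdivrMr//; lra.
pose chi := eulk (d.+1)%:R psi.
have cchi : cls chi by exact: cls_eulk.
have hchi : bsup M chi by exact: eulk_bsup.
have := @derive2_itv R (fun t => t ^+ d.+1 * II (fun x => u x * psi (t *: x)))
  (fun t => t ^+ d * II (fun x => u x * chi (t *: x))) 0 (1 + eps).
have d1 (t : R) : 0 < t < 1 + eps -> is_derive t 1
    (fun t => t ^+ d.+1 * II (fun x => u x * psi (t *: x)))
    (t ^+ d * II (fun x => u x * chi (t *: x))).
  move=> /andP[t0 _]; have := @path_dilation_pow psi M d.+1 t cp hM t0.
  by rewrite exprS !mulrA mulVf ?gt_eqF// mul1r.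
have d2 (t : R) : 0 < t < 1 + eps -> is_derive t 1
    (fun t => t ^+ d * II (fun x => u x * chi (t *: x))) 0.
  move=> /andP[t0 t1]; have := @path_dilation_pow chi M d t cchi hchi t0.
  suff -> : II (fun x => u x * eulk d%:R chi (t *: x)) = 0 by rewrite !mulr0.
  have ct : cls (fun y => psi (t *: y)) by exact: cls_dilation.
  transitivity (pairing u (fun y => psi (t *: y) *: rank1 y)).
    rewrite pairingE; congr II; apply/funext => x; rewrite div2_rank1//; congr (_ * _).
    have dd : d%:R + 1 = d.+1%:R :> R by rewrite natr1.
    by rewrite dd (eulk_dilation _ t cp) (eulk_dilation _ t cchi).
  apply: outer.
    apply: (tfield_rank1_id (M := M / t)) => // x; rewrite ltr_pdivrMr// => h; apply: hM.
    by rewrite normrZ gtr0_norm// mulrC.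
  exists (dl / 2); first by rewrite divr_gt0.
  move=> x; rewrite scaler_eq0 negb_or => /andP[/hdl + _]; rewrite /rho sq_scale => hx.
  have t2 : t ^+ 2 <= 1 + 3 * eps.
    have : t ^+ 2 <= (1 + eps) ^+ 2 by rewrite lerXn2r ?nnegrE; lra.
    by move=> /le_trans; apply; rewrite sqrrD expr1n mul1r; nra.
  rewrite leNgt; apply/negP => hs.
  have : t ^+ 2 * sq x <= (1 + 3 * eps) * (1 + dl / 2) by rewrite ler_pM ?sqr_ge0 ?sq_ge0//; lra.
  have : t ^+ 2 * sq x < (1 + 3 * eps) * (1 + dl / 2).
    apply: le_lt_trans (_ : (1 + 3 * eps) * sq x < _); first by rewrite ler_wpM2r ?sq_ge0.
    by rewrite ltr_pM2l//; lra.
  nra.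
move=> /(_ d1 d2) h2.
(* On the cube |x|^2 <= d, so |t x|^2 <= 1 and psi(t x) = 0: the dilated support lies where u is
   already known to vanish. *)
have N0 (t : R) : 0 < t -> t <= d%:R^-1 -> t ^+ d.+1 * II (fun x => u x * psi (t *: x)) = 0.
  move=> t0 td; rewrite (_ : II _ = 0) ?mulr0//; apply: II_ae0 => //; first exact: cls_dilation.
  apply: filterS cube => x hx /hdl; rewrite /rho sq_scale => hs; apply: hx.
  rewrite ltNge; apply/negP => x1.
  have x2 : `|x| ^+ 2 <= 1 by rewrite exprn_ile1.
  have sd : sq x <= d%:R by rewrite (le_trans (sq_le_norm x))// ler_piMr.
  have : t ^+ 2 * sq x <= 1.
    have d0 : 0 < d%:R :> R by rewrite ltr0n.
    have t1 : t <= 1 by rewrite (le_trans td)// invf_le1// ler1n.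
    have td1 : t * d%:R <= 1 by rewrite -ler_pdivlMr// div1r.
    rewrite (le_trans (ler_wpM2l (sqr_ge0 t) sd))// expr2 -mulrA mulr_ile1 ?mulr_ge0// ltW//.
  by move: hs; lra.
have d0 : 0 < d%:R^-1 :> R by rewrite invr_gt0 ltr0n.
have dle : d%:R^-1 <= 1 :> R by rewrite invf_le1 ?ltr0n// ler1n.
move: d0 dle N0; move: (d%:R^-1 : R) => D d0 dle N0.
pose t1 : R := D; pose t2 : R := D / 2.
have i1 : 0 < t1 < 1 + eps by rewrite /t1; apply/andP; split; lra.
have i2 : 0 < t2 < 1 + eps by rewrite /t2; apply/andP; split; lra.
have i3 : (0 : R) < 1 < 1 + eps by rewrite ltr01 ltrDl.
have := h2 t1 i1 t2 i2; rewrite !N0//; [|by rewrite /t2; lra..].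
rewrite add0r => /esym/eqP; rewrite mulf_eq0 subr_eq0 => /orP[/eqP N1|/eqP]; last first.
  by rewrite /t1 /t2; lra.
have := h2 t1 i1 1 i3; rewrite N1 mul0r addr0 (N0 t1 d0 (lexx _)) expr1n mul1r => <-.
by congr II; apply/funext => x; rewrite scale1r.
Qed.

End exterior.

(** * Homogeneity inside the ball *)

Section interior.
Context {R : realType} {n : nat}.
Local Notation d := n.+1.
Local Notation rV := 'rV[R]_d.
Local Notation mu := (@lebesgue_measure_rV R d).
Implicit Types (f g phi psi w rho : rV -> R) (x v b z : rV) (M s t dl : R).

Lemma div2_column_field phi k x : cls phi ->
  div2 (fun y => phi y *: column_field k y) x = partial k (eulk d%:R phi) x.
Proof.
move=> cp; have cj j : cls (fun y : rV => phi y * y ord0 j).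
  by apply: clsM => //; exact: cls_coord.
have -> : eulk d%:R phi = fun y => \sum_j partial j (fun z => phi z * z ord0 j) y.
  by apply/funext => y; rewrite divergence_coord.
rewrite partial_sumE; last by move=> j; exact: cls_partial.
rewrite div2E (bigD1 k)//= [X in _ + X]big1 => [|i ik].
  rewrite addr0; apply: eq_bigr => j _; congr (partial k (partial j _) x).
  by apply/funext => y; rewrite !mxE eqxx mul1r.
apply: big1 => j _; rewrite (_ : (fun y : rV => _) = (fun=> 0)) ?partial_cst ?partial_cst//.
by apply/funext => y; rewrite !mxE (negbTE ik) mul0r mulr0.
Qed.

(* Convexity of [sq] along the (slightly extended) segment, then
   (p + q)^2 <= (1 + th) p^2 + (1 + 1/th) q^2 for the neighbourhood. *)
Lemma ball_buffer (del : R) : 0 < del -> del <= 1 -> exists2 eta : R, 0 < eta &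
  forall z z', 0 < 1 - del - sq z -> 0 < 1 - del - sq z' -> exists2 eps : R, 0 < eps &
    forall t (y : rV), - eps < t < 1 + eps -> `|y - (z + t *: (z' - z))| <= eta ->
      del / 4 <= 1 - sq y.
Proof.
move=> del0 del1; have th0 : 0 < del / 4 by lra.
have d0 : 0 < d%:R :> R by rewrite ltr0n.
pose A := (1 + (del / 4)^-1) * d%:R.
have A1 : 1 <= A.
  have h1 : 1 <= d%:R :> R by rewrite ler1n.
  have h2 : 1 <= 1 + (del / 4)^-1 by rewrite lerDl invr_ge0 ltW.
  by rewrite /A -[leLHS]mulr1 ler_pM.
have A0 : 0 < A := lt_le_trans ltr01 A1.
pose eta := del / 4 / A; have eta0 : 0 < eta by rewrite divr_gt0.
have etaA : A * eta = del / 4 by rewrite /eta mulrC divfK// gt_eqF.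
have eta1 : eta <= 1 by nra.
have sqD (p q : rV) : sq (p + q) <= (1 + del / 4) * sq p + (1 + (del / 4)^-1) * sq q.
  rewrite /sq !mulr_sumr -big_split/=; apply: ler_sum => i _; rewrite mxE.
  move: (p ord0 i) (q ord0 i) => a b; set th := del / 4 in th0 *.
  have h : 0 <= th * (a - th^-1 * b) ^+ 2 by rewrite mulr_ge0 ?sqr_ge0// ltW.
  have e : (1 + th) * a ^+ 2 + (1 + th^-1) * b ^+ 2 - (a + b) ^+ 2 = th * (a - th^-1 * b) ^+ 2.
    by field; rewrite gt_eqF.
  by rewrite -subr_ge0 e.
exists eta => // z z' hz hz'; pose D := sq (z' - z).
have D0 : 0 <= D := sq_ge0 _.
pose eps := del / 4 / (1 + 2 * D); have D1 : 0 < 1 + 2 * D by lra.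
have eps0 : 0 < eps by rewrite divr_gt0.
have epsD : eps * (1 + 2 * D) = del / 4 by rewrite /eps divfK// gt_eqF.
have eps1 : eps <= 1 by nra.
exists eps => // t y /andP[t1 t2] hy.
pose p := z + t *: (z' - z).
have pE : sq p = (1 - t) * sq z + t * sq z' - t * (1 - t) * D.
  rewrite /sq /D /p /sq !mulr_sumr -big_split/= -sumrB; apply: eq_bigr => i _.
  by rewrite !mxE; ring.
have sp : sq p <= 1 - del + del / 4.
  have z0 := sq_ge0 z; have z'0 := sq_ge0 z'.
  have h1 : (1 - t) * sq z + t * sq z' <= (1 - del) + eps.
    have [t0|t0] := leP 0 t; last by nra.
    by have [t3|t3] := leP t 1; nra.
  have h2 : - (t * (1 - t)) <= 2 * eps by nra.
  have h3 : - (t * (1 - t)) * D <= 2 * eps * D by rewrite ler_wpM2r.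
  by rewrite pE; move: epsD h1 h3; rewrite mulrDr; lra.
have sy : sq (y - p) <= d%:R * eta.
  apply: le_trans (sq_le_norm _) _; apply: ler_wpM2l; first exact: ltW.
  rewrite expr2 -[leRHS]mulr1; apply: ler_pM => //; exact: le_trans hy eta1.
have := sqD p (y - p); rewrite addrC subrK => h.
have h4 : (1 + (del / 4)^-1) * sq (y - p) <= A * eta.
  by rewrite /A -mulrA; apply: ler_wpM2l => //; rewrite addr_ge0// invr_ge0 ltW.
rewrite etaA in h4.
have h5 : (1 + del / 4) * sq p <= (1 + del / 4) * (1 - del + del / 4).
  by rewrite ler_wpM2l//; lra.
nra.
Qed.

Variable u : rV -> R.
Hypothesis lu : locint u.
Hypothesis column : forall k phi dl, 0 < dl -> cls phi ->
  (forall x, phi x != 0 -> sq x <= 1 - dl) -> pairing u (fun x => phi x *: column_field k x) = 0.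

Lemma II_dilation s phi M : 0 < s -> cls phi -> bsup M phi ->
  II (fun x => u (s *: x) * phi x) = s^-1 ^+ d * II (fun x => u x * phi (s^-1 *: x)).
Proof.
move=> s0 cp hM; have s1 : 0 < s^-1 by rewrite invr_gt0.
have i1 : itg (fun x => u (s *: x) * phi x).
  apply: itg_test hM; last exact: cls_cont.
  have := locint_affn 0 s0 lu; congr locint; apply/funext => x.
  by rewrite /affn addr0.
rewrite (II_affn 0 s1 i1); congr (_ * _); congr II; apply/funext => x.
by rewrite /affn addr0 scalerA divff ?gt_eqF// scale1r.
Qed.

Definition homogeneity_defect s x := u (s *: x) - s * u x.

Lemma locint_defect s : 0 < s -> locint (homogeneity_defect s).
Proof.
move=> s0; rewrite (_ : homogeneity_defect s = fun x => u (affn s 0 x) + - s * u x); last first.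
  by apply/funext => x; rewrite /affn addr0 mulNr.
by apply: locintD; [exact: locint_affn|exact: locintZ].
Qed.

(** The double divergence of phi(t x) e_k x^T is a multiple of the derivative in t of K(t), which is
    t^(d+1) times the pairing of u with (partial_k phi)(t x). So K is constant, and K(1/s) = K(1) is
    the claim after a change of variables. *)
Lemma defect_gradient s phi k M dl : 0 < s -> s <= 1 -> 0 < dl -> cls phi -> bsup M phi ->
  (forall x, phi x != 0 -> sq x <= 1 - dl) ->
  II (fun x => homogeneity_defect s x * partial k phi x) = 0.
Proof.
move=> s0 s1 dl0 cp hM hs.
wlog dl1 : dl dl0 hs / dl <= 1.
  move=> /(_ (Num.min dl 1)); apply; rewrite ?lt_min ?dl0 ?ltr01//; last by rewrite ge_min lexx orbT.
  by move=> x /hs h; have : Num.min dl 1 <= dl; [rewrite ge_min lexx|move: h; lra].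
have cpk := cls_partial k cp; have hpk := partial_bsup k hM.
pose K t := t ^+ d.+1 * II (fun x => u x * partial k phi (t *: x)).
(* The interval contains 1 and 1/s in its interior; the bound t > 1 - dl / 4 keeps the support of
   phi(t x) in |x|^2 <= 1 - dl / 2. *)
have dK t : 1 - dl / 4 < t < s^-1 + 1 -> is_derive t 1 K 0.
  move=> /andP[t1 _]; have t0 : 0 < t by lra.
  have := path_dilation_pow lu d.+1 cpk hpk t0.
  suff -> : II (fun x => u x * eulk d.+1%:R (partial k phi) (t *: x)) = 0 by rewrite !mulr0.
  have dd : d.+1%:R = d%:R + 1 :> R by rewrite -natr1.
  rewrite dd -(partial_eulk k _ cp).
  have ce := cls_eulk d%:R cp.
  have ct : cls (fun y => phi (t *: y)) by exact: cls_dilation.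
  have := column k (dl := dl / 2) (divr_gt0 dl0 (ltr0n _ 2)) ct.
  have h2 x : phi (t *: x) != 0 -> sq x <= 1 - dl / 2.
    move=> /hs; rewrite sq_scale => h; rewrite leNgt; apply/negP => hx.
    have tt : (1 - dl / 4) ^+ 2 <= t ^+ 2 by rewrite lerXn2r ?nnegrE; lra.
    have t3 : 1 - dl / 2 <= t ^+ 2 by move: tt; nra.
    have : (1 - dl / 2) * sq x <= t ^+ 2 * sq x by rewrite ler_wpM2r ?sq_ge0.
    nra.
  move=> /(_ h2); rewrite pairingE => e0.
  suff -> : II (fun x => u x * partial k (eulk d%:R phi) (t *: x)) =
      t^-1 * II (fun x => u x * div2 (fun y => phi (t *: y) *: column_field k y) x).
    by rewrite e0 mulr0.
  have E x : div2 (fun y => phi (t *: y) *: column_field k y) x =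
      t * partial k (eulk d%:R phi) (t *: x).
    rewrite div2_column_field// (eulk_dilation _ t cp).
    have -> : (fun y => eulk d%:R phi (t *: y)) = (fun y => eulk d%:R phi (t *: y + 0)).
      by apply/funext => y; rewrite addr0.
    by rewrite partial_affn// addr0.
  have i1 : itg (fun x => u x * partial k (eulk d%:R phi) (t *: x)).
    apply: (@itg_test _ _ _ _ (M / t)) => //.
      by apply/cls_cont/cls_dilation/cls_partial.
    move=> x; rewrite ltr_pdivrMr// => h; apply: (partial_bsup k (eulk_bsup d%:R hM)).
    by rewrite normrZ gtr0_norm// mulrC.
  have -> : (fun x => u x * div2 (fun y => phi (t *: y) *: column_field k y) x) =
      (fun x => t * (u x * partial k (eulk d%:R phi) (t *: x))).
    by apply/funext => x; rewrite E; ring.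
  by rewrite IIZ// mulKf// gt_eqF.
have si : 1 <= s^-1 by rewrite invf_ge1.
have r1 : 1 - dl / 4 < 1 < s^-1 + 1 by apply/andP; split; lra.
have r2 : 1 - dl / 4 < s^-1 < s^-1 + 1 by apply/andP; split; lra.
have := derive0_itv dK r2 r1; rewrite /K expr1n mul1r => e.
have i1 : itg (fun x => u (s *: x) * partial k phi x).
  apply: itg_test hpk; last exact: cls_cont.
  have := locint_affn 0 s0 lu; congr locint; apply/funext => x.
  by rewrite /affn addr0.
have i2 : itg (fun x => u x * partial k phi x) by apply: itg_test hpk => //; exact: cls_cont.
rewrite (_ : (fun x => _) = (fun x => u (s *: x) * partial k phi x - s * (u x * partial k phi x)));
  last by apply/funext => x; rewrite /homogeneity_defect; ring.
rewrite IIB//; last exact: itgZ.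
rewrite IIZ// (II_dilation s0 cpk hpk); apply/eqP; rewrite subr_eq0; apply/eqP.
have e1 : (fun x => u x * partial k phi (1 *: x)) = (fun x => u x * partial k phi x).
  by apply/funext => x; rewrite scale1r.
by rewrite -e1 -e [s^-1 ^+ d.+1]exprS -mulrA mulVKf// gt_eqF.
Qed.

(** The weak gradient vanishes, so [weak_affine] applies with slope 0 on each smaller ball. The
    constant is identified as the mean against one fixed bump and so is the same for all these
    balls. The cocycle relation comes from u(s t x) - s t u(x) = [u(s t x) - s u(t x)] + s
    [u(t x) - t u(x)]. *)
Lemma defect_constant : exists kap : R -> R, forall s, 0 < s -> s < 1 ->
  {ae mu, forall x, sq x < 1 -> homogeneity_defect s x = kap s} /\
  forall t, 0 < t -> t < 1 -> kap (s * t) = kap s + s * kap t.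
Proof.
have d0 : 0 < d%:R :> R by rewrite ltr0n.
have d1 : 1 <= d%:R :> R by rewrite ler1n.
(* This radius in the maximum norm puts the bump inside |x|^2 <= 1/4, hence inside all the balls
   |x|^2 < 1 - del with del <= 1/2. *)
have r0 : 0 < (2 * d%:R)^-1 :> R by rewrite invr_gt0 mulr_gt0.
have [psi1 [c1 s1 I1 _]] := @centered_bump R n _ r0.
have supp1 x : psi1 x != 0 -> sq x <= 1 / 4.
  move=> px; have xr : `|x| <= (2 * d%:R)^-1 by rewrite leNgt; apply: contraNN px => /s1 ->.
  rewrite (le_trans (sq_le_norm x))//.
  have : `|x| ^+ 2 <= (2 * d%:R)^-1 ^+ 2.
    by apply: lerXn2r => //; rewrite nnegrE//; exact: ltW.
  rewrite -(ler_pM2l d0) => /le_trans; apply.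
  have -> : d%:R * (2 * d%:R)^-1 ^+ 2 = d%:R^-1 / 4 :> R by field; rewrite gt_eqF.
  by rewrite ler_pM2r ?invr_gt0// invf_le1.
pose kap s := II (fun x => homogeneity_defect s x * psi1 x).
have pc : continuous psi1 by exact: cls_cont.
have ip1 : itg psi1 by exact: itg_bsup pc s1.
have avg w (a : R) : locint w -> {ae mu, forall x, sq x <= 1 / 4 -> w x = a} ->
    II (fun x => w x * psi1 x) = a.
  move=> [mw _] h; rewrite -[RHS]mulr1 -I1 -IIZ//; apply: II_ae.
  - by apply: measurable_funM => //; exact: cls_meas.
  - by apply: measurable_funM => //; exact: cls_meas.
  - apply: filterS h => x hx; have [->|/supp1 /hx ->//] := eqVneq (psi1 x) 0.
    by rewrite !mulr0.
have key s : 0 < s -> s < 1 -> {ae mu, forall x, sq x < 1 -> homogeneity_defect s x = kap s}.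
  move=> s0 sl1; have lw := locint_defect s0.
  have local del : 0 < del -> del <= 1 / 2 ->
      {ae mu, forall x, 0 < 1 - del - sq x -> homogeneity_defect s x = kap s}.
    move=> del0 del1; have del2 : del <= 1 by lra.
    have [eta eta0 buf] := ball_buffer del0 del2.
    pose rho (x : rV) := 1 - sq x; pose rho' (x : rV) := 1 - del - sq x.
    have cr' : cls rho' by apply: clsB; [exact: cls_cst|exact: cls_sq].
    have r00 : 0 < rho' 0.
      rewrite /rho' /sq big1 ?subr0; first by lra.
      by move=> i _; rewrite mxE expr0n.
    have del4 : 0 < del / 4 by rewrite divr_gt0.
    have weak phi v : test_in rho phi ->
        II (fun x => homogeneity_defect s x * dirg v (dirg v phi) x) = 0.
      move=> [cp [M hM] [dl dl0 hdl]].
      rewrite (II_dirg v lw (cls_dirg v cp) (dirg_bsup v hM)) big1// => i _.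
      rewrite (_ : II _ = 0) ?mulr0//.
      have e : partial i (dirg v phi) = dirg v (partial i phi).
        apply/funext => x; rewrite /dirg /gradf partial_sumE; last first.
          by move=> j; apply: clsM; [exact: cls_cst|exact: cls_partial].
        apply: eq_bigr => j _; rewrite (partialZE _ i (cls_partial j cp)).
        by rewrite (partialC i j cp).
      rewrite e (II_dirg v lw (cls_partial i cp) (partial_bsup i hM)) big1// => j _.
      rewrite (partialC j i cp) (_ : II _ = 0) ?mulr0//.
      have cpj := cls_partial j cp.
      apply: (defect_gradient (dl := dl) i s0 (ltW sl1) dl0 cpj (partial_bsup j hM)) => x.
      apply: contraNT; rewrite -ltNge => hx.
      rewrite (@partial_eq_on _ _ [set x | 1 - dl < sq x] phi (fun=> 0)) ?partial_cst ?inE//.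
        by apply: open_cls_gt; exact: cls_sq.
      move=> y; rewrite inE /= => hy; apply/eqP; apply: contraLR hy => /hdl.
      by rewrite /rho -leNgt; lra.
    have [psi [cpsi [M hM] [dl dl0 hdl]] ae] := weak_affine lw cr' eta0 del4 weak buf r00.
    have ae' : {ae mu, forall x, 0 < rho' x ->
        homogeneity_defect s x = II (fun y => homogeneity_defect s y * psi y)}.
      apply: filterS ae => x h /h ->; rewrite big1 ?subr0// => i _.
      rewrite (defect_gradient (dl := dl) i s0 (ltW sl1) dl0 cpsi hM) ?mulr0// => y /hdl.
      by rewrite /rho; lra.
    have -> : kap s = II (fun y => homogeneity_defect s y * psi y).
      apply: avg => //; apply: filterS ae' => x h hx; apply: h.
      by rewrite /rho'; lra.
    exact: ae'.
  pose rho (x : rV) := 1 - sq x.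
  have cr : cls rho by apply: clsB; [exact: cls_cst|exact: cls_sq].
  have lwk : locint (fun x => homogeneity_defect s x + - kap s).
    by apply: locintD => //; exact: locint_cst.
  suff : {ae mu, forall x, 0 < rho x -> homogeneity_defect s x + - kap s = 0}.
    apply: filterS => x h x1; apply/eqP; rewrite -subr_eq0; apply/eqP; apply: h.
    by rewrite /rho subr_gt0.
  apply: fundamental_lemma => // psi [cp [M hM] [dl dl0 hdl]].
  apply: II_ae0 => //; pose del := Num.min (dl / 2) (1 / 2).
  have del0 : 0 < del by rewrite lt_min; apply/andP; split; lra.
  have dell : del <= dl / 2 by rewrite /del ge_min lexx.
  have delh : del <= 1 / 2 by rewrite /del ge_min lexx orbT.
  apply: filterS (local del del0 delh) => x h /hdl; rewrite /rho => hx.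
  by rewrite h ?subrr//; lra.
exists kap => s s0 sl1; split; first exact: key.
move=> t t0 tl1; have st0 : 0 < s * t by rewrite mulr_gt0.
have lst : locint (fun x => homogeneity_defect s (affn t 0 x) + s * homogeneity_defect t x).
  apply: locintD; last by apply: locintZ; exact: locint_defect.
  by apply: locint_affn => //; exact: locint_defect.
rewrite -(avg _ (kap s + s * kap t) lst).
  congr II; apply/funext => x; congr (_ * _).
  by rewrite /homogeneity_defect /affn addr0 scalerA; ring.
apply: filterS2 (ae_affn 0 t0 (key s s0 sl1)) (key t t0 tl1) => x h1 h2 hx.
rewrite h1 ?h2//; first by lra.
rewrite /affn addr0 sq_scale (@le_lt_trans _ _ (sq x))//; last by lra.
by rewrite ler_piMl ?sq_ge0// expr_le1// ltW.
Qed.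

(** kap(s t) is symmetric in s and t, so kap(s) + s kap(t) = kap(t) + t kap(s); t = 1/2 gives kap(s)
    = 2 kap(1/2) (1 - s). *)
Lemma defect_linear : exists kap : R, forall s, 0 < s -> s < 1 ->
  {ae mu, forall x, sq x < 1 -> homogeneity_defect s x = kap * (1 - s)}.
Proof.
have [kap hk] := defect_constant; exists (2 * kap 2^-1) => s s0 s1.
have h0 : 0 < 2^-1 :> R by rewrite invr_gt0.
have h1 : 2^-1 < 1 :> R by rewrite invf_lt1// ltr1n.
have [hae hm] := hk s s0 s1; have [_ hm'] := hk _ h0 h1.
have e1 := hm _ h0 h1; have e2 := hm' _ s0 s1; rewrite mulrC e2 in e1.
have <- : kap s = 2 * kap 2^-1 * (1 - s) by move: e1; lra.
exact: hae.
Qed.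

End interior.

(** * Uniqueness *)

Section shell_estimate.
Context {R : realType} {n : nat}.
Local Notation d := n.+1.
Local Notation rV := 'rV[R]_d.
Local Notation mu := (@lebesgue_measure_rV R d).
Implicit Types (f g phi psi w rho : rV -> R) (x v b z : rV) (M s t dl : R).

Lemma MVT_derive (f df : R -> R) (a b : R) : a < b -> (forall x : R, is_derive x 1 f (df x)) ->
  exists2 c, a < c < b & f b - f a = df c * (b - a).
Proof.
move=> ab h.
have hc : {within `[a, b], continuous f}.
  apply: continuous_subspaceT => y; apply: differentiable_continuous.
  by apply/derivable1_diffP; exact: ex_derive.
have [c cab e] := MVT ab (fun y _ => h y) hc.
by exists c => //; move: cab; rewrite in_itv.
Qed.

Lemma bernoulli_le (dl : R) (k : nat) : 0 <= dl -> dl <= 1 -> 1 - k%:R * dl <= (1 - dl) ^+ k.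
Proof.
move=> dl0 dl1; elim: k => [|k IH]; first by rewrite mul0r subr0 expr0.
have k0 : 0 <= k%:R :> R by [].
have h : (1 - dl) * (1 - k%:R * dl) <= (1 - dl) * (1 - dl) ^+ k by rewrite ler_wpM2l// subr_ge0.
rewrite exprS -natr1; apply: le_trans h; have := mulr_ge0 k0 (mulr_ge0 dl0 dl0); nra.
Qed.

Lemma sq_addZ_delta (y : rV) (a : R) k :
  sq (y + a *: delta_mx ord0 k) = sq y + 2 * a * y ord0 k + a ^+ 2.
Proof.
rewrite /sq -addrA -(sum_delta (fun i => 2 * a * y ord0 i + a ^+ 2) k) -big_split/=.
apply: eq_bigr => i _; rewrite !mxE eqxx/= [k == i]eq_sym.
by case: (i == k); rewrite /= ?mulr1n ?mulr0n; ring.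
Qed.

Lemma norm_le1_sq x : sq x <= 1 -> `|x| <= 1.
Proof.
move=> h; have := le_trans (norm_le_sq x) h.
by rewrite expr_le1.
Qed.

Lemma itg_set w (A : set rV) M : locint w -> measurable A -> (forall x, A x -> `|x| <= M) ->
  itg (fun x => `|w x * \1_A x|).
Proof.
move=> lw mA hA; apply: itg_norm; apply: (@itg_locint _ _ _ _ M 1) => //.
- by move=> x; have /andP[? ?] := indic_itv A x; rewrite ger0_norm.
- by move=> x xM; rewrite indicE memNset// => /hA; rewrite leNgt xM.
Qed.

Lemma II_set_le w (A : set rV) M K : locint w -> measurable A -> (forall x, A x -> `|x| <= M) ->
  (\int[mu]_(x in A) `|w x|%:E <= K%:E)%E -> II (fun x => `|w x * \1_A x|) <= K.
Proof.
move=> lw mA hA h; have iw := itg_set lw mA hA.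
rewrite -lee_fin EFin_II//; apply: le_trans h; rewrite [leRHS]integral_mkcond.
rewrite le_eqVlt; apply/orP; left; apply/eqP; apply: eq_integral => x _.
rewrite /patch indicE; case: ifPn => xA; first by rewrite mulr1.
by rewrite mulr0 normr0.
Qed.

Lemma measurable_sq_lt (r : R) : measurable [set x : rV | sq x < r].
Proof. by apply: open_measurable_rV; apply: open_cls_lt; exact: cls_sq. Qed.

Lemma measurable_sq_gt (r : R) : measurable [set x : rV | r < sq x].
Proof. by apply: open_measurable_rV; apply: open_cls_gt; exact: cls_sq. Qed.

Variable u : rV -> R.
Hypothesis lu : locint u.
Hypothesis bound : exists2 C, 0 < C & forall B G, 0 < B -> tfield G ->
  (forall x i j, `|G x i j| <= B) -> `|pairing u G| <= C * B.
Hypothesis null : {ae mu, forall x, 1 < sq x -> u x = 0}.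

(* Moving a test function supported in the thin shell by [h] in the direction
   of a large coordinate pushes it out of the ball, where [u] vanishes, and the
   second derivative of the resulting path is bounded. *)
Lemma shell_sector : exists2 C, 0 <= C & forall k s dl, `|s| = 1 -> 0 < dl -> dl <= 1 / 8 ->
  II (fun x => `|u x * \1_[set x | 1 - 4 * dl < sq x < 1 /\ (4 * d%:R)^-1 < s * x ord0 k] x|)
    <= C * dl ^+ 2.
Proof.
have [C C0 hC] := bound; exists (2 * C * (8 * d%:R) ^+ 2) => [|k s dl s1 dl0 dl8].
  by rewrite !mulr_ge0 ?sqr_ge0// ltW.
have d0 : 0 < d%:R :> R by rewrite ltr0n.
set c := (4 * d%:R)^-1; have c0 : 0 < c by rewrite invr_gt0 mulr_gt0.
(* With s x_k > c, a move by h increases |x|^2 by more than 2 h c = 4 dl, the width of the shell in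
   |x|^2. *)
pose h := 8 * d%:R * dl; have h0 : 0 < h by rewrite !mulr_gt0.
have hc : h * c = 2 * dl by rewrite /h /c; field; rewrite gt_eqF.
pose rho x := e0 (sq x - (1 - 4 * dl)) * e0 (1 - sq x) * e0 (s * x ord0 k - c).
have cr : cls rho.
  apply: clsM; first apply: clsM; apply: cls_e0; apply: clsB;
    try (exact: cls_cst); try exact: cls_sq.
  by apply: clsM; [exact: cls_cst|exact: cls_coord].
have rhoE x : (0 < rho x) <-> (1 - 4 * dl < sq x < 1 /\ c < s * x ord0 k).
  rewrite /rho; split=> [|[/andP[h1 h2] h3]]; last by rewrite !mulr_gt0 ?e0_gt0 ?subr_gt0.
  move=> hr; have [n1 n2 n3] : [/\ e0 (sq x - (1 - 4 * dl)) != 0, e0 (1 - sq x) != 0 &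
      e0 (s * x ord0 k - c) != 0].
    by split; apply: contraTN hr => /eqP ->; rewrite ?(mul0r, mulr0) ltxx.
  have P (r : R) : e0 r != 0 -> 0 < r.
    by move=> hn; rewrite -e0_gt0 lt_def hn e0_ge0.
  by move: (P _ n1) (P _ n2) (P _ n3); rewrite !subr_gt0 => -> -> ->.
set A := [set x | _]; have AE : A = [set x | 0 < rho x].
  by apply/seteqP; split=> x /=; rewrite rhoE.
have mA : measurable A by rewrite AE; exact: cls_pos_measurable.
have hA x : A x -> `|x| <= 1 by move=> [/andP[_ h2] _]; apply: norm_le1_sq; exact: ltW.
apply: (II_set_le lu mA hA); rewrite AE; apply: L1_dual => // psi [cp [M hM] [dl' dl'0 hdl]] p1.
pose v : rV := - (s *: delta_mx ord0 k).
pose N t := II (fun x => u x * psi (x + t *: v)).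
pose N1 t := II (fun x => u x * dirg v psi (x + t *: v)).
pose N2 t := II (fun x => u x * dirg v (dirg v psi) (x + t *: v)).
have dN (t : R) : is_derive t 1 N (N1 t) by exact: path_shift lu cp hM.
have dN1 (t : R) : is_derive t 1 N1 (N2 t).
  exact: path_shift lu (cls_dirg v cp) (dirg_bsup v hM).
have N2le t : `|N2 t| <= C.
  have cs : cls (fun y => psi (y + t *: v)) by exact: cls_shift.
  have := pairing_rank1_cst u v cs.
  rewrite (dirg_shift v (t *: v) cp) (dirg_shift v (t *: v) (cls_dirg v cp)) /N2 => <-.
  rewrite -[leRHS]mulr1; apply: hC => //.
    by apply: (tfield_rank1 (M := M + `|t *: v|)) => //; exact: bsup_shift.
  move=> x i j; rewrite mxE rank1E normrM -[leRHS]mulr1 ler_pM// normrM -[leRHS]mulr1.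
  have vle l : `|v ord0 l| <= 1.
    rewrite !mxE normrN normrM s1 mul1r eqxx/=.
    by case: (l == k); rewrite ?normr1 ?normr0.
  by rewrite ler_pM.
have N0 t : h <= t -> N t = 0.
  move=> ht; apply: II_ae0 => //; first exact: cls_shift.
  apply: filterS null => x hx px; apply: hx.
  have /rhoE[/andP[h1 _] h3] := lt_le_trans dl'0 (hdl _ px).
  set y := x + t *: v in h1 h3.
  have -> : x = y + (t * s) *: delta_mx ord0 k.
    by rewrite /y /v scalerN scalerA subrK.
  have tt : h * c <= t * (s * y ord0 k).
    by rewrite ler_pM// ltW.
  rewrite sq_addZ_delta; have := sqr_ge0 (t * s); move: tt; rewrite hc mulrA => tt.
  by rewrite -(mulrA 2); lra.
(* N vanishes from h on, so N' has a zero in (h, 2 h); with |N''| <= C this gives |N(0)| <= C * 2 h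
   * h. *)
have hh : h < 2 * h by lra.
have [x1 /andP[x11 x12] e1] := MVT_derive hh dN.
have [x2 /andP[x21 x22] e2] := MVT_derive h0 dN.
have x21' : x2 < x1 := lt_trans x22 x11.
have [x3 _ e3] := MVT_derive x21' dN1.
have N1x1 : N1 x1 = 0.
  move: e1; rewrite (N0 _ (ltW hh)) (N0 h (lexx _)) subrr => /esym/eqP.
  by rewrite mulf_eq0 subr_eq0 (gt_eqF hh) orbF => /eqP.
have -> : II (fun x => u x * psi x) = N 0.
  by congr II; apply/funext => x; rewrite scale0r addr0.
have NE : N 0 = N2 x3 * ((x1 - x2) * h).
  move: e2 e3; rewrite (N0 h (lexx _)) N1x1 => e2 e3.
  have -> : N 0 = - (N1 x2 * (h - 0)) by rewrite -e2; ring.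
  have -> : N1 x2 = - (N2 x3 * (x1 - x2)) by rewrite -e3; ring.
  ring.
rewrite (le_trans (ler_norm _))// NE normrM.
have -> : 2 * C * (8 * d%:R) ^+ 2 * dl ^+ 2 = C * (2 * h * h) by rewrite /h; ring.
apply: ler_pM => //; rewrite ger0_norm; last first.
  by rewrite mulr_ge0 ?subr_ge0// ltW.
by rewrite ler_pM2r// lerBlDr (le_trans (ltW x12))// lerDl ltW.
Qed.

(** The 2 d sectors, one for each coordinate and sign, cover the shell. *)
Lemma shell_bound : exists2 C, 0 <= C & forall dl, 0 < dl -> dl <= 1 / 8 ->
  II (fun x => `|u x * \1_[set x | 1 - 4 * dl < sq x < 1] x|) <= C * dl ^+ 2.
Proof.
have [C C0 hC] := shell_sector; exists (d%:R * (2 * C)) => [|dl dl0 dl8].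
  by rewrite !mulr_ge0.
have d0 : 0 < d%:R :> R by rewrite ltr0n.
have d1 : 1 <= d%:R :> R by rewrite ler1n.
set c := (4 * d%:R)^-1 in hC; have c0 : 0 < c by rewrite invr_gt0 mulr_gt0.
pose A k (s : R) := [set x : rV | 1 - 4 * dl < sq x < 1 /\ c < s * x ord0 k].
have hA k s x : A k s x -> `|x| <= 1.
  by move=> [/andP[_ h2] _]; apply: norm_le1_sq; exact: ltW.
have mB : measurable [set x : rV | 1 - 4 * dl < sq x < 1].
  rewrite (_ : mkset _ = [set x | 1 - 4 * dl < sq x] `&` [set x | sq x < 1]).
    by apply: measurableI; [exact: measurable_sq_gt|exact: measurable_sq_lt].
  by apply/seteqP; split=> x /= => [/andP[]|[-> ->]].
have mA k s : measurable (A k s).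
  rewrite (_ : A k s = [set x : rV | 1 - 4 * dl < sq x < 1] `&` [set x | c < s * x ord0 k]) //.
  apply: measurableI => //; apply: open_measurable_rV; apply: open_cls_gt.
  by apply: clsM; [exact: cls_cst|exact: cls_coord].
have iA k s := itg_set lu (mA k s) (@hA k s).
have hB x : [set x : rV | 1 - 4 * dl < sq x < 1] x -> `|x| <= 1.
  by move=> /andP[_ h2]; apply: norm_le1_sq; exact: ltW.
have iB := itg_set lu mB hB.
pose S x := \sum_k (`|u x * \1_(A k 1) x| + `|u x * \1_(A k (-1)) x|).
have iS : itg S by apply: itg_sum => k; exact: itgD.
apply: (@le_trans _ _ (II S)); last first.
  rewrite /S II_sum; last by move=> k; exact: itgD.
  apply: (@le_trans _ _ (\sum_(k < d) (2 * C * dl ^+ 2))).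
    apply: ler_sum => k _; rewrite IID//.
    have -> : 2 * C * dl ^+ 2 = C * dl ^+ 2 + C * dl ^+ 2 by ring.
    by apply: lerD; apply: hC => //; rewrite ?normrN1 ?normr1.
  by rewrite sumr_const card_ord -[X in X <= _]mulr_natl mulrA.
apply: II_le => // x; have S0 : 0 <= S x.
  by apply: sumr_ge0 => k _; rewrite addr_ge0.
rewrite indicE; case: (boolP (x \in _)) => [|_]; last by rewrite mulr0 normr0.
rewrite inE /= => hx; rewrite mulr1.
(* Otherwise |x|^2 <= d c^2 <= 1/16, whereas |x|^2 > 1 - 4 dl >= 1/2 in the shell. *)
have [k hk] : exists k, c < `|x ord0 k|.
  apply: contrapT => hn; have xc : `|x| <= c.
    apply/rV_norm_leP; split=> [|k]; first exact: ltW.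
    by rewrite leNgt; apply/negP => hk; apply: hn; exists k.
  have x2 : `|x| ^+ 2 <= c ^+ 2 by apply: lerXn2r => //; rewrite nnegrE// ltW.
  have h16 : sq x <= 1 / 16.
    rewrite (le_trans (sq_le_norm x))// (le_trans (ler_wpM2l (ltW d0) x2))//.
    have -> : d%:R * c ^+ 2 = d%:R^-1 / 16 by rewrite /c; field; rewrite gt_eqF.
    by rewrite ler_wpM2r// invf_le1.
  by move: hx h16 => /andP[]; lra.
have term0 j : 0 <= `|u x * \1_(A j 1) x| + `|u x * \1_(A j (-1)) x| by rewrite addr_ge0.
rewrite /S (bigD1 k)//=; apply: (@le_trans _ _ (`|u x * \1_(A k 1) x| + `|u x * \1_(A k (-1)) x|));
  last by rewrite lerDl sumr_ge0.
have [xk|xk] := leP 0 (x ord0 k).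
  rewrite ger0_norm// in hk; rewrite [X in _ <= X + _](_ : _ = `|u x|) ?lerDl//.
  by rewrite indicE mem_set ?mulr1//; split=> //; rewrite mul1r.
rewrite ltr0_norm// in hk; rewrite [X in _ <= _ + X](_ : _ = `|u x|) ?lerDr//.
by rewrite indicE mem_set ?mulr1//; split=> //; rewrite mulN1r.
Qed.

Lemma II_indic_scale (A A' : set rV) s M : 0 < s -> measurable A' ->
  (forall x, A' x -> `|x| <= M) -> (forall x, A' (s *: x) <-> A x) ->
  II (\1_A' : rV -> R) = s ^+ d * II (\1_A : rV -> R).
Proof.
move=> s0 mA' hA' AA'; rewrite (II_affn 0 s0 (itg_indic mA' hA')); congr (_ * II _).
apply/funext => x; rewrite /affn addr0 !indicE.
suff -> : (s *: x \in A') = (x \in A) by [].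
by apply/idP/idP; rewrite !inE => /AA'.
Qed.

(** The sphere and the ball of radius 1 - dl are disjoint in the closed unit ball of measure b. The
    smaller ball has measure (1 - dl)^d b, so by Bernoulli's inequality the sphere has measure at
    most d b dl. *)
Lemma sphere_null : {ae mu, forall x : rV, sq x <> 1}.
Proof.
pose E r := [set x : rV | sq x <= r]; pose S := [set x : rV | sq x = 1].
have hE r x : r <= 1 -> E r x -> `|x| <= 1.
  by move=> r1 h; apply: norm_le1_sq; exact: le_trans h r1.
have mE r : measurable (E r).
  rewrite (_ : E r = ~` [set x | r < sq x]); first by apply: measurableC; exact: measurable_sq_gt.
  apply/seteqP; split=> x h; first by apply/negP; rewrite -leNgt.
  by rewrite /E /= leNgt; apply/negP.
have mS : measurable S.
  rewrite (_ : S = E 1 `&` ~` [set x | sq x < 1]).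
    by apply: measurableI => //; apply: measurableC; exact: measurable_sq_lt.
  apply/seteqP; split=> x /=; rewrite /S /E /=; first by move=> ->; split=> //; rewrite ltxx.
  by move=> [h1 /negP]; rewrite -leNgt => h2; apply/eqP; rewrite eq_le h1 h2.
have hS x : S x -> `|x| <= 1 by move=> h; apply: norm_le1_sq; rewrite h.
have iS := itg_indic mS hS; have iE r (r1 : r <= 1) := itg_indic (mE r) (fun x => @hE r x r1).
pose b := II (\1_(E 1) : rV -> R); have b0 : 0 <= b.
  by apply: II_ge0 => x; have /andP[] := indic_itv (E 1) x.
have key dl : 0 < dl -> dl < 1 -> II (\1_S : rV -> R) <= d%:R * b * dl.
  move=> dl0 dl1; have s0 : 0 < 1 - dl by lra.
  have s21 : (1 - dl) ^+ 2 < 1 by rewrite exprn_ilt1//; lra.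
  have eE : II (\1_(E ((1 - dl) ^+ 2)) : rV -> R) = (1 - dl) ^+ d * b.
    apply: (II_indic_scale (M := 1)) => // [x|x]; first exact: hE (ltW s21).
    rewrite /E /= sq_scale -[X in _ <= X]mulr1 ler_pM2l//.
    by rewrite exprn_gt0.
  have : II (fun x => \1_S x + \1_(E ((1 - dl) ^+ 2)) x) <= b.
    apply: II_le => [||x]; [exact: itgD (iE _ (ltW s21))|exact: iE|].
    rewrite !indicE; have [xS|xS] := boolP (x \in S).
      rewrite inE in xS; rewrite memNset ?addr0; last first.
        by rewrite /E /= xS => /(lt_le_trans s21); rewrite ltxx.
      by rewrite mem_set// /E /= xS.
    have [xE|xE] := boolP (x \in E _); last by rewrite addr0.
    by rewrite inE in xE; rewrite add0r mem_set//; exact: le_trans xE (ltW s21).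
  rewrite IID//; last exact: iE (ltW s21).
  rewrite eE => h; have := bernoulli_le d (ltW dl0) (ltW dl1) => hb.
  have := ler_wpM2r b0 hb; rewrite mulrBl mul1r; move: h; lra.
have S0 : 0 <= II (\1_S : rV -> R) by apply: II_ge0 => x; have /andP[] := indic_itv S x.
have e0 : II (\1_S : rV -> R) = 0.
  apply/eqP; rewrite eq_le S0 andbT; apply/ler_addgt0Pr => e e0; rewrite add0r.
  pose K := d%:R * b; have K0 : 0 <= K by rewrite mulr_ge0.
  have Ke : 0 < K + e + e by lra.
  have := key (e / (K + e + e)); rewrite divr_gt0// ltr_pdivrMr// mul1r.
  rewrite (_ : e < K + e + e)//; last by lra.
  move=> /(_ isT isT) h; rewrite (le_trans h)// mulrA ler_pdivrMr// -/K mulrC ler_pM2l//; lra.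
exists S; split=> //; last by move=> x /= /contrapT.
rewrite II_indic// in e0.
have foo : (mu S < +oo)%E.
  apply: le_lt_trans (mu_cball_lty 1); apply: le_measure; rewrite ?inE//.
  exact: measurable_cball.
have fS : (mu S \is a fin_num)%E by rewrite ge0_fin_numE.
by rewrite -(fineK fS) e0.
Qed.

Variable kap : R.
Hypothesis defect : forall s, 0 < s -> s < 1 ->
  {ae mu, forall x, sq x < 1 -> homogeneity_defect u s x = kap * (1 - s)}.

(* [u - kap * fcone] is 1-homogeneous in the ball, so its mass in a shell of
   width [dl] is of order [dl], whereas [shell_bound] gives order [dl ^+ 2]. *)
Lemma interior_eq : {ae mu, forall x, sq x < 1 -> u x = kap * fcone x}.
Proof.
pose q x := u x + - kap * fcone x.
have lq : locint q by apply: locintD => //; apply: locintZ; exact: locint_fcone.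
have qhom s : 0 < s -> s < 1 -> {ae mu, forall x, sq x < 1 -> q (s *: x) = s * q x}.
  move=> s0 s1; apply: filterS (defect s0 s1) => x h x1; have := h x1.
  rewrite /homogeneity_defect /q.
  have sx : sq (s *: x) <= 1.
    by rewrite sq_scale mulr_ile1 ?sqr_ge0 ?sq_ge0 ?ltW// exprn_ilt1// ltW.
  rewrite !fcone_inner ?(ltW x1)// sq_scale sqrtrM ?sqr_ge0// sqrtr_sqr gtr0_norm// => e.
  have -> : u (s *: x) = s * u x + kap * (1 - s) by rewrite -e; ring.
  ring.
pose B r := [set x : rV | sq x < r].
have mB r : measurable (B r) by exact: measurable_sq_lt.
have hB r x : r <= 1 -> B r x -> `|x| <= 1.
  by move=> r1 h; apply: norm_le1_sq; exact: le_trans (ltW h) r1.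
have iq r (r1 : r <= 1) := itg_set lq (mB r) (fun x => @hB r x r1).
pose I := II (fun x => `|q x * \1_(B 1) x|).
have I0 : 0 <= I by exact: II_ge0.
have Is s : 0 < s -> s < 1 -> II (fun x => `|q x * \1_(B (s ^+ 2)) x|) = s ^+ d.+1 * I.
  move=> s0 s1; have s21 : s ^+ 2 <= 1 by rewrite exprn_ile1// ltW.
  rewrite (II_affn 0 s0 (iq _ s21)) [s ^+ d.+1]exprSr -mulrA; congr (_ * _).
  rewrite /I -IIZ; last exact: iq.
  have [mq _] := lq.
  apply: II_ae.
  - exact: itg_meas (itg_affn 0 s0 (iq _ s21)).
  - by apply: itg_meas; apply: itgZ; exact: iq.
  - apply: filterS (qhom s s0 s1) => x h; rewrite /affn addr0 !indicE.
    have -> : (s *: x \in B (s ^+ 2)) = (x \in B 1).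
      by apply/idP/idP; rewrite !inE /B /= sq_scale gtr_pMr ?exprn_gt0.
    have [|_] := boolP (x \in B 1); last by rewrite !mulr0 normr0 mulr0.
    by rewrite inE => /h ->; rewrite !mulr1 normrM gtr0_norm.
have [C C0 hC] := shell_bound.
pose b := II (\1_(B 1) : rV -> R).
have b0 : 0 <= b by apply: II_ge0 => x; have /andP[] := indic_itv (B 1) x.
have i1 r (r1 : r <= 1) := itg_indic (mB r) (fun x => @hB r x r1).
(* C dl^2 bounds the mass of u in the shell; the rest bounds that of kap fcone, where the cone is at
   most dl and the shell has measure at most d dl b. *)
pose K := C + `|kap| * (d%:R * b); have K0 : 0 <= K by rewrite addr_ge0// !mulr_ge0.
have key dl : 0 < dl -> dl <= 1 / 8 -> I <= K * dl.
  move=> dl0 dl8; pose s := 1 - dl; have s0 : 0 < s by rewrite /s; lra.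
  have s1 : s < 1 by rewrite /s; lra.
  have s21 : s ^+ 2 <= 1 by rewrite exprn_ile1// ltW.
  have bs : II (\1_(B (s ^+ 2)) : rV -> R) = s ^+ d * b.
    apply: (II_indic_scale (M := 1)) => // [x|x]; first exact: hB.
    by rewrite /B /= sq_scale gtr_pMr ?exprn_gt0.
  have mSh : measurable [set x : rV | 1 - 4 * dl < sq x < 1].
    rewrite (_ : mkset _ = [set x | 1 - 4 * dl < sq x] `&` [set x | sq x < 1]).
      by apply: measurableI; [exact: measurable_sq_gt|exact: measurable_sq_lt].
    by apply/seteqP; split=> x /= => [/andP[]|[-> ->]].
  have hSh x : [set x : rV | 1 - 4 * dl < sq x < 1] x -> `|x| <= 1.
    by move=> /andP[_ h2]; apply: norm_le1_sq; exact: ltW.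
  have iSh := itg_set lu mSh hSh.
  have iD : itg (fun x => \1_(B 1) x - \1_(B (s ^+ 2)) x : R) by apply: itgB; exact: i1.
  have : II (fun x => `|q x * \1_(B 1) x| - `|q x * \1_(B (s ^+ 2)) x|) <=
      II (fun x => `|u x * \1_[set x | 1 - 4 * dl < sq x < 1] x| +
        (`|kap| * dl) * (\1_(B 1) x - \1_(B (s ^+ 2)) x)).
    apply: II_le => [||x].
    - by apply: itgB; exact: iq.
    - by apply: itgD => //; exact: itgZ.
    - rewrite !indicE; have [x1|x1] := boolP (x \in B 1); last first.
        rewrite (memNset (A := B (s ^+ 2))); last first.
          by rewrite notin_setE in x1 => h; apply: x1; exact: lt_le_trans h s21.
        by rewrite !mulr0 normr0 subrr mulr0 addr0.
      rewrite inE in x1; have [xs|xs] := boolP (x \in B (s ^+ 2)).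
        by rewrite !subrr mulr0 addr0.
      rewrite notin_setE /B /= in xs; move/negP: xs; rewrite -leNgt => xs.
      have s2 : 1 - 4 * dl < s ^+ 2 by rewrite /s; nra.
      rewrite mem_set; last by rewrite /= x1 (lt_le_trans s2 xs).
      rewrite !mulr1 mulr0 normr0 !subr0 mulr1 /q (le_trans (ler_normD _ _))// lerD2l.
      rewrite normrM normrN ler_wpM2l// fcone_inner ?(ltW x1)//.
      have h1 : s <= Num.sqrt (sq x).
        by rewrite -[s]gtr0_norm// -sqrtr_sqr ler_wsqrtr.
      have h2 : Num.sqrt (sq x) <= 1 by rewrite -[leRHS]sqrtr1 ler_wsqrtr// ltW.
      by rewrite ger0_norm ?subr_ge0//; move: h1; rewrite /s; lra.
  rewrite IIB; [|exact: iq..]; rewrite -/I Is//.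
  rewrite IID//; last exact: itgZ.
  rewrite IIZ// IIB; [|exact: i1..]; rewrite -/b bs => h.
  have h1 := hC dl dl0 dl8.
  have hb := bernoulli_le d (ltW dl0) (_ : dl <= 1); have dl1 : dl <= 1 by lra.
  have h2 : b - s ^+ d * b <= d%:R * dl * b.
    by have := ler_wpM2r b0 (hb dl1); rewrite mulrBl mul1r -/s; lra.
  have h3 : `|kap| * dl * (b - s ^+ d * b) <= `|kap| * dl * (d%:R * dl * b).
    by rewrite ler_wpM2l// mulr_ge0// ltW.
  (* Homogeneity at work: the ball of radius s carries at most the share s of the mass, so the shell
     carries at least dl * I. *)
  have h4 : s ^+ d.+1 * I <= s * I.
    by rewrite ler_wpM2r// exprS ler_piMr ?(ltW s0)// exprn_ile1// ltW.
  have h5 : dl * I <= dl * (K * dl).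
    have -> : dl * (K * dl) = C * dl ^+ 2 + `|kap| * dl * (d%:R * dl * b) by rewrite /K; ring.
    have -> : dl * I = I - s * I by rewrite /s; ring.
    by move: h h1 h3 h4; lra.
  by rewrite ler_pM2l in h5.
have I00 : I = 0.
  apply/eqP; rewrite eq_le I0 andbT leNgt; apply/negP => Ip.
  pose e := Num.min (1 / 8) (I / (K + 1)).
  have K1 : 0 < K + 1 by lra.
  have e0 : 0 < e by rewrite lt_min divr_gt0//= divr_gt0.
  have := key e e0; rewrite /e ge_min lexx => /(_ isT) h.
  have : K * Num.min (1 / 8) (I / (K + 1)) <= K * (I / (K + 1)).
    by rewrite ler_wpM2l// ge_min lexx orbT.
  have : K * (I / (K + 1)) < I.
    by rewrite mulrCA gtr_pMr// ltr_pdivrMr// mul1r ltrDl.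
  by lra.
pose rho (x : rV) := 1 - sq x.
have cr : cls rho by apply: clsB; [exact: cls_cst|exact: cls_sq].
suff : {ae mu, forall x, 0 < rho x -> q x = 0}.
  apply: filterS => x h x1; have := h; rewrite /rho subr_gt0 => /(_ x1).
  by rewrite /q mulNr => /eqP; rewrite subr_eq0 => /eqP.
apply: fundamental_lemma => // psi [cp [M hM] [dl dl0 hdl]].
have [Cp Cp0 hCp] := bsup_bounded (cls_cont cp) hM.
have iqp : itg (fun x => q x * psi x) by apply: itg_test hM => //; exact: cls_cont.
have : `|II (fun x => q x * psi x)| <= Cp * I.
  rewrite (le_trans (II_norm iqp))// /I -IIZ; last exact: iq.
  apply: II_le => [||x]; [exact: itg_norm|by apply: itgZ; exact: iq|].
  have [->|px] := eqVneq (psi x) 0; first by rewrite mulr0 normr0 mulr_ge0.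
  have x1 : sq x < 1 by have := hdl x px; rewrite /rho; lra.
  by rewrite indicE mem_set// mulr1 normrM mulrC ler_wpM2r.
by rewrite I00 mulr0 normr_le0 => /eqP.
Qed.

Lemma cone_eq : {ae mu, forall x, u x = kap * fcone x}.
Proof.
apply: filterS3 null interior_eq sphere_null => x h1 h2 h3.
have [x1|x1|//] := ltgtP (sq x) 1; first exact: h2.
by rewrite h1// fcone_outer ?mulr0// ltW.
Qed.

End shell_estimate.

(** * Identification of the components *)

Section linear_form.
Context {R : realType} {d : nat}.

Definition linear_form (g : 'rV[R]_d) (x : 'rV[R]_d) : R^o := \sum_i x ord0 i * g ord0 i.

Fact linear_form_is_linear g : linear (linear_form g).
Proof.
move=> a x y; rewrite /linear_form /GRing.scale/= mulr_sumr -big_split/=.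
by apply: eq_bigr => i _; rewrite !mxE mulrDl mulrA.
Qed.

HB.instance Definition _ g := GRing.isLinear.Build R 'rV[R]_d R^o _ (linear_form g)
  (linear_form_is_linear g).

End linear_form.

Section component.
Context {R : realType} {n : nat}.
Local Notation d := n.+1.
Local Notation rV := 'rV[R]_d.
Local Notation mu := (@lebesgue_measure_rV R d).
Implicit Types (f g phi : rV -> R) (E G : rV -> 'M[R]_d).

Lemma cls_linear_form (g : rV) (c : R) : cls (fun x => c + linear_form g x).
Proof.
apply: clsD; first exact: cls_cst.
by apply: cls_sum => i; apply: clsM; [exact: cls_coord|exact: cls_cst].
Qed.

Lemma partial_linear_form (g : rV) (c : R) i :
  partial i (fun x => c + linear_form g x) = fun=> g ord0 i.
Proof.
have cj j : cls (fun x : rV => x ord0 j * g ord0 j).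
  by apply: clsM; [exact: cls_coord|exact: cls_cst].
apply/funext => x; rewrite partialDE; [|exact: cls_cst|exact: cls_sum].
rewrite partial_cst add0r /linear_form partial_sumE//.
rewrite -(sum_delta (fun j => g ord0 j) i); apply: eq_bigr => j _.
by rewrite (partialME i (cls_coord j) (cls_cst _)) partial_cst partial_coord mulr0 add0r.
Qed.

(** One integration by parts leaves constants times integrals of derivatives, which vanish.
    Subtracting an affine function thus changes no pairing. *)
Lemma pairing_linear_form (g : rV) (c : R) G : tfield G ->
  pairing (fun x => c + linear_form g x) G = 0.
Proof.
move=> [sG [M hM]]; set L := fun x => _.
have cL : cls L by exact: cls_linear_form.
have pL i : partial i L = fun=> g ord0 i by exact: partial_linear_form.
have bM i j := mbsup_entry i j hM.
have i1 i j : itg (fun x => L x * partial i (partial j (fun y => G y i j)) x).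
  apply: (@itg_test _ _ _ _ M); first exact/locint_cont/cls_cont.
    by apply: smooth_cont; apply: smooth_partial; exact: smooth_partial.
  by do 2 apply: partial_bsup.
rewrite pairingE (_ : (fun x => _) = (fun x => \sum_i \sum_j
    L x * partial i (partial j (fun y => G y i j)) x)); last first.
  by apply/funext => x; rewrite div2E mulr_sumr; apply: eq_bigr => i _; rewrite mulr_sumr.
rewrite II_sum; last by move=> i; exact: itg_sum.
rewrite big1// => i _; rewrite II_sum// big1// => j _.
have sj : smooth (partial j (fun y => G y i j)) by exact: smooth_partial.
have bj : bsup M (partial j (fun y => G y i j)) by exact: partial_bsup.
rewrite (ibp i (cls_smooth cL) sj bj) pL IIZ; last by apply: itg_bsup bj; exact: smooth_cont.
by rewrite (II_partial0 j (sG i j) (bM i j)) mulr0 oppr0.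
Qed.

Lemma half_space_buffer (z z' : R) : 0 < z - 2 -> 0 < z' - 2 -> exists2 eps : R, 0 < eps &
  forall t, - eps < t < 1 + eps -> 7 / 4 <= z + t * (z' - z).
Proof.
move=> hz hz'; pose D := `|z' - z|; have D1 : 0 < 4 * (D + 1).
  by have := normr_ge0 (z' - z); rewrite -/D; lra.
pose eps := (4 * (D + 1))^-1; have eps0 : 0 < eps by rewrite invr_gt0.
have epsD : eps * (4 * (D + 1)) = 1 by rewrite mulVf// gt_eqF.
have D0 : 0 <= D := normr_ge0 _.
have small s : `|s| <= eps -> `|s * (z' - z)| <= 1 / 4.
  move=> hs; rewrite normrM -/D; have := ler_wpM2r D0 hs; move: epsD; nra.
exists eps => // t /andP[t1 t2].
have [t0|t0] := leP 0 t; last first.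
  have := small t; rewrite ler_norml => /(_ _)/= h.
  have ht : - eps <= t <= eps by apply/andP; split; lra.
  by have := h ht; rewrite ler_norml => /andP[]; lra.
have [t3|t3] := leP t 1; first by nra.
have := small (t - 1); rewrite ler_norml => /(_ _)/= h.
have ht : - eps <= t - 1 <= eps by apply/andP; split; lra.
have := h ht; rewrite ler_norml => /andP[h1 _].
have -> : z + t * (z' - z) = z' + (t - 1) * (z' - z) by ring.
by lra.
Qed.

(** The extremal field cut off to a shell is admissible, and its pairing with the cone is c n times
    the integral of bump / |x|. *)
Lemma cone_variation_gt0 (q : \bar R) (c V : R) : (0 < n)%N -> (1 <= q)%E -> 0 < c ->
  (forall e : R, 0 < e -> exists2 t0 : R, 0 < t0 & forall (x : rV) tau, sq x != 0 ->
    `|tau| <= t0 -> schatten_norm q (extremal_mx c tau x) <= 1 + e * `|tau|) ->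
  (forall E : rV -> 'M[R]_d, admissible q E -> pairing fcone E <= V) -> 0 < V.
Proof.
move=> n0 q1 c0 perturb upper; pose a : R := 1 / 4.
have a0 : 0 < a by rewrite /a; lra.
have a1 : a < 1 by rewrite /a; lra.
have k0 : 0 < 20 :> R by [].
have ki0 : 0 < 20^-1 :> R by rewrite invr_gt0.
pose E (x : rV) := bump a 20 x *: extremal_field c a x.
have hE x : E x != 0 -> 20^-1 <= shell a x.
  by rewrite scaler_eq0 negb_or => /andP[/(bump_neq0 k0)].
have b1 : bsup 1 (bump a 20 : rV -> R).
  by move=> x /(shell_outer a1) h; exact: bump_le0.
have tE : tfield E.
  split=> [i j|].
    apply: eq_smooth (smoothM (cls_smooth (cls_bump a 20))
      (cls_smooth (mcls_extremal_field c a0 i j))) => x.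
    by rewrite [RHS]mxE.
  by exists 1 => x /b1 h; rewrite /E h scale0r.
have aE : admissible q E.
  split=> // x; have [b0|b0] := eqVneq (bump a 20 x) 0.
    by rewrite /E b0 scale0r (schatten0 q1).
  apply: (schatten_cutoff q1); first exact: step_itv.
  have /andP[ax _] := shell_gt0 a1 (lt_le_trans ki0 (bump_neq0 k0 b0)).
  by apply: (schatten_extremal_field perturb a0); exact: ltW.
have [iE eE] := pairing_inner a0 a1 ki0 tE hE.
apply: lt_le_trans (upper E aE); rewrite eE.
have cn : 0 < c * n%:R by rewrite mulr_gt0// ltr0n.
have -> : (fun x => - irad a x * \tr (proj_mx x *m E x)) =
    (fun x => (c * n%:R) * (irad a x * bump a 20 x)).
  apply/funext => x; rewrite /E; have [->|b0] := eqVneq (bump a 20 x) 0.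
    by rewrite scale0r mulmx0 linear0 !mulr0.
  have /andP[ax _] := shell_gt0 a1 (lt_le_trans ki0 (bump_neq0 k0 b0)).
  have x0 : sq x != 0 by rewrite gt_eqF// (lt_trans a0).
  rewrite (extremal_fieldE c (ltW ax)) /extremal_mx mul0r scale0r addr0.
  by rewrite -!scalemxAr proj_mx_idem// !mxtraceZ tr_proj_mx//; ring.
have cb : cls (fun x : rV => irad a x * bump a 20 x).
  by apply: clsM; [exact: cls_irad|exact: cls_bump].
have ib : itg (fun x : rV => irad a x * bump a 20 x).
  by apply: (itg_bsup (M := 1)); [exact: cls_cont|move=> x /b1 ->; rewrite mulr0].
rewrite IIZ// mulr_gt0//.
(* |x0|^2 = 5/8 is the middle of the shell 1/4 < |x|^2 < 1; there 20 * shell = 20 * 9/64 exceeds 2,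
   so the bump is 1. *)
pose x0 : rV := Num.sqrt (5 / 8) *: delta_mx ord0 ord0.
have s0 : sq x0 = 5 / 8.
  rewrite /x0 -[X in sq X]add0r sq_addZ_delta !mxE mulr0 addr0 sqr_sqrtr; last by lra.
  by rewrite /sq big1 ?add0r// => i _; rewrite mxE expr0n.
apply: (@II_gt0 _ _ _ x0) => //; first exact: cls_cont.
  by move=> x; rewrite mulr_ge0 ?irad_ge0//; have /andP[] := step_itv (20 * shell a x - 1).
rewrite bump_eq1; last by rewrite /shell s0 /a; lra.
by rewrite mulr1 /irad invr_gt0 sqrtr_gt0 reg_gt0.
Qed.

Variables (q : \bar R) (c V lam : R) (f1 : rV -> R).
Hypothesis n0 : (0 < n)%N.
Hypothesis q1 : (1 <= q)%E.
Hypothesis c0 : 0 < c.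
Hypothesis hoelder : forall (x : rV) (M : 'M[R]_d), sq x != 0 -> schatten_norm q M <= 1 ->
  `|\tr (proj_mx x *m M)| <= c * n%:R.
Hypothesis perturb : forall e : R, 0 < e -> exists2 t0 : R, 0 < t0 &
  forall (x : rV) tau, sq x != 0 ->
  `|tau| <= t0 -> schatten_norm q (extremal_mx c tau x) <= 1 + e * `|tau|.
Hypothesis lf1 : locint f1.
Hypothesis lam0 : 0 < lam.
Hypothesis maximizing : forall e : R, 0 < e ->
  exists2 E : rV -> 'M[R]_d, admissible q E & V - e <= pairing fcone E.
Hypothesis transfer : forall (E : rV -> 'M[R]_d) (e : R), admissible q E ->
  V - lam * e <= pairing fcone E -> V - e <= pairing f1 E.
Hypothesis upper : forall E : rV -> 'M[R]_d, admissible q E -> pairing f1 E <= V.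
Hypothesis upper_cone : forall E : rV -> 'M[R]_d, admissible q E -> pairing fcone E <= V.

Lemma component_eq : exists2 L, affine L & {ae mu, forall x, f1 x = fcone x + L x}.
Proof.
have outer G : tfield G -> supp_outer G -> pairing f1 G = 0.
  exact: (pairing_outer q1 lf1 lam0 maximizing transfer upper).
(* The affine part is found on the half-space x_0 > 2. Slightly extended segments stay in x_0 >= 7/4
   and their neighbourhoods of radius 1/2 in x_0 >= 5/4, where |x|^2 - 1 >= 9/16, more than the
   required 1/4. *)
pose rho (x : rV) := sq x - 1; pose rho' (x : rV) := x ord0 ord0 - 2.
have cr' : cls rho' by apply: clsB; [exact: cls_coord|exact: cls_cst].
have h12 : 0 < 1 / 2 :> R by lra.
have h14 : 0 < 1 / 4 :> R by lra.
have weak phi v : test_in rho phi -> II (fun x => f1 x * dirg v (dirg v phi) x) = 0.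
  move=> [cp [M hM] [dl dl0 hdl]]; rewrite -pairing_rank1_cst//; apply: outer.
    exact: tfield_rank1 hM.
  exists dl => // x; rewrite scaler_eq0 negb_or => /andP[/hdl + _].
  by rewrite /rho lerBrDl.
have buf (z z' : rV) : 0 < rho' z -> 0 < rho' z' -> exists2 eps : R, 0 < eps &
    forall t (y : rV), - eps < t < 1 + eps -> `|y - (z + t *: (z' - z))| <= 1 / 2 -> 1 / 4 <= rho y.
  move=> hz hz'; have [eps eps0 h] := half_space_buffer hz hz'.
  exists eps => // t y /h ht hy.
  have := le_trans (coord_le_norm _ ord0) hy.
  rewrite !mxE ler_norml => /andP[hy1 _].
  have y0 : 5 / 4 <= y ord0 ord0 by move: hy1 ht; lra.
  by rewrite /rho lerBrDr (le_trans _ (coord_le_sq y ord0))//; nra.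
pose z0 : rV := 3 *: delta_mx ord0 ord0.
have z00 : 0 < rho' z0 by rewrite /rho' !mxE eqxx mulr1; lra.
have [psi _ aeL] := weak_affine lf1 cr' h12 h14 weak buf z00.
set A := II (fun y => f1 y * psi y) in aeL.
pose G i := II (fun y => f1 y * partial i psi y).
pose g : rV := \row_i - G i; pose k := A + \sum_i z0 ord0 i * G i.
pose L x := k + linear_form g x.
have LE x : L x = A - \sum_i (x ord0 i - z0 ord0 i) * G i.
  rewrite /L /k /linear_form -addrA -big_split/= -sumrN; congr (_ + _).
  by apply: eq_bigr => i _; rewrite [g _ _]mxE; ring.
have cL : cls L by exact: cls_linear_form.
have lL : locint L by apply: locint_cont; exact: cls_cont.
pose u x := f1 x + -1 * L x.
have lu : locint u by apply: locintD => //; exact: locintZ.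
have pu E : tfield E -> pairing u E = pairing f1 E.
  move=> tE; rewrite /u pairingDl//; last exact: locintZ.
  by rewrite pairingZl// pairing_linear_form// mulr0 addr0.
have uouter E : tfield E -> supp_outer E -> pairing u E = 0.
  by move=> tE sE; rewrite pu// outer.
have uhalf : {ae mu, forall x : rV, 2 < x ord0 ord0 -> u x = 0}.
  apply: filterS aeL => x h x2; rewrite /u LE h ?subr_gt0// -/(G _).
  by rewrite mulN1r subrr.
pose k1 : 'I_d := Ordinal (n0 : (1 < n.+1)%N).
have k01 : ord0 != k1 by [].
have unull := exterior_null lu uouter k01 uhalf.
have tcol (phi : rV -> R) (kk : 'I_d) (dl : R) : 0 < dl -> cls phi -> (forall x, phi x != 0 -> sq x <= 1 - dl) ->
    tfield (fun x => phi x *: column_field kk x).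
  move=> dl0 cp hs; split=> [i j|].
    apply: eq_smooth (smoothM (cls_smooth cp) (cls_smooth (mcls_column_field kk i j))) => x.
    by rewrite [RHS]mxE.
  exists 1 => x x1; have [->|/hs h] := eqVneq (phi x) 0; first by rewrite scale0r.
  have := norm_le1_sq (le_trans h (_ : 1 - dl <= 1)); rewrite lerBlDr lerDl => /(_ (ltW dl0)).
  by rewrite leNgt x1.
have ucol (kk : 'I_d) (phi : rV -> R) (dl : R) : 0 < dl -> cls phi -> (forall x, phi x != 0 -> sq x <= 1 - dl) ->
    pairing u (fun x => phi x *: column_field kk x) = 0.
  move=> dl0 cp hs; rewrite pu; last exact: tcol hs.
  exact: (pairing_column n0 q1 c0 hoelder perturb lf1 lam0 maximizing transfer upper kk dl0 cp hs).
(* Positivity serves twice: in the constant C V of [ubound], and to divide by V when kap is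
   computed. *)
have V0 : 0 < V := cone_variation_gt0 n0 q1 c0 perturb upper_cone.
have ubound : exists2 C : R, 0 < C & forall (B : R) E, 0 < B -> tfield E ->
    (forall x i j, `|E x i j| <= B) -> `|pairing u E| <= C * B.
  have [C C0 hC] := pairing_entry_bound q1 lf1 upper.
  exists (C * V) => [|B E B0 tE hE]; first by rewrite mulr_gt0.
  by rewrite pu// mulrAC; exact: hC.
have [kap defect] := defect_linear lu ucol.
have ucone := cone_eq lu ubound unull defect.
have lc : locint (@fcone R d) by exact: locint_fcone.
have puk E : tfield E -> pairing f1 E = kap * pairing fcone E.
  move=> tE; rewrite -pu// -pairingZl// !pairingE; have [sE [M hM]] := tE.
  have [cE bE] := div2_cont_bsup sE hM.
  have mE := continuous_measurable_rV cE; have [mu' _] := lu; have [mc _] := lc.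
  apply: II_ae.
  - exact: measurable_funM.
  - by apply: measurable_funM => //; exact: (measurable_funM (f := cst kap)).
  - by apply: filterS ucone => x ->.
(* T_f1 is kap times T_cone. On an almost maximizing field, with P its pairing with the cone, both P
   and kap P are close to V, so V = kap V. *)
have kap1 : kap = 1.
  suff h : `|V - kap * V| <= 0.
    move: h; rewrite normr_le0 subr_eq0 => /eqP h.
    have Vn0 : V != 0 by rewrite gt_eqF.
    by apply: (mulIf Vn0); rewrite -h mul1r.
  have K0 : 0 < 1 + `|kap| * lam by rewrite ltr_pwDl// mulr_ge0// ltW.
  apply/ler_addgt0Pr => e e0; rewrite add0r.
  pose e' := e / (1 + `|kap| * lam); have e'0 : 0 < e' by rewrite divr_gt0.
  have [E aE hE] := maximizing (mulr_gt0 lam0 e'0); have [tE _] := aE.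
  have h1 := transfer aE hE; have h2 := upper aE; have h3 := upper_cone aE.
  rewrite (puk _ tE) in h1 h2; set P := pairing fcone E in hE h1 h2 h3.
  have -> : V - kap * V = (V - kap * P) + kap * (P - V) by ring.
  rewrite (le_trans (ler_normD _ _))// normrM.
  have n1 : `|V - kap * P| <= e' by rewrite ler_norml; apply/andP; split; lra.
  have n2 : `|P - V| <= lam * e' by rewrite ler_norml; apply/andP; split; lra.
  have n3 := ler_wpM2l (normr_ge0 kap) n2.
  have -> : e = e' + `|kap| * (lam * e') by rewrite /e'; field; rewrite gt_eqF.
  exact: lerD.
exists L; first by exists (linear_form g), k => x; rewrite /L addrC.
apply: filterS ucone => x; rewrite /u kap1 mul1r => <-; ring.
Qed.

End component.

(** The common variation is finite because that of f1 is, so almost maximizing fields exist for the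
    cone. Since T_cone = lam T_f1 + (1 - lam) T_f2 and T_f2 <= V, the bound T_cone(E) >= V - lam e
    forces T_f1(E) >= V - e. *)
Lemma variation_component (R : realType) (n : nat) (p lam : R) (f1 f2 : 'rV[R]_n.+1 -> R) :
  (0 < n)%N -> 1 <= p -> locint f1 -> locint f2 ->
  bounded_hessian_schatten_variation p%:E f1 ->
  hessian_schatten_variation p%:E f1 [set: 'rV[R]_n.+1] = hessian_schatten_variation p%:E fcone [set: 'rV[R]_n.+1] ->
  hessian_schatten_variation p%:E f2 [set: 'rV[R]_n.+1] = hessian_schatten_variation p%:E fcone [set: 'rV[R]_n.+1] ->
  0 < lam < 1 ->
  {ae @lebesgue_measure_rV R n.+1, forall x, fcone x = lam * f1 x + (1 - lam) * f2 x} ->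
  exists2 L, affine L & {ae @lebesgue_measure_rV R n.+1, forall x, f1 x = fcone x + L x}.
Proof.
move=> n0 p1 lf1 lf2 b1 e1 e2 /andP[lam0 lam1] ae.
have [q1 [c c0 [hoelder perturb]]] := schatten_extremal n0 p1.
set q := hoelder_conjugate p%:E in q1 hoelder perturb.
have lc : locint (@fcone R n.+1) by exact: locint_fcone.
pose S (f : 'rV[R]_n.+1 -> R) := [set (pairing f E)%:E | E in [set E : 'rV[R]_n.+1 -> 'M[R]_n.+1 | admissible q E]] : set (\bar R).
have SE f : locint f -> hessian_schatten_variation p%:E f [set: 'rV[R]_n.+1] = ereal_sup (S f).
  by move=> lf; exact: hvarE.
have S0 f : (0%:E <= ereal_sup (S f))%E.
  apply: ereal_sup_ubound; exists (fun=> 0); last by rewrite pairing0.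
  by split=> [|x]; [exact: tfield0|rewrite (schatten0 q1)].
have fS : ereal_sup (S fcone) \is a fin_num.
  by rewrite ge0_fin_numE// -(SE _ lc) -e1.
pose V := fine (ereal_sup (S fcone)).
have VE : V%:E = ereal_sup (S fcone) by rewrite fineK.
have up f : ereal_sup (S f) = V%:E -> forall E : 'rV[R]_n.+1 -> 'M[R]_n.+1, admissible q E -> pairing f E <= V.
  by move=> fV E aE; rewrite -lee_fin -fV; apply: ereal_sup_ubound; exists E.
have upper := up f1 (etrans (esym (SE _ lf1)) (etrans e1 (etrans (SE _ lc) (esym VE)))).
have upper2 := up f2 (etrans (esym (SE _ lf2)) (etrans e2 (etrans (SE _ lc) (esym VE)))).
have upperc := up fcone (esym VE).
have maximizing (e : R) : 0 < e -> exists2 E : 'rV[R]_n.+1 -> 'M[R]_n.+1, admissible q E & V - e <= pairing fcone E.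
  move=> e0; have [_ [E aE <-] h] := ub_ereal_sup_adherent e0 fS.
  by exists E => //; rewrite -lee_fin EFinB VE ltW.
have transfer (E : 'rV[R]_n.+1 -> 'M[R]_n.+1) (e : R) : admissible q E -> V - lam * e <= pairing fcone E -> V - e <= pairing f1 E.
  move=> aE; have [tE _] := aE.
  have -> : pairing fcone E = lam * pairing f1 E + (1 - lam) * pairing f2 E.
    have l1 := locintZ lam lf1; have l2 := locintZ (1 - lam) lf2.
    rewrite -pairingZl// -[X in _ + X]pairingZl// -pairingDl// !pairingE.
    have [sE [M hM]] := tE; have [cE bE] := div2_cont_bsup sE hM.
    have mE := continuous_measurable_rV cE; have [mc _] := lc.
    have [m12 _] := locintD l1 l2.
    apply: II_ae; [exact: measurable_funM|exact: measurable_funM|].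
    by apply: filterS ae => x ->.
  have h2 := ler_wpM2l (_ : 0 <= 1 - lam) (upper2 E aE).
  rewrite subr_ge0 in h2; have {}h2 := h2 (ltW lam1).
  by move=> h; rewrite -(ler_pM2l lam0); move: h h2; nra.
exact: (component_eq n0 q1 c0 hoelder perturb lf1 lam0 maximizing transfer upper upperc).
Qed.

Theorem theorem3p1 (R : realType) (d : nat) (p : R)
    (f1 f2 : 'rV[R]_d -> R) (lambda : R) :
  (2 <= d)%N ->
  1 <= p ->
  locally_integrable_rV f1 ->
  locally_integrable_rV f2 ->
  bounded_hessian_schatten_variation p%:E f1 ->
  bounded_hessian_schatten_variation p%:E f2 ->
  hessian_schatten_variation p%:E f1 [set: 'rV[R]_d] =
    hessian_schatten_variation p%:E fcone [set: 'rV[R]_d] ->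
  hessian_schatten_variation p%:E f2 [set: 'rV[R]_d] =
    hessian_schatten_variation p%:E fcone [set: 'rV[R]_d] ->
  0 < lambda < 1 ->
  fcone = (fun x => lambda * f1 x + (1 - lambda) * f2 x)
    %[ae lebesgue_measure_rV d] ->
  exists L1 L2 : 'rV[R]_d -> R,
    [/\ affine L1, affine L2,
        f1 = (fun x => fcone x + L1 x) %[ae lebesgue_measure_rV d] &
        f2 = (fun x => fcone x + L2 x) %[ae lebesgue_measure_rV d]].
Proof.
case: d f1 f2 => [|n] f1 f2 // n0 p1 /locintP lf1 /locintP lf2 b1 b2 e1 e2 lam ae.
have ae1 : {ae @lebesgue_measure_rV R n.+1, forall x,
    fcone x = lambda * f1 x + (1 - lambda) * f2 x}.
  by apply: filterS ae => x; apply.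
(* The hypotheses are symmetric: f2 is the first component of the same combination with weight 1 -
   lambda. *)
have ae2 : {ae @lebesgue_measure_rV R n.+1, forall x,
    fcone x = (1 - lambda) * f2 x + (1 - (1 - lambda)) * f1 x}.
  by apply: filterS ae1 => x ->; ring.
have lam' : 0 < 1 - lambda < 1.
  by move: lam => /andP[l0 l1]; rewrite subr_gt0 l1 gtrBl.
have [L1 aL1 hL1] := variation_component n0 p1 lf1 lf2 b1 e1 e2 lam ae1.
have [L2 aL2 hL2] := variation_component n0 p1 lf2 lf1 b2 e2 e1 lam' ae2.
exists L1, L2; split=> //; first by apply: filterS hL1 => x.
by apply: filterS hL2 => x.
Qed.
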